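(* Let $(\mathcal P_t)_{t\ge0}$ be a decohering QMS. Let $t\mapsto p(t)$ be a twice continuously differentiable increasing real function in a neighbourhood of $0$ with $p(0)=q\ge1$, and let $t\mapsto Y(t)\in\mathcal B(\mathcal H)$ be twice continuously differentiable with $Y(t)$ positive definite in a neighbourhood of $0$; set $Y=Y(0)$. Then $\frac{d}{dt}\|Y(t)\|_{(q,p(t)),\mathcal N}\Big|_{t=0}=\frac{p'(0)}{q\|Y\|^{q-1}_{q,\sigma_{\mathrm{Tr}}}}\Big(\mathrm{Ent}_{q,\mathcal N}(Y)+\frac{q}{p'(0)}\mathrm{Tr}\big[(\Gamma^{1/q}(Y))^{q-1}\Gamma^{1/q}(Y'(0))\big]\Big)$.
   Context: $\mathcal H$ finite-dimensional of dimension $d_{\mathcal H}$; $\|Y\|_p=(\mathrm{Tr}|Y|^p)^{1/p}$. QMS $\mathcal P_t$ (unital completely positive maps), decohering = has a full-rank invariant state; $\mathcal N$ its decoherence-free algebra ($X$ with $\mathcal P_t(X^*X)=\mathcal P_t(X)^*\mathcal P_t(X)$, $\mathcal P_t(XX^* )=\mathcal P_t(X)\mathcal P_t(X)^*$ for all $t$), $E_{\mathcal N}$ the unique conditional expectation onto $\mathcal N$ with $\mathcal P_t(X-E_{\mathcal N}[X])\to0$, $E_{\mathcal N*}$ its predual, $\sigma_{\mathrm{Tr}}=E_{\mathcal N*}(\mathbb I/d_{\mathcal H})$. $\Gamma^s(X)=\sigma_{\mathrm{Tr}}^{s/2}X\sigma_{\mathrm{Tr}}^{s/2}$, $\|X\|_{p,\sigma_{\mathrm{Tr}}}=\|\Gamma^{1/p}(X)\|_p$.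 Amalgamated norms: for $1\le a\le b\le\infty$, $1/r=1/a-1/b$: $\|X\|_{(a,b),\mathcal N}=\inf\{\|A\|_{2r,\sigma_{\mathrm{Tr}}}\|B\|_{2r,\sigma_{\mathrm{Tr}}}\|Y\|_{b,\sigma_{\mathrm{Tr}}}:A,B\in\mathcal N,X=AYB\}$ and $\|X\|_{(b,a),\mathcal N}=\sup_{A,B\in\mathcal N}\|AXB\|_{a,\sigma_{\mathrm{Tr}}}/(\|A\|_{2r,\sigma_{\mathrm{Tr}}}\|B\|_{2r,\sigma_{\mathrm{Tr}}})$. For $Y>0$, $Z=\Gamma^{1/q}(Y)$: $\mathrm{Ent}_{q,\mathcal N}(Y)=\frac1q\mathrm{Tr}[Z^q(\ln Z^q-\ln\sigma_{\mathrm{Tr}}-\ln E_{\mathcal N}[\sigma_{\mathrm{Tr}}^{-1/2}Z^q\sigma_{\mathrm{Tr}}^{-1/2}])]$. *)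

(* Defs.v *)
(* mathcomp + mathcomp-analysis + real_closed complex numbers. *)
From HB Require Import structures.
From mathcomp Require Import all_boot all_order all_algebra.
From mathcomp Require Import all_classical all_reals all_analysis.
From mathcomp Require Export complex spectral.
Set Implicit Arguments. Unset Strict Implicit. Unset Printing Implicit Defensive.
Import Order.TTheory GRing.Theory Num.Theory numFieldNormedType.Exports.
Local Open Scope ring_scope.
Local Open Scope classical_set_scope.

Section QMSDefs.
Variable R : realType.
Local Notation C := R[i].

(** conjugate transpose *)
Definition adjmx m k (A : 'M[C]_(m, k)) : 'M[C]_(k, m) :=
  map_mx (fun z : C => z^*) A^T.

(** Hermitian, positive semidefinite, positive definite matrices *)
Definition mxherm k (A : 'M[C]_k) : Prop := adjmx A = A.
Definition mxpsd k (A : 'M[C]_k) : Prop :=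
  mxherm A /\ forall v : 'rV[C]_k, 0 <= (v *m A *m adjmx v) 0 0.
Definition mxpd k (A : 'M[C]_k) : Prop :=
  mxherm A /\ forall v : 'rV[C]_k, v != 0 -> 0 < (v *m A *m adjmx v) 0 0.

(** functional calculus f(A) = U^* diag(f(lambda_i)) U for a Hermitian
    (normal) matrix A, using the spectral theorem of mathcomp's spectral.v *)
Definition mfun k (f : R -> R) (A : 'M[C]_k) : 'M[C]_k :=
  invmx (spectralmx A) *m
  diag_mx (map_mx (fun z : C => (f (complex.Re z))%:C%C) (spectral_diag A)) *m
  spectralmx A.

Definition mpow k (s : R) (A : 'M[C]_k) : 'M[C]_k := mfun (fun x => x `^ s) A.
Definition mlog k (A : 'M[C]_k) : 'M[C]_k := mfun (@ln R) A.

(** |Y| = (Y^* Y)^{1/2} *)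
Definition mabs k (Y : 'M[C]_k) : 'M[C]_k := mpow (2^-1) (adjmx Y *m Y).

(** real part of the trace *)
Definition retr k (A : 'M[C]_k) : R := complex.Re (\tr A).

(** Schatten norm ||Y||_p, parametrised by th = 1/p in [0,1]:
    (Tr |Y|^p)^(1/p) for p finite, and the operator norm
    (largest eigenvalue of |Y|) for p = oo, i.e. th = 0. *)
Definition schatten_inv k (th : R) (Y : 'M[C]_k) : R :=
  if th == 0 then \big[Num.max/0]_(i < k) complex.Re (spectral_diag (mabs Y) 0 i)
  else (retr (mpow (th^-1) (mabs Y))) `^ th.

(** Gamma^s_sigma(X) = sigma^{s/2} X sigma^{s/2} *)
Definition Gammas k (sigma : 'M[C]_k) (s : R) (X : 'M[C]_k) : 'M[C]_k :=
  mpow (s / 2) sigma *m X *m mpow (s / 2) sigma.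

(** weighted norm ||X||_{p,sigma} = ||Gamma^{1/p}(X)||_p, with th = 1/p *)
Definition wnorm_inv k (sigma : 'M[C]_k) (th : R) (X : 'M[C]_k) : R :=
  schatten_inv th (Gammas sigma th X).

(** amalgamated norm ||X||_{(a,b),N} for 1 <= a <= b, 1/r = 1/a - 1/b
    (norms of A, B are ||.||_{2r,sigma}, i.e. th = (1/a - 1/b)/2) *)
Definition amalg_inf k (N : set 'M[C]_k) (sigma : 'M[C]_k) (a b : R)
    (X : 'M[C]_k) : R :=
  inf [set v : R | exists A B Y : 'M[C]_k,
        [/\ N A, N B, X = A *m Y *m B &
            v = wnorm_inv sigma ((a^-1 - b^-1) / 2) A
                * wnorm_inv sigma ((a^-1 - b^-1) / 2) B
                * wnorm_inv sigma (b^-1) Y]].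

(** amalgamated norm ||X||_{(b,a),N} for 1 <= a <= b (note the order of
    the arguments: first b, then a) *)
Definition amalg_sup k (N : set 'M[C]_k) (sigma : 'M[C]_k) (b a : R)
    (X : 'M[C]_k) : R :=
  sup [set v : R | exists A B : 'M[C]_k,
        [/\ N A, N B, A != 0, B != 0 &
            v = wnorm_inv sigma (a^-1) (A *m X *m B)
                / (wnorm_inv sigma ((a^-1 - b^-1) / 2) A
                   * wnorm_inv sigma ((a^-1 - b^-1) / 2) B)]].

(** ||X||_{(x,y),N} for arbitrary x, y >= 1: the first form if x <= y,
    the second form (with b = x, a = y) if x > y *)
Definition amalg k (N : set 'M[C]_k) (sigma : 'M[C]_k) (x y : R)
    (X : 'M[C]_k) : R :=
  if x <= y then amalg_inf N sigma x y X else amalg_sup N sigma x y X.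

(** complete positivity: id_m (x) f preserves positivity for every m *)
Definition completely_positive k (f : 'M[C]_k -> 'M[C]_k) : Prop :=
  forall (m : nat) (X : 'I_m -> 'I_m -> 'M[C]_k),
    mxpsd (\mxblock_(i < m, j < m) X i j) ->
    mxpsd (\mxblock_(i < m, j < m) f (X i j)).

Definition mx_linear k (f : 'M[C]_k -> 'M[C]_k) : Prop :=
  forall (c : C) (X Y : 'M[C]_k), f (c *: X + Y) = c *: f X + f Y.

(** quantum Markov semigroup (P_t)_{t >= 0} of unital completely positive
    maps on B(H) = 'M[C]_k, right-continuous at t = 0 *)
Definition is_QMS k (P : R -> 'M[C]_k -> 'M[C]_k) : Prop :=
  (forall t, 0 <= t -> mx_linear (P t)) /\
  (forall t, 0 <= t -> P t 1%:M = 1%:M) /\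
  (forall t, 0 <= t -> completely_positive (P t)) /\
  (forall X, P 0 X = X) /\
  (forall s t X, 0 <= s -> 0 <= t -> P (s + t) X = P s (P t X)) /\
  (forall X i j,
     (complex.Re (P x X i j) @[x --> 0^'+] --> complex.Re (X i j)) /\
     (complex.Im (P x X i j) @[x --> 0^'+] --> complex.Im (X i j))).

(** decohering: there is a full-rank (faithful) invariant state *)
Definition decohering k (P : R -> 'M[C]_k -> 'M[C]_k) : Prop :=
  exists rho : 'M[C]_k,
    [/\ mxpd rho, \tr rho = 1 &
        forall t X, 0 <= t -> \tr (rho *m P t X) = \tr (rho *m X)].

(** decoherence-free algebra N(P) *)
Definition dfa k (P : R -> 'M[C]_k -> 'M[C]_k) : set 'M[C]_k :=
  [set X | forall t, 0 <= t ->
     P t (adjmx X *m X) = adjmx (P t X) *m P t X /\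
     P t (X *m adjmx X) = P t X *m adjmx (P t X)].

(** E is a conditional expectation onto N(P) with P_t(X - E[X]) -> 0 *)
Definition is_dfa_cond_exp k (P : R -> 'M[C]_k -> 'M[C]_k)
    (E : 'M[C]_k -> 'M[C]_k) : Prop :=
  mx_linear E /\
  (forall X, dfa P (E X)) /\
  (forall X, dfa P X -> E X = X) /\
  completely_positive E /\
  (forall A B X, dfa P A -> dfa P B -> E (A *m X *m B) = A *m E X *m B) /\
  (forall X i j,
     (complex.Re (P x (X - E X) i j) @[x --> +oo] --> 0) /\
     (complex.Im (P x (X - E X) i j) @[x --> +oo] --> 0)).

(** sigma = E_* (I / d), characterised by duality Tr(sigma X) = Tr(E[X]) / d *)
Definition is_sigma_Tr k (E : 'M[C]_k -> 'M[C]_k) (sigma : 'M[C]_k) : Prop :=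
  forall X, \tr (sigma *m X) = \tr (E X) / k%:R.

(** Ent_{q,N}(Y) *)
Definition Ent_q k (E : 'M[C]_k -> 'M[C]_k) (sigma : 'M[C]_k) (q : R)
    (Y : 'M[C]_k) : R :=
  let Z := Gammas sigma (q^-1) Y in
  let Zq := mpow q Z in
  q^-1 * retr (Zq *m (mlog Zq - mlog sigma
                      - mlog (E (mpow (- 2^-1) sigma *m Zq *m mpow (- 2^-1) sigma)))).

(** f is C^2 on the open interval (-e, e) *)
Definition C2_near (e : R) (f : R -> R) : Prop :=
  forall t, `|t| < e ->
    [/\ derivable f t 1, derivable f^`() t 1 & {for t, continuous f^`()^`()}].

(** entrywise derivative at 0 of a matrix-valued function *)
Definition mderiv0 k (Y : R -> 'M[C]_k) : 'M[C]_k :=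
  \matrix_(i, j) Complex ((fun t => complex.Re (Y t i j))^`() 0)
                         ((fun t => complex.Im (Y t i j))^`() 0).

End QMSDefs.

(* Main.v *)
(**
  Put Z_t = Gamma^{1/p(t)}(Y(t)), s = 1/q - 1/p(t), W = Z_0^q and Q = tr W.
  Polar decomposition of the two factors A, B in N rewrites the p-th power of
  each competitor of the infimum (t > 0) or of the supremum (t < 0) as
  Phi(a, b) = tr (a^{-s/2} Z_t b^{-s} Z_t a^{-s/2})^{p/2} with a, b in N positive
  and tr (sigma a) = tr (sigma b) = 1. Adding a small multiple eta of the
  identity keeps the spectra of a and b in a compact subset of the positive
  axis, at the price of changing the constraint to 1 + eta, and then
    Phi(a, b) = Q + t (h - (p'(0) / 2q) tr W (ln a + ln b)) + o(t)
  uniformly in a and b. By Klein's inequality tr (W ln a) is maximal, up to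
  Q eta, at a_0 = E(sigma^{-1/2} W sigma^{-1/2}) / Q, and a = b = a_0 is itself
  admissible. So the p(t)-th power of the amalgamated norm has derivative
  h - (p'(0) / q) tr (W ln a_0) at 0; taking the p(t)-th root gives the formula.
*)
Require Import Defs.
From HB Require Import structures.
From mathcomp Require Import all_boot all_order all_algebra.
From mathcomp Require Import all_classical all_reals all_analysis.
From mathcomp Require Import complex spectral ring lra.
Import Order.TTheory GRing.Theory Num.Theory numFieldNormedType.Exports.
Local Open Scope ring_scope.
Local Open Scope classical_set_scope.
Set Implicit Arguments. Unset Strict Implicit. Unset Printing Implicit Defensive.

(** As t tends to 0, r tends to infinity, so the constraint bears on a huge power of |A|. The
    substitution |A|^2 = a^(1/r) absorbs this: the constraint becomes linear in a, and the powers of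
    a tend to 1, so all competitors share the value Q at t = 0 and differ only at first order. Both
    factors pass through Gamma because sigma commutes with N. The optimal a depends on t and is
    unknown, so nothing is differentiated along optimisers. One side of the estimate evaluates a_0;
    the other needs the expansion uniformly over all competitors, and it is the singularity of ln at
    0 that forces eta. Since p increases, s has the sign of t, and the supremum (t < 0) and the
    infimum (t > 0) both call for an upper bound on tr (W ln a). As a, b and Z need not commute, the
    trace inequalities rest on pairs of eigenvalues weighted by the overlaps of two eigenbases. The
    point t = 0 is treated apart: there r is infinite and the norm is computed directly. *)

(* An abstract copy of R[i]: unification of matrix expressions over the concrete
   complex field is prohibitively slow. *)
Record cplx (R : realType) := Cplx {
  ck : numClosedFieldType;
  rc : R -> ck;
  re : ck -> R;
  im : ck -> R;
  re_rc : forall x, re (rc x) = x;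
  im_rc : forall x, im (rc x) = 0;
  reD : forall x y, re (x + y) = re x + re y;
  imD : forall x y, im (x + y) = im x + im y;
  reM : forall x y, re (x * y) = re x * re y - im x * im y;
  imM : forall x y, im (x * y) = re x * im y + im x * re y;
  re_conj : forall x, re x^* = re x;
  im_conj : forall x, im x^* = - im x;
  ck_inj : forall x y, re x = re y -> im x = im y -> x = y;
  ck_ge0 : forall x, (0 <= x) = (im x == 0) && (0 <= re x) }.
Arguments rc {R} S x : rename.
Arguments re {R} S z : rename.
Arguments im {R} S z : rename.

(** * Functional calculus *)
Section Adjoint.
Variable R : realType.
Variable S : cplx R.
Local Notation C := (ck S).

Definition adjm m k (A : 'M[C]_(m, k)) : 'M[C]_(k, m) :=
  map_mx (fun z : C => z^*) A^T.
Definition hermm k (A : 'M[C]_k) : Prop := adjm A = A.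
Definition psdm k (A : 'M[C]_k) : Prop :=
  hermm A /\ forall v : 'rV[C]_k, 0 <= (v *m A *m adjm v) 0 0.
Definition pdm k (A : 'M[C]_k) : Prop :=
  hermm A /\ forall v : 'rV[C]_k, v != 0 -> 0 < (v *m A *m adjm v) 0 0.

(* The functional calculus is kept opaque: comparing two unfolded instances is
   prohibitively expensive for unification. *)
Lemma mfn_seal : {F : forall k, (R -> R) -> 'M[C]_k -> 'M[C]_k |
  forall k (f : R -> R) (A : 'M[C]_k), F k f A = invmx (spectralmx A) *m
    diag_mx (map_mx (fun z : C => rc S (f (re S z))) (spectral_diag A)) *m
    spectralmx A}.
Proof. by eexists => k f A; reflexivity. Qed.

Definition mfn k (f : R -> R) (A : 'M[C]_k) : 'M[C]_k := sval mfn_seal k f A.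
Definition mpw k (s : R) (A : 'M[C]_k) : 'M[C]_k := mfn (fun x => x `^ s) A.
Definition mlg k (A : 'M[C]_k) : 'M[C]_k := mfn (@ln R) A.
Definition rtr k (A : 'M[C]_k) : R := re S (\tr A).

Lemma re0 : re S 0 = 0.
Proof. by apply: (addrI (re S 0)); rewrite -reD !addr0. Qed.

Lemma im0 : im S 0 = 0.
Proof. by apply: (addrI (im S 0)); rewrite -imD !addr0. Qed.

Lemma reN (x : C) : re S (- x) = - re S x.
Proof. by apply: (addrI (re S x)); rewrite -reD !subrr re0. Qed.

Lemma imN (x : C) : im S (- x) = - im S x.
Proof. by apply: (addrI (im S x)); rewrite -imD !subrr im0. Qed.

Lemma rcD (x y : R) : rc S (x + y) = rc S x + rc S y.
Proof. by apply: ck_inj; rewrite ?(reD, imD, re_rc, im_rc) ?addr0. Qed.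

Lemma rcM (x y : R) : rc S (x * y) = rc S x * rc S y.
Proof.
by apply: ck_inj; rewrite ?(reM, imM, re_rc, im_rc); rewrite ?mulr0 ?mul0r ?subr0 ?addr0.
Qed.

Lemma rc0 : rc S 0 = 0.
Proof. by apply: ck_inj; rewrite ?(re_rc, im_rc) ?re0 ?im0. Qed.

Lemma rcN (x : R) : rc S (- x) = - rc S x.
Proof. by apply: ck_inj; rewrite ?(reN, imN, re_rc, im_rc) ?oppr0. Qed.

Lemma rc_neq0 (x : R) : (rc S x == 0) = (x == 0).
Proof.
by apply/eqP/eqP => [/(congr1 (re S))|->]; rewrite ?rc0 // re_rc re0.
Qed.

Lemma rc1 : rc S 1 = 1.
Proof.
have r1 : rc S 1 != 0 by rewrite rc_neq0 oner_neq0.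
by apply: (mulIf r1); rewrite -rcM mul1r mul1r.
Qed.

Lemma rc_conj (x : R) : (rc S x)^* = rc S x.
Proof. by apply: ck_inj; rewrite ?(re_conj, im_conj, im_rc) ?oppr0. Qed.

Lemma rc_inj : injective (rc S).
Proof. by move=> x y /(congr1 (re S)); rewrite !re_rc. Qed.

Lemma adjmM m k l (A : 'M[C]_(m, k)) (B : 'M[C]_(k, l)) :
  adjm (A *m B) = adjm B *m adjm A.
Proof. by rewrite /adjm trmx_mul map_mxM. Qed.

Lemma adjmK m k (A : 'M[C]_(m, k)) : adjm (adjm A) = A.
Proof. by apply/matrixP => i j; rewrite !mxE conjCK. Qed.

Lemma adjmD m k (A B : 'M[C]_(m, k)) : adjm (A + B) = adjm A + adjm B.
Proof. by rewrite /adjm linearD map_mxD. Qed.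

Lemma adjmN m k (A : 'M[C]_(m, k)) : adjm (- A) = - adjm A.
Proof. by rewrite /adjm linearN map_mxN. Qed.

Lemma adjmB m k (A B : 'M[C]_(m, k)) : adjm (A - B) = adjm A - adjm B.
Proof. by rewrite adjmD adjmN. Qed.

Lemma adjmZ m k (c : C) (A : 'M[C]_(m, k)) : adjm (c *: A) = c^* *: adjm A.
Proof. by apply/matrixP => i j; rewrite !mxE rmorphM. Qed.

Lemma adjm1 k : adjm (1%:M : 'M[C]_k) = 1%:M.
Proof. by apply/matrixP => i j; rewrite !mxE eq_sym rmorph_nat. Qed.

Lemma unitmx_adj k (A : 'M[C]_k) : (adjm A \in unitmx) = (A \in unitmx).
Proof. by rewrite /adjm map_unitmx unitmx_tr. Qed.

Lemma ReM_real (r : R) (z : C) : re S (rc S r * z) = r * re S z.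
Proof. by rewrite reM re_rc im_rc mul0r subr0. Qed.

Lemma ReB (x y : C) : re S (x - y) = re S x - re S y.
Proof. by rewrite reD reN. Qed.

Lemma Re_sum (I : Type) (r : seq I) (P : pred I) (F : I -> C) :
  re S (\sum_(i <- r | P i) F i) = \sum_(i <- r | P i) re S (F i).
Proof. by elim/big_rec2: _ => [|i y1 y2 _ <-]; rewrite ?re0 ?reD. Qed.

Lemma rtrD k (A B : 'M[C]_k) : rtr (A + B) = rtr A + rtr B.
Proof. by rewrite /rtr mxtraceD reD. Qed.

Lemma rtrN k (A : 'M[C]_k) : rtr (- A) = - rtr A.
Proof. by rewrite /rtr raddfN /= reN. Qed.

Lemma rtrB k (A B : 'M[C]_k) : rtr (A - B) = rtr A - rtr B.
Proof. by rewrite rtrD rtrN. Qed.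

Lemma rtrZ k (r : R) (A : 'M[C]_k) : rtr ((rc S r) *: A) = r * rtr A.
Proof. by rewrite /rtr linearZ /= ReM_real. Qed.

Lemma rtrC k (A B : 'M[C]_k) : rtr (A *m B) = rtr (B *m A).
Proof. by rewrite /rtr mxtrace_mulC. Qed.

Lemma realC_ge0 (r : R) : (0 <= rc S r) = (0 <= r).
Proof. by rewrite ck_ge0 im_rc re_rc eqxx. Qed.

Lemma realC_gt0 (r : R) : (0 < rc S r) = (0 < r).
Proof. by rewrite !lt_def rc_neq0 realC_ge0. Qed.

Lemma ge0_Re_ge0 (z : C) : 0 <= z -> 0 <= re S z.
Proof. by rewrite ck_ge0 => /andP[]. Qed.

Lemma rc_re_real (z : C) : z^* = z -> z = rc S (re S z).
Proof.
move=> hz; apply: ck_inj; rewrite ?re_rc ?im_rc //.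
by have := im_conj z; rewrite hz => /esym/eqP; rewrite eqNr => /eqP.
Qed.

End Adjoint.

(** * Diagonal forms in an arbitrary basis *)

Section DiagonalForms.
Variable F : fieldType.

Definition gdiag k (V : 'M[F]_k) (d : 'I_k -> F) : 'M[F]_k :=
  invmx V *m diag_mx (\row_i d i) *m V.

Lemma gdiag_intertwine_core k (V W X : 'M[F]_k) d l :
  V \in unitmx -> W \in unitmx ->
  gdiag V d *m X = X *m gdiag W l <->
  forall i j, (V *m X *m invmx W) i j * d i = (V *m X *m invmx W) i j * l j.
Proof.
move=> uV uW; rewrite /gdiag; set M := V *m X *m invmx W.
have XE : X = invmx V *m M *m W by rewrite /M !mulmxA mulVmx // mul1mx mulmxKV.
transitivity (diag_mx (\row_i d i) *m M = M *m diag_mx (\row_i l i)).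
  split=> h.
    move/(congr1 (fun T => V *m T *m invmx W)): h.
    by rewrite /M !mulmxA mulmxV // mul1mx mulmxK.
  clearbody M; rewrite XE !mulmxA !mulmxK //; congr (_ *m W).
  by rewrite -[LHS]mulmxA h mulmxA.
clearbody M; split=> [h i j|h].
  by move/matrixP/(_ i j): h; rewrite mul_diag_mx mul_mx_diag 4!mxE mulrC.
by apply/matrixP => i j; rewrite mul_diag_mx mul_mx_diag 4!mxE mulrC.
Qed.

(** With M = V X W^-1 the hypothesis reads d_i M_ij = M_ij l_j, so d_i = l_j wherever M_ij is
    nonzero. This carries functional calculus through intertwiners; V and W may be any invertible
    matrices. *)
Lemma gdiag_intertwine k (V W X : 'M[F]_k) d l d' l' :
  V \in unitmx -> W \in unitmx ->
  (forall i j, d i = l j -> d' i = l' j) ->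
  gdiag V d *m X = X *m gdiag W l -> gdiag V d' *m X = X *m gdiag W l'.
Proof.
move=> uV uW dl /(gdiag_intertwine_core _ _ _ uV uW) h.
apply/(gdiag_intertwine_core _ _ _ uV uW) => i j; have := h i j.
have [->|M0] := eqVneq ((V *m X *m invmx W) i j) 0; first by rewrite !mul0r.
by move=> /(mulfI M0)/dl ->.
Qed.

(** The base change V W^-1 is invertible, so its row i has a nonzero entry, and intertwining with X
    = 1 identifies the two values at that entry. *)
Lemma gdiag_eq_eig k (V W : 'M[F]_k) d l :
  V \in unitmx -> W \in unitmx ->
  gdiag V d = gdiag W l -> forall i, exists j, d i = l j.
Proof.
move=> uV uW h i.
have /(gdiag_intertwine_core _ _ _ uV uW) : gdiag V d *m 1%:M = 1%:M *m gdiag W l.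
  by rewrite mulmx1 mul1mx.
rewrite mulmx1 => {}h.
have uM : V *m invmx W \in unitmx by rewrite unitmx_mul uV unitmx_inv.
have [j Mj] : exists j, (V *m invmx W) i j != 0.
  apply/existsP; rewrite -negb_forall; apply/negP => /forallP Mz.
  have r0 : row i (V *m invmx W) = 0.
    by apply/matrixP => a b; rewrite !mxE; apply/eqP; have := Mz b; rewrite !mxE.
  have := congr1 (fun T => row i T) (mulmxV uM).
  rewrite row_mul r0 mul0mx => /matrixP/(_ 0 i); rewrite !mxE eqxx => /eqP.
  by rewrite eq_sym oner_eq0.
by exists j; apply: (mulfI Mj).
Qed.

Lemma gdiagM k (V : 'M[F]_k) d l : V \in unitmx ->
  gdiag V d *m gdiag V l = gdiag V (fun i => d i * l i).
Proof.
move=> uV; rewrite /gdiag !mulmxA mulmxK //; congr (_ *m V).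
rewrite -[LHS]mulmxA mulmx_diag; congr (_ *m diag_mx _).
by apply/matrixP => i j; rewrite !mxE.
Qed.

Lemma gdiagD k (V : 'M[F]_k) d l :
  gdiag V d + gdiag V l = gdiag V (fun i => d i + l i).
Proof.
rewrite /gdiag -mulmxDl -mulmxDr -raddfD /=; congr (_ *m diag_mx _ *m _).
by apply/matrixP => i j; rewrite !mxE.
Qed.

Lemma gdiagZ k (V : 'M[F]_k) c d :
  c *: gdiag V d = gdiag V (fun i => c * d i).
Proof.
rewrite /gdiag scalemxAl scalemxAr; congr (_ *m _ *m _).
by apply/matrixP => i j; rewrite !mxE mulrnAr.
Qed.

Lemma gdiag_cst k (V : 'M[F]_k) c : V \in unitmx ->
  gdiag V (fun _ => c) = c%:M.
Proof.
move=> uV; rewrite /gdiag.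
have -> : diag_mx (\row__ c) = c%:M :> 'M[F]_k.
  by apply/matrixP => i j; rewrite !mxE.
by rewrite mul_mx_scalar -scalemxAl mulVmx // scalemx1.
Qed.

Lemma tr_gdiag k (V : 'M[F]_k) d : V \in unitmx -> \tr (gdiag V d) = \sum_i d i.
Proof.
move=> uV; rewrite /gdiag -mulmxA mxtrace_mulC mulmxK // mxtrace_diag.
by apply: eq_bigr => i _; rewrite mxE.
Qed.

Lemma unitmx_gdiag k (V : 'M[F]_k) d : V \in unitmx ->
  (gdiag V d \in unitmx) = [forall i, d i != 0].
Proof.
move=> uV; rewrite /gdiag !unitmx_mul unitmx_inv !uV andbT /=.
rewrite unitmxE det_diag unitfE; apply/prodf_neq0/forallP => h i; have := h i.
  by rewrite mxE; apply.
by rewrite mxE.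
Qed.

Lemma row_mul_gdiag k (V : 'M[F]_k) d i : V \in unitmx ->
  row i V *m gdiag V d = d i *: row i V.
Proof.
move=> uV; rewrite /gdiag -row_mul !mulmxA mulmxV // mul1mx row_mul.
by rewrite row_diag_mx -scalemxAl -rowE mxE.
Qed.

End DiagonalForms.

Section FunctionalCalculus.
Variable R : realType.
Variable S : cplx R.
Local Notation C := (ck S).

Definition eig k (A : 'M[C]_k) (i : 'I_k) : R := re S (spectral_diag A 0 i).

Definition rdiag k (V : 'M[C]_k) (d : 'I_k -> R) : 'M[C]_k :=
  gdiag V (fun i => (rc S (d i))).

Lemma mfnE k f (A : 'M[C]_k) : mfn f A = rdiag (spectralmx A) (f \o eig A).
Proof.
rewrite /mfn (svalP (mfn_seal S)) /rdiag /gdiag.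
have <- // : map_mx (fun z : C => (rc S (f (re S z)))) (spectral_diag A) =
  \row_i (rc S ((f \o eig A) i)).
by apply/rowP => j; rewrite !mxE.
Qed.

Lemma adj_spectral k (A : 'M[C]_k) : adjm (spectralmx A) = invmx (spectralmx A).
Proof. by rewrite (invmx_unitary (spectral_unitarymx A)). Qed.

Lemma hermm_normal k (A : 'M[C]_k) : hermm A -> A \is normalmx.
Proof. by move=> hA; apply/normalmxP; move: hA; rewrite /hermm /adjm => ->. Qed.

Lemma herm_spectral k (A : 'M[C]_k) : hermm A -> A = rdiag (spectralmx A) (eig A).
Proof.
move=> hA; rewrite {1}(orthomx_spectralP (hermm_normal hA)) /rdiag /gdiag.
have <- // : spectral_diag A = \row_i (rc S (eig A i)).
apply/rowP => j; rewrite mxE.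
have: A \is hermsymmx.
  by rewrite qualifE /=; apply/eqP; rewrite expr0 scale1r; apply/esym.
move=> /hermitian_spectral_diag_real/mxOverP/(_ 0 j)/CrealP h.
exact: rc_re_real.
Qed.

Lemma rdiag_intertwine k (V W X : 'M[C]_k) d l f :
  V \in unitmx -> W \in unitmx ->
  rdiag V d *m X = X *m rdiag W l -> rdiag V (f \o d) *m X = X *m rdiag W (f \o l).
Proof.
move=> uV uW; apply: gdiag_intertwine => // i j /rc_inj dl.
by rewrite /comp dl.
Qed.

Lemma mfn_intertwine k f (A B X : 'M[C]_k) : hermm A -> hermm B ->
  A *m X = X *m B -> mfn f A *m X = X *m mfn f B.
Proof.
move=> hA hB; rewrite {1}(herm_spectral hA) {1}(herm_spectral hB) !mfnE.
by apply: rdiag_intertwine; apply: spectral_unit.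
Qed.

Lemma mfn_comm k f (A X : 'M[C]_k) : hermm A -> A *m X = X *m A ->
  mfn f A *m X = X *m mfn f A.
Proof. by move=> hA; apply: mfn_intertwine. Qed.

(** The calculus is defined through the eigenbasis that [spectralmx] picks; intertwining by the
    identity shows that any other diagonalisation, orthonormal or not, gives the same matrix. *)
Lemma mfn_rdiag k f (A V : 'M[C]_k) d : hermm A -> V \in unitmx ->
  A = rdiag V d -> mfn f A = rdiag V (f \o d).
Proof.
move=> hA uV hd; rewrite mfnE -[LHS]mulmx1 -[RHS]mul1mx.
apply: rdiag_intertwine => //; first exact: spectral_unit.
by rewrite -hd -herm_spectral // mulmx1 mul1mx.
Qed.

Lemma eq_rdiag k (V : 'M[C]_k) d l : d =1 l -> rdiag V d = rdiag V l.
Proof. by move=> dl; rewrite (funext dl). Qed.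

Lemma rdiagM k (V : 'M[C]_k) d l : V \in unitmx ->
  rdiag V d *m rdiag V l = rdiag V (fun i => d i * l i).
Proof.
move=> uV; rewrite /rdiag.
have -> : (fun i => (rc S (d i * l i))) = (fun i => (rc S (d i)) * (rc S (l i)) :> C).
  by apply/funext => i; rewrite rcM.
exact: gdiagM.
Qed.

Lemma rdiagD k (V : 'M[C]_k) d l :
  rdiag V d + rdiag V l = rdiag V (fun i => d i + l i).
Proof.
rewrite /rdiag gdiagD; congr gdiag.
by apply/funext => i; rewrite rcD.
Qed.

Lemma rdiagZ k (V : 'M[C]_k) (c : R) d :
  (rc S c) *: rdiag V d = rdiag V (fun i => c * d i).
Proof.
rewrite /rdiag gdiagZ; congr gdiag.
by apply/funext => i; rewrite rcM.
Qed.

Lemma rdiag_cst k (V : 'M[C]_k) c : V \in unitmx ->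
  rdiag V (fun _ => c) = (rc S c)%:M.
Proof. by move=> uV; rewrite /rdiag gdiag_cst. Qed.

Lemma rtr_rdiag k (V : 'M[C]_k) d : V \in unitmx -> rtr (rdiag V d) = \sum_i d i.
Proof. by move=> uV; rewrite /rtr tr_gdiag // Re_sum; apply: eq_bigr => i _; rewrite re_rc. Qed.

Lemma adj_diag_real k (d : 'I_k -> R) :
  adjm (diag_mx (\row_i (rc S (d i))) : 'M[C]_k) = diag_mx (\row_i (rc S (d i))).
Proof.
apply/matrixP => i j; rewrite !mxE [j == i]eq_sym.
by case: eqP => [->|_]; rewrite ?mulr1n ?mulr0n ?rmorph0 // rc_conj.
Qed.

Lemma mfn_herm k f (A : 'M[C]_k) : hermm (mfn f A).
Proof.
rewrite mfnE /hermm /rdiag /gdiag.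
rewrite -adj_spectral !adjmM adjmK adj_diag_real; exact: mulmxA.
Qed.
Lemma mfn_id k (A : 'M[C]_k) : hermm A -> mfn id A = A.
Proof. by move=> hA; rewrite mfnE [RHS]herm_spectral. Qed.

Lemma mfn_ext k f g (A : 'M[C]_k) : (forall i, f (eig A i) = g (eig A i)) ->
  mfn f A = mfn g A.
Proof. by move=> fg; rewrite !mfnE; apply: eq_rdiag. Qed.

Lemma mfnM k f g (A : 'M[C]_k) :
  mfn f A *m mfn g A = mfn (fun x => f x * g x) A.
Proof. by rewrite !mfnE rdiagM // spectral_unit. Qed.

Lemma mfnMid k f (A : 'M[C]_k) : hermm A ->
  mfn f A *m A = mfn (fun x => f x * x) A.
Proof. by move=> hA; rewrite -(mfnM f id) mfn_id. Qed.

Lemma mfnD k f g (A : 'M[C]_k) :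
  mfn f A + mfn g A = mfn (fun x => f x + g x) A.
Proof. by rewrite !mfnE rdiagD. Qed.

Lemma mfnZ k c f (A : 'M[C]_k) :
  (rc S c) *: mfn f A = mfn (fun x => c * f x) A.
Proof. by rewrite !mfnE rdiagZ. Qed.

Lemma mfn_cst k c (A : 'M[C]_k) : mfn (fun _ => c) A = (rc S c)%:M.
Proof. by rewrite mfnE rdiag_cst ?spectral_unit. Qed.

Lemma mfn1 k (A : 'M[C]_k) : mfn (fun _ => 1) A = 1%:M.
Proof. by rewrite mfn_cst rc1. Qed.

Lemma mfnB k f g (A : 'M[C]_k) :
  mfn f A - mfn g A = mfn (fun x => f x - g x) A.
Proof.
have -> : - mfn g A = (rc S (-1)) *: mfn g A by rewrite rcN rc1 scaleN1r.
by rewrite mfnZ mfnD; apply: mfn_ext => i; rewrite mulN1r.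
Qed.

Lemma mfn_comp k f g (A : 'M[C]_k) : mfn f (mfn g A) = mfn (f \o g) A.
Proof.
rewrite (mfn_rdiag f (mfn_herm g A) (spectral_unit A) (mfnE g A)).
by rewrite mfnE.
Qed.

Lemma rtr_mfn k f (A : 'M[C]_k) : rtr (mfn f A) = \sum_i f (eig A i).
Proof. by rewrite mfnE rtr_rdiag // spectral_unit. Qed.

Lemma herm_form k (A : 'M[C]_k) (v : 'rV[C]_k) : hermm A ->
  (v *m A *m adjm v) 0 0 =
  \sum_i (rc S (eig A i)) * `|(v *m adjm (spectralmx A)) 0 i| ^+ 2.
Proof.
move=> hA; rewrite {1}(herm_spectral hA) /rdiag /gdiag -adj_spectral.
set U := spectralmx A; set D := diag_mx _; set w := v *m adjm U.
have -> : v *m (adjm U *m D *m U) *m adjm v = w *m D *m adjm w.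
  by rewrite /w adjmM adjmK !mulmxA.
rewrite mxE; apply: eq_bigr => i _; rewrite /D mul_mx_diag.
rewrite [X in X * _]mxE [X in _ * X]mxE [X in Num.conj X]mxE [X in _ * X * _]mxE.
by rewrite normCK mulrAC mulrC.
Qed.

Definition eigrow k (A : 'M[C]_k) i : 'rV[C]_k := row i (spectralmx A).

Lemma eigrow_unit k (A : 'M[C]_k) i : eigrow A i *m adjm (eigrow A i) = 1%:M.
Proof.
rewrite /eigrow -row_mul; apply/matrixP => a b; rewrite !ord1 !mxE.
have /unitarymxP/matrixP/(_ i i) := spectral_unitarymx A.
rewrite [LHS]mxE [X in _ = X]mxE eqxx => <-.
by apply: eq_bigr => j _; rewrite !mxE.
Qed.

Lemma eigrow_form k (A : 'M[C]_k) i : hermm A ->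
  (eigrow A i *m A *m adjm (eigrow A i)) 0 0 = (rc S (eig A i)).
Proof.
move=> hA; have rE : eigrow A i *m A = (rc S (eig A i)) *: eigrow A i.
  by rewrite {2}(herm_spectral hA) row_mul_gdiag // spectral_unit.
by rewrite rE -scalemxAl eigrow_unit !mxE mulr1.
Qed.

Lemma eigrow_neq0 k (A : 'M[C]_k) i : eigrow A i != 0.
Proof.
apply/eqP => e0; have := eigrow_unit A i; rewrite e0 mul0mx => /matrixP/(_ 0 0).
by rewrite !mxE eqxx /= => /eqP; rewrite eq_sym oner_eq0.
Qed.

Lemma psdmP k (A : 'M[C]_k) : psdm A <-> hermm A /\ forall i, 0 <= eig A i.
Proof.
split=> [[hA h]|[hA h]]; split=> //; last move=> v.
  by move=> i; rewrite -(realC_ge0 S) -eigrow_form.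
rewrite herm_form // sumr_ge0 // => i _.
by rewrite mulr_ge0 // ?exprn_ge0 // realC_ge0.
Qed.

Lemma pdmP k (A : 'M[C]_k) : pdm A <-> hermm A /\ forall i, 0 < eig A i.
Proof.
split=> [[hA h]|[hA h]]; split=> //; last move=> v v0.
  by move=> i; rewrite -(realC_gt0 S) -eigrow_form // h // eigrow_neq0.
rewrite herm_form //; set w := v *m _.
have w0 : w != 0.
  apply: contra_neq v0 => w0; rewrite -[v]mulmx1.
  by rewrite -(mulVmx (spectral_unit A)) -adj_spectral mulmxA -/w w0 mul0mx.
have [i wi] : exists i, w 0 i != 0.
  apply/existsP; rewrite -negb_forall; apply: contra w0 => /forallP wz.
  by apply/eqP/matrixP => a b; rewrite ord1 [RHS]mxE; apply/eqP.
rewrite (bigD1 i) //= ltr_pwDl //.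
  by rewrite mulr_gt0 // ?realC_gt0 // exprn_gt0 // normr_gt0.
by rewrite sumr_ge0 // => j _; rewrite mulr_ge0 ?exprn_ge0 // realC_ge0 ltW.
Qed.

Lemma pdm_herm k (A : 'M[C]_k) : pdm A -> hermm A. Proof. by case. Qed.
Lemma psdm_herm k (A : 'M[C]_k) : psdm A -> hermm A. Proof. by case. Qed.
Lemma pdm_eig k (A : 'M[C]_k) i : pdm A -> 0 < eig A i.
Proof. by move/pdmP => -[]. Qed.
Lemma psdm_eig k (A : 'M[C]_k) i : psdm A -> 0 <= eig A i.
Proof. by move/psdmP => -[]. Qed.
Lemma pdm_psd k (A : 'M[C]_k) : pdm A -> psdm A.
Proof. by move=> /pdmP[hA h]; apply/psdmP; split => // i; rewrite ltW. Qed.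

Lemma rdiag_eig k (A V : 'M[C]_k) d i : hermm A -> V \in unitmx ->
  A = gdiag V d -> exists j, d i = (rc S (eig A j)).
Proof.
move=> hA uV; rewrite {1}(herm_spectral hA) => /esym/gdiag_eq_eig; apply => //.
exact: spectral_unit.
Qed.

(** The eigenvalues of [mfn f A] come from a fresh choice of eigenbasis, so their order is unrelated
    to that of [eig A]; hence the existential. *)
Lemma eig_mfn k f (A : 'M[C]_k) i : exists j, eig (mfn f A) i = f (eig A j).
Proof.
have /gdiag_eq_eig : rdiag (spectralmx (mfn f A)) (eig (mfn f A)) =
   rdiag (spectralmx A) (f \o eig A).
  by rewrite -mfnE -herm_spectral //; exact: mfn_herm.
by move/(_ (spectral_unit _) (spectral_unit _) i) => [j /rc_inj h]; exists j.
Qed.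

Lemma mfn_pd k f (A : 'M[C]_k) : (forall i, 0 < f (eig A i)) -> pdm (mfn f A).
Proof.
move=> h; apply/pdmP; split; first exact: mfn_herm.
by move=> i; have [j ->] := eig_mfn f A i.
Qed.

Lemma mfn_psd k f (A : 'M[C]_k) : (forall i, 0 <= f (eig A i)) -> psdm (mfn f A).
Proof.
move=> h; apply/psdmP; split; first exact: mfn_herm.
by move=> i; have [j ->] := eig_mfn f A i.
Qed.

Lemma psd_congr m k (A : 'M[C]_k) (X : 'M[C]_(m, k)) :
  psdm A -> psdm (X *m A *m adjm X).
Proof.
move=> [hA h]; split; first by rewrite /hermm !adjmM adjmK hA mulmxA.
by move=> v; have := h (v *m X); rewrite adjmM !mulmxA.
Qed.

Lemma psd_congr_sub m k (A B : 'M[C]_k) (X : 'M[C]_(m, k)) :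
  psdm (B - A) -> psdm (X *m B *m adjm X - X *m A *m adjm X).
Proof. by move=> /(psd_congr X); rewrite mulmxBr mulmxBl. Qed.

Lemma pd_congr k (A X : 'M[C]_k) :
  X \in unitmx -> pdm A -> pdm (X *m A *m adjm X).
Proof.
move=> uX [hA h]; split; first by rewrite /hermm !adjmM adjmK hA mulmxA.
move=> v v0; have := h (v *m X); rewrite adjmM !mulmxA; apply.
by apply: contra_neq v0 => /(congr1 (mulmx^~ (invmx X))); rewrite mul0mx mulmxK.
Qed.

Lemma psd_adjMr m k (X : 'M[C]_(m, k)) : psdm (X *m adjm X).
Proof.
rewrite -{1}[X]mulmx1; apply: psd_congr; split; first exact: adjm1.
move=> v; rewrite mulmx1 mxE sumr_ge0 // => i _.
by rewrite !mxE -normCK exprn_ge0.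
Qed.

Lemma psd_adjMl m k (X : 'M[C]_(m, k)) : psdm (adjm X *m X).
Proof. by have := psd_adjMr (adjm X); rewrite adjmK. Qed.

Lemma herm_unit k (A : 'M[C]_k) : hermm A ->
  (A \in unitmx) = [forall i, eig A i != 0].
Proof.
move=> hA; rewrite {1}(herm_spectral hA) unitmx_gdiag ?spectral_unit //.
by apply: eq_forallb => i; rewrite rc_neq0.
Qed.

Lemma pd_unit k (A : 'M[C]_k) : pdm A -> A \in unitmx.
Proof.
by move=> /pdmP[hA h]; rewrite herm_unit //; apply/forallP => i; rewrite gt_eqF.
Qed.

Lemma psd_unit_pd k (A : 'M[C]_k) : psdm A -> A \in unitmx -> pdm A.
Proof.
move=> /psdmP[hA h]; rewrite herm_unit // => /forallP u.
by apply/pdmP; split => // i; rewrite lt_neqAle h andbT eq_sym.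
Qed.

Lemma psdD k (A B : 'M[C]_k) : psdm A -> psdm B -> psdm (A + B).
Proof.
move=> [hA pA] [hB pB]; split; first by rewrite /hermm adjmD hA hB.
by move=> v; rewrite mulmxDr mulmxDl mxE addr_ge0.
Qed.

Lemma hermmM_comm k (A B : 'M[C]_k) : hermm A -> hermm B -> A *m B = B *m A ->
  hermm (A *m B).
Proof. by rewrite /hermm adjmM => -> -> ->. Qed.

End FunctionalCalculus.

(** * Trace inequalities *)
Section Klein.
Variable R : realType.
Variable S : cplx R.
Local Notation C := (ck S).

(** Transition probability between the i-th eigenvector of A and the j-th eigenvector of B. *)
Definition overlap k (A B : 'M[C]_k) i j : R :=
  re S (`|(spectralmx A *m adjm (spectralmx B)) i j| ^+ 2).

Lemma overlap_ge0 k (A B : 'M[C]_k) i j : 0 <= overlap A B i j.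
Proof. by apply: ge0_Re_ge0; rewrite exprn_ge0. Qed.

Lemma mxtrace_diag2 (F : comPzRingType) k (d l : 'rV[F]_k) (w w' : 'M[F]_k) :
  \tr (diag_mx d *m w *m diag_mx l *m w') =
  \sum_i \sum_j d 0 i * l 0 j * (w i j * w' j i).
Proof.
apply: eq_bigr => i _; rewrite mxE; apply: eq_bigr => j _.
by rewrite mul_mx_diag mxE mul_diag_mx mxE; ring.
Qed.

Lemma rtr_mfn2 k f g (A B : 'M[C]_k) :
  rtr (mfn f A *m mfn g B) =
  \sum_i \sum_j f (eig A i) * g (eig B j) * overlap A B i j.
Proof.
rewrite !mfnE /rdiag /gdiag -!adj_spectral.
have assoc (U D V D' : 'M[C]_k) : adjm U *m D *m U *m (adjm V *m D' *m V) =
   adjm U *m (D *m (U *m adjm V) *m D' *m V) by rewrite !mulmxA.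
rewrite assoc rtrC -mulmxA /rtr mxtrace_diag2 Re_sum; apply: eq_bigr => i _.
rewrite Re_sum; apply: eq_bigr => j _; rewrite ![(\row__ _) _ _]mxE.
rewrite -rcM ReM_real /overlap normCK; congr (_ * re S (_ * _)).
set U := spectralmx A; set V := spectralmx B.
have -> : V *m adjm U = adjm (U *m adjm V) by rewrite adjmM adjmK.
by rewrite 2!mxE.
Qed.

(* Klein's trick: a scalar inequality between pairs of eigenvalues of A and B
   becomes a trace inequality, because the overlaps of the two eigenbases are
   nonnegative. *)
Lemma klein k (A B : 'M[C]_k) (l : seq ((R -> R) * (R -> R))) :
  (forall i j, 0 <= \sum_(fg <- l) fg.1 (eig A i) * fg.2 (eig B j)) ->
  0 <= \sum_(fg <- l) rtr (mfn fg.1 A *m mfn fg.2 B).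
Proof.
move=> h; under eq_bigr do rewrite rtr_mfn2.
rewrite exchange_big sumr_ge0 // => i _; rewrite exchange_big sumr_ge0 // => j _.
by rewrite -big_distrl /= mulr_ge0 // overlap_ge0.
Qed.

Lemma rtr_psdM k (A B : 'M[C]_k) : psdm A -> psdm B -> 0 <= rtr (A *m B).
Proof.
move=> pA pB; have := @klein k A B [:: (id, id)].
rewrite !big_seq1 /= !mfn_id; [|exact: psdm_herm|exact: psdm_herm].
apply => i j; rewrite big_seq1 /=; apply: mulr_ge0; exact: psdm_eig.
Qed.

(** A and B may fail to commute: each term is a function of A times a function of B, so all terms
    expand over pairs of eigenvalues with the same nonnegative weights, and the scalar estimate is
    summed. *)
Lemma klein_taylor k (A B : 'M[C]_k) f f' K : hermm A -> hermm B ->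
  (forall i j, `|f (eig A i) - f (eig B j) - f' (eig B j) * (eig A i - eig B j)|
     <= K * (eig A i - eig B j) ^+ 2) ->
  `|rtr (mfn f A) - rtr (mfn f B) - rtr (mfn f' B *m (A - B))|
     <= K * rtr ((A - B) *m (A - B)).
Proof.
move=> hA hB h.
have AE f1 : mfn f1 A = mfn f1 A *m mfn (fun=> 1) B by rewrite mfn1 mulmx1.
have BE f1 : mfn f1 B = mfn (fun=> 1) A *m mfn f1 B by rewrite mfn1 mul1mx.
have E1 : rtr (mfn f' B *m (A - B)) =
    rtr (mfn id A *m mfn f' B) - rtr (mfn (fun=> 1) A *m mfn (fun x => f' x * x) B).
  rewrite mulmxBr rtrB rtrC mfn_id // mfn1 mul1mx -mfnM.
  by rewrite (mfn_id hB).
have E2 : rtr ((A - B) *m (A - B)) =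
    rtr (mfn (fun x => x ^+ 2) A *m mfn (fun=> 1) B)
    - 2 * rtr (mfn id A *m mfn id B)
    + rtr (mfn (fun=> 1) A *m mfn (fun x => x ^+ 2) B).
  rewrite mulmxBl !mulmxBr !rtrB !mfn1 mulmx1 mul1mx -!mfnM !mfn_id //.
  by rewrite (rtrC B A); ring.
rewrite (AE f) (BE f) E1 E2 !rtr_mfn2 !mulr_sumr -!sumrB -!big_split /=.
rewrite mulr_sumr; apply: (le_trans (ler_norm_sum _ _ _)).
apply: ler_sum => i _; rewrite !mulr_sumr -!sumrB -!big_split /= mulr_sumr.
apply: (le_trans (ler_norm_sum _ _ _)); apply: ler_sum => j _.
set o := overlap A B i j; have o0 : 0 <= o by exact: overlap_ge0.
set a := eig A i in h *; set b := eig B j.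
have := ler_wpM2r o0 (h i j); rewrite -{1}(ger0_norm o0) -normrM -/a -/b => {}h.
rewrite [X in `|X|](_ : _ = (f a - f b - f' b * (a - b)) * o); last by ring.
by rewrite (le_trans h) // le_eqVlt; apply/orP; left; apply/eqP; ring.
Qed.

(** Young's inequality for the product of u^th and 1, with conjugate exponents 1/th and 1/(1 -
    th). *)
Lemma powR_bernoulli_le (u th : R) : 0 <= u -> 0 < th -> th < 1 ->
  u `^ th <= th * u + (1 - th).
Proof.
move=> u0 t0 t1; have t1' : 0 < 1 - th by rewrite subr_gt0.
have := @conjugate_powR R (u `^ th) 1 th^-1 (1 - th)^-1 (powR_ge0 _ _) ler01.
rewrite !invrK mulr1 powR1 mul1r -powRrM mulfV ?gt_eqF // powRr1 // mulrC.
by apply; rewrite ?invr_gt0 //; ring.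
Qed.

Lemma powR_bernoulli_ge (z k : R) : 0 <= z -> 1 <= k ->
  1 + k * (z - 1) <= z `^ k.
Proof.
move=> z0; rewrite le_eqVlt => /predU1P[<-|k1]; first by rewrite powRr1 //; lra.
have k0 : 0 < k by rewrite (lt_trans ltr01).
have := @powR_bernoulli_le (z `^ k) k^-1 (powR_ge0 _ _).
rewrite invr_gt0 invf_lt1 // -powRrM mulfV ?gt_eqF // powRr1 // => /(_ k0 k1) h.
have : k * z <= k * (k^-1 * z `^ k + (1 - k^-1)) by rewrite ler_pM2l.
by rewrite mulrDr mulrA mulrBr mulfV ?gt_eqF // mul1r; lra.
Qed.

Lemma powR_tangent_ge (x y k : R) : 0 <= x -> 0 <= y -> 1 <= k ->
  x `^ k + k * x `^ (k - 1) * (y - x) <= y `^ k.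
Proof.
move=> x0 y0; have [->|xn0] := eqVneq x 0.
  (* For x = 0 the factor x^(k - 1) is 1 if k = 1 and 0 if k > 1. *)
  rewrite le_eqVlt => /predU1P[<-|k1].
    by rewrite subrr powRr0 !powRr1 //; lra.
  rewrite !powR0 ?mulr0 ?mul0r ?addr0 ?powR_ge0 //; lra.
move=> k1; have xp : 0 < x by rewrite lt_neqAle eq_sym xn0.
have := ler_wpM2l (powR_ge0 x k) (powR_bernoulli_ge (divr_ge0 y0 x0) k1).
rewrite -powRM ?divr_ge0 // (mulrC x (y / x)) divfK //; apply: le_trans.
have -> : x `^ k = x * x `^ (k - 1) by rewrite mulr_powRB1 //; lra.
rewrite le_eqVlt; apply/orP; left; apply/eqP; by field.
Qed.

Lemma powR_tangent_le (x y k : R) : 0 < x -> 0 <= y -> 0 < k -> k < 1 ->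
  y `^ k <= x `^ k + k * x `^ (k - 1) * (y - x).
Proof.
move=> xp y0 k0 k1; have x0 := ltW xp.
have := ler_wpM2l (powR_ge0 x k) (powR_bernoulli_le (divr_ge0 y0 x0) k0 k1).
rewrite -powRM ?divr_ge0 // (mulrC x (y / x)) divfK ?gt_eqF // => h.
apply: (le_trans h).
have -> : x `^ k = x * x `^ (k - 1) by rewrite mulr_powRB1 //.
rewrite le_eqVlt; apply/orP; left; apply/eqP; field; by rewrite gt_eqF.
Qed.

Lemma powR_subadd (x y k : R) : 0 <= x -> 0 < y -> 0 < k -> k < 1 ->
  (x + y) `^ k <= x `^ k + y `^ k.
Proof.
move=> x0 y0 k0 k1; set s := x + y; have s0 : 0 < s by rewrite /s; lra.
have sub z : 0 <= z -> z <= s -> z / s * s `^ k <= z `^ k.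
  move=> z0 zs; have zE : z `^ k = (z / s) `^ k * s `^ k.
    by rewrite -powRM ?divr_ge0 ?(ltW s0) // divfK // gt_eqF.
  rewrite zE ler_wpM2r ?powR_ge0 //.
  have [->|zn0] := eqVneq z 0; first by rewrite mul0r powR_ge0.
  have zp : 0 < z by rewrite lt_neqAle eq_sym zn0.
  by rewrite ger1_powR ?(ltW k1) // divr_gt0 //= ler_pdivrMr // mul1r.
have : x / s * s `^ k + y / s * s `^ k <= x `^ k + y `^ k.
  by apply: lerD; apply: sub; rewrite /s; lra.
by rewrite -!mulrDl mulfV ?gt_eqF // mul1r.
Qed.

(** By convexity, tr B^r is at least tr A^r + r tr (A^(r-1) (B - A)), and the last trace pairs two
    positive semidefinite matrices. The comparison is one of traces only: x^r is not operator
    monotone for r > 1. *)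
Lemma rtr_mpw_le_ge1 k (A B : 'M[C]_k) (r : R) : psdm A -> psdm B ->
  psdm (B - A) -> 1 <= r -> rtr (mpw r A) <= rtr (mpw r B).
Proof.
move=> pA pB pBA r1; have hA := psdm_herm pA; have hB := psdm_herm pB.
have p1 : 0 <= r * rtr (mpw (r - 1) A *m (B - A)).
  rewrite mulr_ge0 ?rtr_psdM //; first by lra.
  by apply: mfn_psd => i; rewrite powR_ge0.
have := @klein k A B [:: (fun=> 1, fun x => x `^ r); (fun x => - x `^ r, fun=> 1);
  (fun x => - r * x `^ (r - 1), id); (fun x => r * x `^ (r - 1) * x, fun=> 1)].
rewrite !big_cons !big_nil /= !mfn1 mul1mx !mulmx1 !addr0 mfn_id //.
have -> : mfn (fun x => - r * x `^ (r - 1)) A = (rc S (- r)) *: mpw (r - 1) A.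
  by rewrite mfnZ.
have -> : mfn (fun x => r * x `^ (r - 1) * x) A = (rc S r) *: (mpw (r - 1) A *m A).
  rewrite mfnMid // mfnZ; apply: mfn_ext => i; ring.
have -> : mfn (fun x => - x `^ r) A = (rc S (-1)) *: mpw r A.
  by rewrite mfnZ; apply: mfn_ext => i; rewrite mulN1r.
rewrite -scalemxAl !rtrZ => h.
suff : 0 <= rtr (mfn (fun x => x `^ r) B) - rtr (mpw r A)
           - r * rtr (mpw (r - 1) A *m (B - A)).
  by rewrite -[mfn _ B]/(mpw r B); lra.
rewrite mulmxBr rtrB; apply: le_trans (h _) _; last by lra.
move=> i j; rewrite !big_cons !big_nil /= addr0.
have := powR_tangent_ge (psdm_eig i pA) (psdm_eig j pB) r1.
by lra.
Qed.

(** Now x^r is concave and the tangent is taken at B; its slope r x^(r-1) blows up at 0, which is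
    why B is positive definite. *)
Lemma rtr_mpw_le_lt1 k (A B : 'M[C]_k) (r : R) : psdm A -> pdm B ->
  psdm (B - A) -> 0 < r -> r < 1 -> rtr (mpw r A) <= rtr (mpw r B).
Proof.
move=> pA pB pBA r0 r1; have hA := psdm_herm pA; have hB := pdm_herm pB.
have p1 : 0 <= r * rtr (mpw (r - 1) B *m (B - A)).
  rewrite mulr_ge0 ?rtr_psdM //; first by lra.
  by apply: mfn_psd => i; rewrite powR_ge0.
have := @klein k A B [:: (fun=> 1, fun x => x `^ r); (fun x => - x `^ r, fun=> 1);
  (id, fun x => r * x `^ (r - 1)); (fun=> 1, fun x => - r * (x `^ (r - 1) * x))].
rewrite !big_cons !big_nil /= !mfn1 !mul1mx !mulmx1 !addr0 mfn_id //.
have -> : mfn (fun x => r * x `^ (r - 1)) B = (rc S r) *: mpw (r - 1) B.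
  by rewrite mfnZ.
have -> : mfn (fun x => - r * (x `^ (r - 1) * x)) B =
    (rc S (- r)) *: (mpw (r - 1) B *m B).
  by rewrite mfnMid // mfnZ.
have -> : mfn (fun x => - x `^ r) A = (rc S (-1)) *: mpw r A.
  by rewrite mfnZ; apply: mfn_ext => i; rewrite mulN1r.
rewrite -scalemxAr !rtrZ (rtrC A) => h.
suff : 0 <= rtr (mfn (fun x => x `^ r) B) - rtr (mpw r A)
           - r * rtr (mpw (r - 1) B *m (B - A)).
  by rewrite -[mfn _ B]/(mpw r B); lra.
rewrite mulmxBr rtrB; apply: le_trans (h _) _; last by lra.
move=> i j; rewrite !big_cons !big_nil /= addr0.
have := powR_tangent_le (pdm_eig j pB) (psdm_eig i pA) r0 r1.
by lra.
Qed.

Lemma rtr_mpw_le k (A B : 'M[C]_k) (r : R) : psdm A -> psdm (B - A) ->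
  0 < r -> rtr (mpw r A) <= rtr (mpw r B).
Proof.
move=> pA pBA r0; have pB : psdm B by have := psdD pBA pA; rewrite subrK.
have [r1|r1] := leP 1 r; first exact: rtr_mpw_le_ge1.
apply/ler_addgt0Pr => e e0.
(* Shifting B by d makes it definite and, by subadditivity of x^r, costs at most d^r per eigenvalue.
   The choice d^r = e/(k+1) keeps the total below e, also when k = 0. *)
pose d : R := (e / k.+1%:R) `^ r^-1.
have d0 : 0 < d by rewrite powR_gt0 // divr_gt0.
have dr : d `^ r = e / k.+1%:R.
  by rewrite /d -powRrM mulVf ?gt_eqF // powRr1 // ltW // divr_gt0.
pose Bd := mfn (fun x => x + d) B.
have pBd : pdm Bd.
  by apply: mfn_pd => i; have := psdm_eig i pB; lra.
have BdE : Bd = B + (rc S d)%:M.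
  by rewrite /Bd -mfnD mfn_cst -[fun x : R => x]/id mfn_id //; exact: psdm_herm.
have pd1 : psdm ((rc S d)%:M : 'M[C]_k).
  by rewrite -(mfn_cst d B); apply: mfn_psd => i; exact: ltW.
have /(rtr_mpw_le_lt1 pA pBd) : psdm (Bd - A).
  by rewrite BdE addrAC; exact: psdD.
move=> /(_ r r0 r1) h; apply: (le_trans h).
rewrite /Bd /mpw mfn_comp !rtr_mfn.
have : \sum_i (eig B i + d) `^ r <=
       \sum_i ((eig B i) `^ r + e / k.+1%:R).
  apply: ler_sum => i _; rewrite /= -dr; apply: powR_subadd => //.
  exact: psdm_eig.
move=> /le_trans; apply; rewrite big_split /= lerD2l sumr_const card_ord.
have k0 : (0 : R) < k.+1%:R by rewrite ltr0n.
rewrite -(mulr_natr (e / k.+1%:R) k) mulrAC ler_pdivrMr // ler_pM2l //.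
by rewrite ler_nat.
Qed.

(** Writing f(x) = f(0) + x g(x) isolates one factor X that can be moved around the trace, while g
    changes sides by intertwining. X may be singular, and T only has to commute with X. *)
Lemma rtr_cyc k f (T X : 'M[C]_k) : T *m X = X *m T ->
  rtr (T *m mfn f (X *m adjm X)) = rtr (T *m mfn f (adjm X *m X)).
Proof.
move=> TX; pose g x : R := if x == 0 then 0 else (f x - f 0) / x.
have fE x : f x = f 0 + x * g x.
  rewrite /g; case: eqP => [->|/eqP x0]; first by rewrite mulr0 addr0.
  by rewrite mulrC divfK //; ring.
have h1 := psdm_herm (psd_adjMr X); have h2 := psdm_herm (psd_adjMl X).
have E (H : 'M[C]_k) : hermm H -> mfn f H = (rc S (f 0))%:M + H *m mfn g H.
  move=> hH; rewrite -{2}(mfn_id hH) mfnM -(mfn_cst _ H) mfnD.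
  exact: mfn_ext.
rewrite !E // !mulmxDr !rtrD; congr (_ + _).
have I : mfn g (adjm X *m X) *m adjm X = adjm X *m mfn g (X *m adjm X).
  by apply: mfn_intertwine => //; rewrite mulmxA.
have -> : T *m (X *m adjm X *m mfn g (X *m adjm X)) =
    X *m (T *m mfn g (adjm X *m X) *m adjm X).
  by rewrite -[X *m adjm X *m _]mulmxA -I !mulmxA TX.
have c2 : mfn g (adjm X *m X) *m (adjm X *m X) =
    adjm X *m X *m mfn g (adjm X *m X) by apply: mfn_comm.
by rewrite rtrC -c2 !mulmxA.
Qed.

(** Simultaneous diagonalisation, in a basis that may not be orthonormal. The last clause ties the
    diagonal entries to the eigenvalues, so that positivity can be used entry by entry. *)
Lemma commuting_rdiag k (A B : 'M[C]_k) : hermm A -> hermm B ->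
  A *m B = B *m A -> exists V dA dB, [/\ V \in unitmx, A = rdiag V dA, B = rdiag V dB &
   (forall i, exists j, dA i = eig A j) /\ (forall i, exists j, dB i = eig B j)].
Proof.
move=> hA hB AB.
have dg (H : 'M[C]_k) : hermm H -> diagonalizable H.
  move=> hH; exists (spectralmx H); first exact: spectral_unit.
  apply/(diagonalizable_forLR (spectral_unit H)).
  exists (\row_i (rc S (eig H i))).
  by rewrite {1}(herm_spectral hH) mxpoly.conjumx ?unitmx_inv ?spectral_unit // invmxK.
have /codiagonalizableP : {in [:: A; B] &, forall A B, comm_mx A B} /\
   {in [:: A; B], forall A, diagonalizable A}.
  split; last by move=> H; rewrite !inE => /orP[]/eqP ->; exact: dg.
  by move=> H K; rewrite !inE => /orP[]/eqP -> /orP[]/eqP -> //; apply/comm_mx_sym.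
case=> V uV /= /andP[/(diagonalizable_forLR uV)[d dE]].
move=> /andP[/(diagonalizable_forLR uV)[l lE] _].
have conv (H : 'M[C]_k) (m : 'rV[C]_k) : hermm H -> H = mxpoly.conjmx (invmx V) (diag_mx m) ->
    exists d, H = rdiag V d /\ forall i, exists j, d i = eig H j.
  move=> hH; rewrite mxpoly.conjumx ?unitmx_inv // invmxK => HE.
  have HE' : H = gdiag V (fun i => m 0 i).
    rewrite /gdiag HE.
    by have -> : \row_i m 0 i = m by apply/rowP => i; rewrite mxE.
  have mE i := rdiag_eig i hH uV HE'.
  exists (fun i => re S (m 0 i)); split.
    rewrite HE' /rdiag; congr gdiag; apply/funext => i.
    by have [j ->] := mE i; rewrite re_rc.
  by move=> i; have [j ->] := mE i; exists j; rewrite re_rc.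
have [dA [AE dAE]] := conv _ _ hA dE; have [dB [BE dBE]] := conv _ _ hB lE.
by exists V, dA, dB.
Qed.

Lemma mfn_commM k f (A B : 'M[C]_k) : hermm A -> hermm B -> A *m B = B *m A ->
  (forall i j, f (eig A i * eig B j) = f (eig A i) * f (eig B j)) ->
  mfn f (A *m B) = mfn f A *m mfn f B.
Proof.
move=> hA hB AB fM; have [V [dA [dB [uV AE BE [dAE dBE]]]]] := commuting_rdiag hA hB AB.
have hAB := hermmM_comm hA hB AB.
rewrite (mfn_rdiag f hA uV AE) (mfn_rdiag f hB uV BE) rdiagM //.
rewrite (@mfn_rdiag _ _ _ f (A *m B) V (fun i => dA i * dB i)) //; last first.
  by rewrite AE BE rdiagM.
apply: eq_rdiag => i /=; have [j ->] := dAE i; have [l ->] := dBE i; exact: fM.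
Qed.

Lemma mpw_commM k r (A B : 'M[C]_k) : psdm A -> psdm B -> A *m B = B *m A ->
  mpw r (A *m B) = mpw r A *m mpw r B.
Proof.
move=> pA pB AB; apply: mfn_commM => // [||i j]; try exact: psdm_herm.
by rewrite powRM //; exact: psdm_eig.
Qed.

Lemma mlg_commM k (A B : 'M[C]_k) : pdm A -> pdm B -> A *m B = B *m A ->
  mlg (A *m B) = mlg A + mlg B.
Proof.
move=> pA pB AB; have hA := pdm_herm pA; have hB := pdm_herm pB.
have [V [dA [dB [uV AE BE [dAE dBE]]]]] := commuting_rdiag hA hB AB.
have hAB := hermmM_comm hA hB AB.
rewrite /mlg (mfn_rdiag _ hA uV AE) (mfn_rdiag _ hB uV BE) rdiagD.
rewrite (@mfn_rdiag _ _ _ (@ln R) (A *m B) V (fun i => dA i * dB i)) //; last first.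
  by rewrite AE BE rdiagM.
apply: eq_rdiag => i /=; have [j ->] := dAE i; have [l ->] := dBE i.
by rewrite lnM // posrE; exact: pdm_eig.
Qed.

Lemma psd_commM k (A B : 'M[C]_k) : psdm A -> psdm B -> A *m B = B *m A ->
  psdm (A *m B).
Proof.
move=> pA pB AB; have hA := psdm_herm pA; have hB := psdm_herm pB.
have hs : hermm (mpw 2^-1 A) by exact: mfn_herm.
have AE : A = mpw 2^-1 A *m mpw 2^-1 A.
  rewrite -{1}(mfn_id hA) mfnM; apply: mfn_ext => i /=.
  by rewrite powR12_sqrt ?psdm_eig // -expr2 sqr_sqrtr ?psdm_eig.
rewrite AE -mulmxA; have -> : mpw 2^-1 A *m B = B *m mpw 2^-1 A.
  exact: mfn_comm.
by rewrite mulmxA -{2}hs; exact: psd_congr.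
Qed.

Lemma poly_interp (s : seq R) (f : R -> R) :
  exists p : {poly R}, forall x, x \in s -> p.[x] = f x.
Proof.
elim: s => [|a s [p hp]]; first by exists 0.
have [as_|as_] := boolP (a \in s).
  by exists p => x; rewrite inE => /predU1P[->|]; exact: hp.
pose m := \prod_(y <- s) ('X - y%:P); have ma : m.[a] != 0.
  by rewrite -[_ == 0]/(root m a) root_prod_XsubC.
exists (p + ((f a - p.[a]) / m.[a]) *: m) => x.
rewrite inE hornerD hornerZ => /predU1P[->|xs]; first by rewrite divfK //; ring.
have /rootP -> : root m x by rewrite root_prod_XsubC.
by rewrite mulr0 addr0 hp.
Qed.

(** On the finite spectrum of A the function f agrees with an interpolating polynomial, so a unital
    algebra containing A contains f(A). *)
Lemma mfn_closed k (N : set 'M[C]_k) f (A : 'M[C]_k) : hermm A ->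
  N A -> N 1%:M -> (forall X Y, N X -> N Y -> N (X + Y)) ->
  (forall c X, N X -> N (c *: X)) -> (forall X Y, N X -> N Y -> N (X *m Y)) ->
  N (mfn f A).
Proof.
move=> hA SA S1 SD SZ SM.
have [p hp] := poly_interp [seq eig A i | i <- enum 'I_k] f.
have -> : mfn f A = mfn (fun x => p.[x]) A.
  by apply: mfn_ext => i; rewrite hp //; apply: map_f; rewrite mem_enum.
elim/poly_ind: (p) => [|r c IH].
  have -> : mfn (fun x => (0 : {poly R}).[x]) A = 0 *: 1%:M.
    rewrite scale0r (_ : (fun x => _) = (fun=> 0)) ?mfn_cst ?rc0 ?raddf0 //.
    by apply/funext => x; rewrite horner0.
  exact: SZ.
have -> : mfn (fun x => (r * 'X + c%:P).[x]) A =
    mfn (fun x => r.[x]) A *m A + (rc S c) *: 1%:M.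
  rewrite -{3}(mfn_id hA) mfnM scalemx1 -(mfn_cst c A) mfnD.
  by apply: mfn_ext => i; rewrite !hornerE.
by apply: SD; [exact: SM|exact: SZ].
Qed.

End Klein.

(** * First-order expansions, uniform in parameters *)
Section ScalarTaylor.
Variable R : realType.
Implicit Types x y u w m M k : R.

Lemma expR_taylor W u : u <= W ->
  `|expR u - 1 - u| <= (2 + 4 * expR W) * u ^+ 2.
Proof.
move=> uW; have e1 := expR_ge1Dx u; rewrite ger0_norm; last by lra.
have eW := expR_gt0 W; have u2 : 0 <= u ^+ 2 by rewrite sqr_ge0.
(* Up to 1/2, exp u <= 1/(1 - u) <= 1 + u + 2 u^2 accounts for the constant 2; beyond it, 1 <= 4 u^2
   and exp u <= exp W account for 4 exp W. *)
have [uh|uh] := leP u 2^-1.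
  have p1 : 0 < 1 - u by lra.
  have : expR u <= (1 - u)^-1.
    have := expR_ge1Dx (- u); rewrite expRN => h.
    by rewrite -[leLHS]invrK lef_pV2 // posrE ?invr_gt0 ?expR_gt0.
  have : (1 - u)^-1 <= 1 + u + 2 * u ^+ 2.
    rewrite -[leLHS]div1r ler_pdivrMr //.
    have : 0 <= u ^+ 2 * (1 - 2 * u) by apply: mulr_ge0 => //; lra.
    by rewrite !expr2; nra.
  by nra.
have eu : expR u <= expR W by rewrite ler_expR.
have : 1 <= 4 * u ^+ 2 by rewrite expr2; nra.
by nra.
Qed.

Lemma ln_lip m x y : 0 < m -> m <= x -> m <= y ->
  `|ln x - ln y| <= `|x - y| / m.
Proof.
move=> m0 mx my.
have h a b : m <= a -> m <= b -> ln a - ln b <= `|a - b| / m.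
  move=> ma mb; have a0 : 0 < a by lra. have b0 : 0 < b by lra.
  rewrite -ln_div // ?posrE //.
  have := expR_ge1Dx (ln (a / b)); rewrite lnK ?posrE ?divr_gt0 // => h.
  have -> : ln (a / b) = 1 + ln (a / b) - 1 by ring.
  have : a / b - 1 <= `|a - b| / m.
    have -> : a / b - 1 = (a - b) / b by field; rewrite gt_eqF.
    apply: (@le_trans _ _ (`|a - b| / b)).
      by rewrite ler_pM2r ?invr_gt0 // ler_norm.
    by rewrite ler_wpM2l // lef_pV2 ?posrE.
  by lra.
rewrite ler_norml; apply/andP; split; last exact: h.
by have := h y x my mx; rewrite (distrC y x); lra.
Qed.

Lemma powR_expR x k : 0 < x -> x `^ k = expR (k * ln x).
Proof. by move=> x0; rewrite /powR gt_eqF. Qed.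

Definition lnbound m M : R := `|ln m| + `|ln M|.

Lemma ln_bounded m M x : 0 < m -> m <= x -> x <= M -> `|ln x| <= lnbound m M.
Proof.
move=> m0 mx xM; have x0 : 0 < x by lra. have M0 : 0 < M by lra.
have h1 : ln m <= ln x by rewrite ler_ln ?posrE.
have h2 : ln x <= ln M by rewrite ler_ln ?posrE.
rewrite /lnbound ler_norml.
have := ler_norm (ln M); have := ler_norm (- ln m); rewrite normrN.
have := normr_ge0 (ln m); have := normr_ge0 (ln M); lra.
Qed.

Lemma powR_bounded m M x k : 0 < m -> m <= x -> x <= M ->
  x `^ k <= expR (`|k| * lnbound m M).
Proof.
move=> m0 mx xM; have x0 : 0 < x by lra.
rewrite powR_expR // ler_expR (le_trans (ler_norm _)) // normrM ler_wpM2l //.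
exact: ln_bounded.
Qed.

(** With w = ln x - ln y the remainder equals y^k ((exp(k w) - 1 - k w) - k (exp w - 1 - w)), so two
    expansions of exp suffice. K is uniform in the exponent, which later moves with t. *)
Lemma powR_taylor m M (kM : R) : 0 < m -> exists K : R, 0 <= K /\
  forall k x y, `|k| <= kM -> m <= x -> x <= M -> m <= y -> y <= M ->
  `|x `^ k - y `^ k - k * y `^ (k - 1) * (x - y)| <= K * (x - y) ^+ 2.
Proof.
move=> m0; pose L := lnbound m M; have L0 : 0 <= L by rewrite addr_ge0.
pose W := `|kM| * (2 * L) + 2 * L; pose D := 2 + 4 * expR W.
have D0 : 0 <= D by have := expR_gt0 W; rewrite /D; lra.
pose Bd := expR (`|kM| * L).
exists (Bd * D * (kM ^+ 2 + `|kM|) * m ^- 2); split.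
  rewrite !mulr_ge0 ?expR_ge0 ?addr_ge0 ?sqr_ge0 //.
  by rewrite invr_ge0 exprn_ge0 // ltW.
move=> k x y kb mx xM my yM.
have kM0 : 0 <= kM by apply: le_trans kb.
have [x0 y0] : 0 < x /\ 0 < y by split; lra.
pose w := ln x - ln y.
have lx : `|ln x| <= L by exact: ln_bounded.
have ly : `|ln y| <= L by exact: ln_bounded.
have wL : `|w| <= 2 * L by rewrite (le_trans (ler_normB _ _)) //; lra.
have wx : `|w| <= `|x - y| / m by exact: ln_lip.
have xE : x = y * expR w.
  by rewrite /w expRB !lnK ?posrE //; field; rewrite gt_eqF.
have xkE : x `^ k = y `^ k * expR (k * w).
  by rewrite !powR_expR // -expRD /w; congr expR; ring.
have y1E : y `^ k = y `^ (k - 1) * y.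
  by rewrite !powR_expR // -[X in _ = _ * X]lnK ?posrE // -expRD; congr expR; ring.
have -> : x `^ k - y `^ k - k * y `^ (k - 1) * (x - y) =
   y `^ k * ((expR (k * w) - 1 - k * w) - k * (expR w - 1 - w)).
  rewrite xkE {1}xE y1E; ring.
have kwW : k * w <= W.
  rewrite (le_trans (ler_norm _)) // normrM.
  have : `|k| * `|w| <= `|kM| * (2 * L).
    by apply: ler_pM => //; rewrite (le_trans kb) // ler_norm.
  by rewrite /W; lra.
have wW : w <= W.
  rewrite (le_trans (ler_norm _)) // (le_trans wL) // /W lerDr mulr_ge0 //; lra.
have t1 := expR_taylor kwW; have t2 := expR_taylor wW; rewrite -/D in t1 t2.
have yk : y `^ k <= Bd.
  rewrite (le_trans (powR_bounded k m0 my yM)) // ler_expR ler_wpM2r //.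
  by rewrite (ger0_norm kM0).
rewrite normrM (ger0_norm (powR_ge0 _ _)).
have w2 : w ^+ 2 <= m ^- 2 * (x - y) ^+ 2.
  have : `|w| ^+ 2 <= (`|x - y| / m) ^+ 2 by rewrite ler_pXn2r ?nnegrE ?divr_ge0 // ltW.
  by rewrite real_normK ?num_real // exprMn real_normK ?num_real // exprVn mulrC.
have k2 : k ^+ 2 <= kM ^+ 2.
  by rewrite -[k ^+ 2]real_normK ?num_real // ler_pXn2r ?nnegrE.
have tot : `|expR (k * w) - 1 - k * w - k * (expR w - 1 - w)| <=
    D * (kM ^+ 2 + `|kM|) * w ^+ 2.
  rewrite (le_trans (ler_normB _ _)) // normrM.
  have h1 : `|k| * `|expR w - 1 - w| <= kM * (D * w ^+ 2) by apply: ler_pM.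
  have h2 : D * (k * w) ^+ 2 <= D * (kM ^+ 2 * w ^+ 2).
    by rewrite exprMn ler_wpM2l // ler_wpM2r // sqr_ge0.
  by rewrite (ger0_norm kM0); lra.
apply: (@le_trans _ _ (Bd * (D * (kM ^+ 2 + `|kM|) * (m ^- 2 * (x - y) ^+ 2)))).
  apply: ler_pM => //; first exact: powR_ge0.
  rewrite (le_trans tot) // ler_wpM2l // mulr_ge0 // addr_ge0 ?sqr_ge0 //.
by rewrite !mulrA.
Qed.

(** Differentiability at 0 in epsilon-delta form, so that radii can be shared with families of
    matrices. The case t = 0 forces [g 0 = g0]. *)
Definition rdiff (g : R -> R) (g0 g1 : R) : Prop :=
  forall e : R, 0 < e -> exists2 d : R, 0 < d &
    forall t, `|t| < d -> `|g t - g0 - t * g1| <= e * `|t|.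

Lemma rdiff_lip g g0 g1 : rdiff g g0 g1 -> exists2 d : R, 0 < d &
  forall t, `|t| < d -> `|g t - g0| <= (1 + `|g1|) * `|t|.
Proof.
move=> /(_ 1 ltr01) [d d0 h]; exists d => // t /h {}h.
have -> : g t - g0 = (g t - g0 - t * g1) + t * g1 by ring.
rewrite (le_trans (ler_normD _ _)) // normrM; lra.
Qed.

Lemma powR_rdiff m M g g0 g1 : 0 < m -> rdiff g g0 g1 ->
  forall e : R, 0 < e -> exists2 d : R, 0 < d & forall t x, `|t| < d -> m <= x -> x <= M ->
  `|x `^ (g t) - x `^ g0 - t * (g1 * (x `^ g0 * ln x))| <= e * `|t|.
Proof.
move=> m0 hg e e0; pose L := lnbound m M + 1.
have L0 : 0 < L by rewrite ltr_wpDl // addr_ge0.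
pose Bd := expR (`|g0| * lnbound m M); have B0 : 0 < Bd by rewrite expR_gt0.
pose G := 1 + `|g1|; have G0 : 0 < G by rewrite ltr_pwDl.
pose D := (2 + 4 * expR 1 : R); have D0 : 0 < D by have := expR_gt0 (1 : R); rewrite /D; lra.
have e1 : 0 < e / (2 * Bd * L) by rewrite divr_gt0 // !mulr_gt0.
have [d1 d10 h1] := hg _ e1.
have [d2 d20 h2] := rdiff_lip hg.
(* d3 makes (g t - g0) ln x at most 1 in absolute value, so that [expR_taylor] applies with W = 1;
   d4 puts its quadratic remainder below half of the allowed error. *)
pose d3 := (G * L)^-1; have d30 : 0 < d3 by rewrite invr_gt0 mulr_gt0.
pose d4 := e / (2 * Bd * D * (G * L) ^+ 2).
have d40 : 0 < d4 by rewrite divr_gt0 // !mulr_gt0 // exprn_gt0 // mulr_gt0.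
exists (Num.min (Num.min d1 d2) (Num.min d3 d4)); first by rewrite !lt_min d10 d20 d30.
move=> t x; rewrite !lt_min => /andP[/andP[td1 td2] /andP[td3 td4]] mx xM.
have x0 : 0 < x by lra.
set y := ln x; have yL : `|y| <= L.
  by rewrite (le_trans (ln_bounded m0 mx xM)) // /L lerDl.
pose u := (g t - g0) * y.
have ub : `|u| <= G * L * `|t|.
  rewrite /u normrM mulrAC; apply: ler_pM => //; exact: h2.
have u1 : u <= 1.
  rewrite (le_trans (ler_norm _)) // (le_trans ub) //.
  by rewrite -ler_pdivlMl ?mulr_gt0 // mulr1 ltW.
have gE : x `^ (g t) = x `^ g0 * expR u.
  by rewrite !powR_expR // -expRD /u -/y; congr expR; ring.
rewrite gE.
have -> : x `^ g0 * expR u - x `^ g0 - t * (g1 * (x `^ g0 * y)) =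
  x `^ g0 * ((expR u - 1 - u) + (g t - g0 - t * g1) * y) by rewrite /u; ring.
rewrite normrM (ger0_norm (powR_ge0 _ _)).
have q1 : `|(g t - g0 - t * g1) * y| <= e / (2 * Bd) * `|t|.
  rewrite normrM (@le_trans _ _ (e / (2 * Bd * L) * `|t| * L)) //.
    by apply: ler_pM => //; exact: h1.
  rewrite le_eqVlt; apply/orP; left; apply/eqP; field.
  by rewrite !gt_eqF.
have q2 : `|expR u - 1 - u| <= e / (2 * Bd) * `|t|.
  rewrite (le_trans (expR_taylor u1)) // -/D.
  have u2 : u ^+ 2 <= (G * L) ^+ 2 * `|t| ^+ 2.
    by rewrite -exprMn -[u ^+ 2]real_normK ?num_real // ler_pXn2r ?nnegrE // !mulr_ge0 // ltW.
  apply: (@le_trans _ _ (D * ((G * L) ^+ 2 * `|t| ^+ 2))); first by rewrite ler_wpM2l // ltW.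
  rewrite [`|t| ^+ 2]expr2 !mulrA ler_wpM2r //.
  have := ltW td4; rewrite /d4 ler_pdivlMr; last first.
    by rewrite !mulr_gt0 // exprn_gt0 // mulr_gt0.
  move=> h; rewrite ler_pdivlMr ?mulr_gt0 //.
  by rewrite (le_trans _ h) // le_eqVlt; apply/orP; left; apply/eqP; ring.
have xB : x `^ g0 <= Bd by exact: powR_bounded.
apply: (@le_trans _ _ (Bd * (e / (2 * Bd) * `|t| + e / (2 * Bd) * `|t|))).
  apply: ler_pM => //; first exact: powR_ge0.
  by rewrite (le_trans (ler_normD _ _)) // lerD.
rewrite le_eqVlt; apply/orP; left; apply/eqP; field; by rewrite gt_eqF.
Qed.

End ScalarTaylor.

(** * An entrywise norm and perturbation of spectra *)

Section MatrixNorm.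
Variable R : realType.
Variable S : cplx R.
Local Notation C := (ck S).

(** A submultiplicative size with values in R, whereas the norm of [ck S] takes values in the
    complex field. *)
Definition cN (z : C) : R := `|re S z| + `|im S z|.
Definition mN p q (A : 'M[C]_(p, q)) : R := \sum_i \sum_j cN (A i j).

Lemma cN_ge0 z : 0 <= cN z. Proof. by rewrite addr_ge0. Qed.

Lemma cND x y : cN (x + y) <= cN x + cN y.
Proof.
rewrite /cN reD imD.
have := ler_normD (re S x) (re S y); have := ler_normD (im S x) (im S y); lra.
Qed.

Lemma cNM x y : cN (x * y) <= cN x * cN y.
Proof.
rewrite /cN reM imM.
have := ler_normB (re S x * re S y) (im S x * im S y).
have := ler_normD (re S x * im S y) (im S x * re S y).
by rewrite !normrM; nra.
Qed.

Lemma cN0 : cN 0 = 0. Proof. by rewrite /cN re0 im0 normr0 addr0. Qed.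

Lemma cN_rc x : cN (rc S x) = `|x|.
Proof. by rewrite /cN re_rc im_rc normr0 addr0. Qed.

Lemma cN_conj z : cN z^* = cN z.
Proof. by rewrite /cN re_conj im_conj normrN. Qed.

Lemma cN_sum (I : Type) (r : seq I) (P : pred I) (F : I -> C) :
  cN (\sum_(i <- r | P i) F i) <= \sum_(i <- r | P i) cN (F i).
Proof.
elim/big_rec2: _ => [|i y1 y2 _ h]; first by rewrite cN0.
by rewrite (le_trans (cND _ _)) // lerD2l.
Qed.

Lemma mN_ge0 p q (A : 'M[C]_(p, q)) : 0 <= mN A.
Proof. by rewrite sumr_ge0 // => i _; rewrite sumr_ge0 // => j _; exact: cN_ge0. Qed.

Lemma mND p q (A B : 'M[C]_(p, q)) : mN (A + B) <= mN A + mN B.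
Proof.
rewrite /mN -big_split; apply: ler_sum => i _; rewrite -big_split.
by apply: ler_sum => j _; rewrite mxE cND.
Qed.

Lemma mNZ p q (r : R) (A : 'M[C]_(p, q)) : mN (rc S r *: A) <= `|r| * mN A.
Proof.
rewrite /mN mulr_sumr; apply: ler_sum => i _; rewrite mulr_sumr.
by apply: ler_sum => j _; rewrite mxE (le_trans (cNM _ _)) // cN_rc.
Qed.

Lemma mNM p q r (A : 'M[C]_(p, q)) (B : 'M[C]_(q, r)) : mN (A *m B) <= mN A * mN B.
Proof.
rewrite /mN mulr_suml; apply: ler_sum => i _.
apply: (@le_trans _ _ (\sum_(k < r) \sum_(j < q) cN (A i j) * cN (B j k))).
  apply: ler_sum => k _; rewrite mxE (le_trans (cN_sum _ _ _)) //.
  by apply: ler_sum => j _; exact: cNM.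
rewrite exchange_big mulr_suml; apply: ler_sum => j _ /=.
rewrite -mulr_sumr ler_wpM2l ?cN_ge0 // (bigD1 j) //= lerDl sumr_ge0 // => l _.
by rewrite sumr_ge0 // => k _; exact: cN_ge0.
Qed.

Lemma rtr_mN k (A : 'M[C]_k) : `|rtr A| <= mN A.
Proof.
rewrite /rtr Re_sum (le_trans (ler_norm_sum _ _ _)) //; apply: ler_sum => i _.
rewrite (bigD1 i) //= (@le_trans _ _ (cN (A i i))) //; first by rewrite lerDl.
by rewrite lerDl sumr_ge0 // => j _; exact: cN_ge0.
Qed.

Lemma mN_adj p q (A : 'M[C]_(p, q)) : mN (adjm A) = mN A.
Proof.
rewrite /mN exchange_big; apply: eq_bigr => i _; apply: eq_bigr => j _.
by rewrite !mxE cN_conj.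
Qed.

Lemma cN_unit_row k (v : 'rV[C]_k) i : v *m adjm v = 1%:M -> cN (v 0 i) <= 2.
Proof.
move=> /matrixP/(_ 0 0); rewrite mxE [RHS]mxE eqxx => /(congr1 (re S)).
rewrite Re_sum -rc1 re_rc (bigD1 i) //= => h.
have h0 : 0 <= \sum_(j < k | j != i) re S (v 0 j * adjm v j 0).
  rewrite sumr_ge0 // => j _; apply: ge0_Re_ge0.
  by rewrite !mxE -normCK exprn_ge0.
move: h; rewrite !mxE reM re_conj im_conj /cN.
set a := re S _; set b := im S _ => h.
have : `|a| <= 1 by rewrite ler_norml; nra.
have : `|b| <= 1 by rewrite ler_norml; nra.
by lra.
Qed.

Lemma mN_spectral k (A : 'M[C]_k) : mN (spectralmx A) <= 2 * (k * k)%:R.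
Proof.
apply: (@le_trans _ _ (\sum_(i < k) \sum_(j < k) 2)).
  apply: ler_sum => i _; apply: ler_sum => j _.
  have := @cN_unit_row k (eigrow A i) j (eigrow_unit A i).
  by rewrite mxE.
by rewrite !sumr_const !card_ord -mulrnA mulr_natr.
Qed.

(** Two eigenvector matrices of size at most 2 k^2 surround a diagonal of k entries: [mfn f A] is
    thus bounded by f on the spectrum, uniformly in A. *)
Definition bcst k : R := (2 * (k * k)%:R) ^+ 2 * k%:R.

Lemma bcst_ge0 k : 0 <= bcst k.
Proof. by rewrite /bcst mulr_ge0 ?ler0n // sqr_ge0. Qed.

Lemma mN_mfn k f (A : 'M[C]_k) (M : R) : (forall i, `|f (eig A i)| <= M) ->
  mN (mfn f A) <= bcst k * M.
Proof.
move=> h; rewrite mfnE /rdiag /gdiag -adj_spectral.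
set D := diag_mx _; set U := spectralmx A.
have Ub := mN_spectral A; rewrite -/U in Ub.
have Db : mN D <= k%:R * M.
  rewrite /mN (@le_trans _ _ (\sum_(i < k) M)) //; last first.
    by rewrite sumr_const card_ord mulr_natl.
  apply: ler_sum => i _; rewrite (bigD1 i) //= big1; last first.
    by move=> j ji; rewrite !mxE eq_sym (negPf ji) mulr0n cN0.
  by rewrite !mxE eqxx mulr1n addr0 cN_rc; exact: h.
rewrite (le_trans (mNM _ _)) //.
have h1 : mN (adjm U *m D) <= 2 * (k * k)%:R * (k%:R * M).
  by rewrite (le_trans (mNM _ _)) // mN_adj ler_pM // mN_ge0.
have h2 : mN (adjm U *m D) * mN U <= 2 * (k * k)%:R * (k%:R * M) * (2 * (k * k)%:R).
  by apply: ler_pM => //; exact: mN_ge0.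
by rewrite (le_trans h2) // le_eqVlt; apply/orP; left; apply/eqP; rewrite /bcst; ring.
Qed.

Definition specin (m M : R) k (A : 'M[C]_k) : Prop :=
  hermm A /\ forall i, m <= eig A i <= M.

Lemma form_le k (D : 'M[C]_k) (v : 'rV[C]_k) : v *m adjm v = 1%:M ->
  `|re S ((v *m D *m adjm v) 0 0)| <= 4 * mN D.
Proof.
move=> hv; rewrite mxE Re_sum (le_trans (ler_norm_sum _ _ _)) //.
have vb i := @cN_unit_row k v i hv.
rewrite /mN exchange_big mulr_sumr; apply: ler_sum => j _.
apply: (@le_trans _ _ (cN ((v *m D) 0 j * adjm v j 0))); first by rewrite lerDl.
rewrite (le_trans (cNM _ _)) //.
have -> : cN (adjm v j 0) = cN (v 0 j) by rewrite !mxE cN_conj.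
have : cN ((v *m D) 0 j) <= 2 * \sum_i cN (D i j).
  rewrite mxE (le_trans (cN_sum _ _ _)) // mulr_sumr; apply: ler_sum => i _.
  by rewrite (le_trans (cNM _ _)) // ler_wpM2r ?cN_ge0.
have := vb j; have := cN_ge0 (v 0 j); have := cN_ge0 ((v *m D) 0 j); nra.
Qed.

Lemma form_specin k (A : 'M[C]_k) m M (v : 'rV[C]_k) : specin m M A ->
  v *m adjm v = 1%:M -> m <= re S ((v *m A *m adjm v) 0 0) <= M.
Proof.
move=> [hA h] hv.
have one c : (v *m (rc S c)%:M *m adjm v) 0 0 = rc S c.
  by rewrite mul_mx_scalar -scalemxAl hv !mxE eqxx mulr1.
have p1 : psdm (A - (rc S m)%:M).
  rewrite -{1}(mfn_id hA) -(mfn_cst m A) mfnB; apply: mfn_psd => i.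
  by rewrite subr_ge0; have /andP[] := h i.
have p2 : psdm ((rc S M)%:M - A).
  rewrite -{1}(mfn_id hA) -(mfn_cst M A) mfnB; apply: mfn_psd => i.
  by rewrite subr_ge0; have /andP[] := h i.
have /ge0_Re_ge0 := p1.2 v; have /ge0_Re_ge0 := p2.2 v.
rewrite !mulmxBr !mulmxBl.
have sub (X Y : 'M[C]_1) : (X - Y) 0 0 = X 0 0 - Y 0 0 by rewrite !mxE.
by rewrite !sub !one !ReB !re_rc; lra.
Qed.

(** An eigenvalue of H is its quadratic form at a unit eigenvector. There the form of K lies in
    [m, M] and that of H - K is at most 4 [mN (H - K)], the 4 coming from two vector entries of size
    at most 2. *)
Lemma eig_perturb k (H K : 'M[C]_k) m M : hermm H -> specin m M K ->
  specin (m - 4 * mN (H - K)) (M + 4 * mN (H - K)) H.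
Proof.
move=> hH sK; split => // i.
have e1 := eigrow_form i hH; have u := eigrow_unit H i.
have := form_le (H - K) u; have := form_specin sK u.
set v := eigrow H i in e1 u *.
have -> : (v *m (H - K) *m adjm v) 0 0 = rc S (eig H i) - (v *m K *m adjm v) 0 0.
  by rewrite -e1 mulmxBr mulmxBl mxE [X in _ + X]mxE.
rewrite ReB re_rc ler_norml; lra.
Qed.

Lemma specin_bounds k (A : 'M[C]_k) : pdm A -> exists m M : R, 0 < m /\ specin m M A.
Proof.
(* The cap 1 gives the minimum a positive default in dimension 0; the trace dominates each
   eigenvalue because all are positive. *)
move=> pA; exists (\big[Num.min/1]_i eig A i), (\sum_i eig A i); split.
  by apply: lt_bigmin => // i _; exact: pdm_eig.
split => [|i]; first exact: pdm_herm.
rewrite bigmin_le_cond //= (bigD1 i) //= lerDl.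
by apply: sumr_ge0 => j _; apply/ltW/pdm_eig.
Qed.

Lemma rtr_sq_le k (D : 'M[C]_k) : rtr (D *m D) <= mN D ^+ 2.
Proof. by rewrite (le_trans (ler_norm _)) // (le_trans (rtr_mN _)) // mNM. Qed.

End MatrixNorm.

(** * Differentiation of matrix families, uniformly in a parameter *)

Lemma mx_telescope (F : comNzRingType) p q (x y z a b c : 'M[F]_(p, q)) :
  x - z - (a + b) = (x - y - c) + (y - z - a) + (c - b).
Proof. by apply/matrixP => i j; rewrite !mxE; ring. Qed.

Section UniformDerivative.
Variable R : realType.
Variable S : cplx R.
Local Notation C := (ck S).
Variables (I : Type) (T : set I) (k : nat).

Definition usmall (F : R -> I -> 'M[C]_k) : Prop := forall e : R, 0 < e -> exists2 d : R, 0 < d &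
  forall t i, `|t| < d -> T i -> mN (F t i) <= e * `|t|.

(** Boundedness of F0 and F1 over T belongs to the notion: in the product rule they multiply
    remainders, and uniformity would otherwise be lost. *)
Definition udiff (F : R -> I -> 'M[C]_k) (F0 F1 : I -> 'M[C]_k) : Prop :=
  (exists2 K : R, 0 <= K & forall i, T i -> mN (F0 i) <= K /\ mN (F1 i) <= K) /\
  usmall (fun t i => F t i - F0 i - rc S t *: F1 i).

Lemma udiff_lip F F0 F1 : udiff F F0 F1 -> exists K d : R, [/\ 0 <= K, 0 < d &
  forall t i, `|t| < d -> T i -> mN (F t i - F0 i) <= K * `|t| /\ mN (F t i) <= K].
Proof.
move=> [[K K0 hK] /(_ 1 ltr01)[d d0 h]].
exists (K + K + 1), (Num.min d 1); split; [lra|by rewrite lt_min d0 ltr01|].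
move=> t i; rewrite lt_min => /andP[td t1] Ti; have [h0 h1] := hK i Ti.
have e1 : mN (F t i - F0 i) <= (K + 1) * `|t|.
  have -> : F t i - F0 i = (F t i - F0 i - rc S t *: F1 i) + rc S t *: F1 i.
    by rewrite subrK.
  rewrite (le_trans (mND _ _)) //; have := h t i td Ti.
  have := mNZ t (F1 i); have : `|t| * mN (F1 i) <= `|t| * K by rewrite ler_wpM2l.
  by lra.
have t0 := normr_ge0 t.
split; first by rewrite (le_trans e1) //; nra.
have -> : F t i = (F t i - F0 i) + F0 i by rewrite subrK.
rewrite (le_trans (mND _ _)) //; nra.
Qed.

Lemma udiff_mul F F0 F1 G G0 G1 : udiff F F0 F1 -> udiff G G0 G1 ->
  udiff (fun t i => F t i *m G t i) (fun i => F0 i *m G0 i)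
        (fun i => F0 i *m G1 i + F1 i *m G0 i).
Proof.
move=> hF hG; have [K1 [d1 [K10 d10 l1]]] := udiff_lip hG.
case: hF => [[K K0 hK] sF]; case: hG => [[L L0 hL] sG].
split.
  exists (K * L + K * L); first by rewrite addr_ge0 // mulr_ge0.
  move=> i Ti; have [a0 a1] := hK i Ti; have [b0 b1] := hL i Ti.
  have KL : 0 <= K * L by rewrite mulr_ge0.
  have pm (A B : 'M[C]_k) : mN A <= K -> mN B <= L -> mN (A *m B) <= K * L.
    by move=> hA hB; rewrite (le_trans (mNM _ _)) // ler_pM // mN_ge0.
  split; first by rewrite (le_trans (pm _ _ a0 b0)) // lerDl.
  by rewrite (le_trans (mND _ _)) // lerD // pm.
move=> e e0.
pose c1 := K1 + 1; pose c2 := K + 1.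
have c10 : 0 < c1 by rewrite /c1; lra. have c20 : 0 < c2 by rewrite /c2; lra.
have e1 : 0 < e / (3 * c1) by rewrite divr_gt0 // mulr_gt0.
have e2 : 0 < e / (3 * c2) by rewrite divr_gt0 // mulr_gt0.
have [d2 d20 h2] := sF _ e1; have [d3 d30 h3] := sG _ e2.
pose d4 := e / (3 * c2 * c1).
have d40 : 0 < d4 by rewrite divr_gt0 // !mulr_gt0.
exists (Num.min (Num.min d1 d2) (Num.min d3 d4)); first by rewrite !lt_min d10 d20 d30.
move=> t i; rewrite !lt_min => /andP[/andP[td1 td2] /andP[td3 td4]] Ti.
have [a0 a1] := hK i Ti; have [b0 b1] := l1 t i td1 Ti.
have := h2 t i td2 Ti; have := h3 t i td3 Ti.
set f := F t i; set g := G t i; set r := f - _ - _; set s := g - _ - _ => hs hr.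
(* Leibniz splitting: the remainder of F times g, F0 times the remainder of G, and a cross term of
   second order in t. Each gets a third of the error. *)
have -> : f *m g - F0 i *m G0 i - rc S t *: (F0 i *m G1 i + F1 i *m G0 i) =
    r *m g + F0 i *m s + rc S t *: (F1 i *m (g - G0 i)).
  rewrite /r /s !mulmxBl !mulmxBr scalerDr -!scalemxAl -!scalemxAr.
  rewrite scalerBr; exact: mx_telescope.
have t0 := normr_ge0 t.
rewrite (le_trans (mND _ _)) //.
have q3 : mN (rc S t *: (F1 i *m (g - G0 i))) <= e / 3 * `|t|.
  rewrite (le_trans (mNZ _ _)) // mulrC ler_wpM2r //.
  apply: (@le_trans _ _ (c2 * (c1 * `|t|))).
    rewrite (le_trans (mNM _ _)) // ler_pM ?mN_ge0 //; first by rewrite /c2; lra.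
    by rewrite (le_trans b0) // ler_wpM2r // /c1; lra.
  have := ltW td4; rewrite /d4 ler_pdivlMr ?mulr_gt0 // => h.
  by rewrite ler_pdivlMr //; lra.
have q1 : mN (r *m g) <= e / 3 * `|t|.
  rewrite (le_trans (mNM _ _)) //.
  apply: (@le_trans _ _ (e / (3 * c1) * `|t| * c1)).
    by apply: ler_pM; rewrite ?mN_ge0 // (le_trans b1) // /c1; lra.
  by rewrite le_eqVlt; apply/orP; left; apply/eqP; field; rewrite gt_eqF.
have q2 : mN (F0 i *m s) <= e / 3 * `|t|.
  rewrite (le_trans (mNM _ _)) //.
  apply: (@le_trans _ _ (c2 * (e / (3 * c2) * `|t|))).
    by apply: ler_pM; rewrite ?mN_ge0 // (le_trans a0) // /c2; lra.
  by rewrite le_eqVlt; apply/orP; left; apply/eqP; field; rewrite gt_eqF.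
have := mND (r *m g) (F0 i *m s); lra.
Qed.

End UniformDerivative.

(** Used with constant maps, to view one curve as a family, and with the projections, to let a and b
    vary as a pair. *)
Lemma udiff_map (R : realType) (S : cplx R) (I J : Type) (T : set I) (U : set J) k
    (phi : J -> I) F F0 F1 : (forall j, U j -> T (phi j)) ->
  @udiff R S I T k F F0 F1 ->
  @udiff R S J U k (fun t j => F t (phi j)) (F0 \o phi) (F1 \o phi).
Proof.
move=> UT [[K K0 hK] s]; split.
  by exists K => // j /UT; exact: hK.
move=> e /s[d d0 h]; exists d => // t j td /UT; exact: h.
Qed.

Lemma scale_diff_split (F : comNzRingType) (r r0 t a b c : F) :
  r * a - t * (r0 * c) = r * (a - t * b) + t * ((r - r0) * b + r0 * (b - c)).
Proof. by ring. Qed.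

Section UniformExpansion.
Variable R : realType.
Variable S : cplx R.
Local Notation C := (ck S).
Variable k : nat.

Lemma udiff_mpw (m M : R) g g0 g1 : 0 < m -> rdiff g g0 g1 ->
  udiff [set A : 'M[C]_k | specin m M A] (fun t A => mpw (g t) A)
    (fun A => mpw g0 A) (fun A => rc S g1 *: mfn (fun x => x `^ g0 * ln x) A).
Proof.
move=> m0 hg; pose Bd := expR (`|g0| * lnbound m M).
have L0 : 0 <= lnbound m M by rewrite addr_ge0.
split.
  exists (bcst R k * Bd + `|g1| * (bcst R k * (Bd * lnbound m M))).
    by rewrite !(addr_ge0, mulr_ge0) ?bcst_ge0 ?expR_ge0.
  move=> A [hA sA].
  have n0 : 0 <= bcst R k * Bd by rewrite mulr_ge0 ?bcst_ge0 ?expR_ge0.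
  have n1 : 0 <= `|g1| * (bcst R k * (Bd * lnbound m M)).
    by rewrite !mulr_ge0 ?bcst_ge0 ?expR_ge0.
  have pb i : `|eig A i `^ g0| <= Bd.
    have /andP[a1 a2] := sA i; rewrite ger0_norm ?powR_ge0 //; exact: powR_bounded.
  split.
    rewrite (@le_trans _ _ (bcst R k * Bd)) ?lerDl //; exact: mN_mfn.
  apply: (@le_trans _ _ (`|g1| * (bcst R k * (Bd * lnbound m M)))); last by rewrite lerDr.
  rewrite (le_trans (mNZ _ _)) // ler_wpM2l // mN_mfn // => i.
  have /andP[a1 a2] := sA i.
  rewrite normrM ler_pM //; exact: ln_bounded.
move=> e e0; pose c := bcst R k + 1.
have c0 : 0 < c by have := bcst_ge0 R k; rewrite /c; lra.
have e1 : 0 < e / c by rewrite divr_gt0.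
have [d d0 h] := powR_rdiff M m0 hg e1; exists d => // t A td [hA sA].
have -> : mpw (g t) A - mpw g0 A - rc S t *: (rc S g1 *: mfn (fun x => x `^ g0 * ln x) A)
   = mfn (fun x => x `^ (g t) - x `^ g0 - t * (g1 * (x `^ g0 * ln x))) A.
  by rewrite !mfnZ !mfnB.
apply: (@le_trans _ _ (bcst R k * (e / c * `|t|))).
  apply: mN_mfn => i; have /andP[a1 a2] := sA i; exact: h.
apply: (@le_trans _ _ (c * (e / c * `|t|))).
  apply: ler_wpM2r; last by rewrite /c lerDl.
  by apply: mulr_ge0 => //; exact: ltW.
by rewrite le_eqVlt; apply/orP; left; apply/eqP; field; rewrite gt_eqF.
Qed.

(** Exponent and matrix both move, and H1 need not commute with H0. The error splits into three: the
    matrix moves at exponent r(t), by [klein_taylor]; the exponent moves at H0; the linear term at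
    r(t) is replaced by that at r0. The base point H0 is common to all parameters. *)
Lemma udiff_rtr_mpw (I : Type) (T : set I) (N : R -> I -> 'M[C]_k) (H0 : 'M[C]_k)
    (H1 : I -> 'M[C]_k) (r : R -> R) r0 r1 (b : R) : 0 < b ->
  pdm H0 -> udiff T N (fun=> H0) H1 ->
  (forall t i, `|t| < b -> T i -> hermm (N t i)) -> rdiff r r0 r1 ->
  forall e : R, 0 < e -> exists2 d : R, 0 < d & forall t i, `|t| < d -> T i ->
  `|rtr (mpw (r t) (N t i)) - rtr (mpw r0 H0)
    - t * (r1 * rtr (mfn (fun x => x `^ r0 * ln x) H0)
           + r0 * rtr (mpw (r0 - 1) H0 *m H1 i))| <= e * `|t|.
Proof.
move=> b0 pH dN hN hr e e0.
have hH : hermm H0 := pdm_herm pH.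
have [m [M [m0 sH]]] := specin_bounds pH.
have [Kn [dn [Kn0 dn0 lipN]]] := udiff_lip dN.
have [rl dl0 hl] := rdiff_lip hr.
pose kM : R := `|r0| + 1 + `|r1|.
have m20 : 0 < m / 2 by lra.
have [Kt [Kt0 ht]] := @powR_taylor R (m / 2) (M + m / 2) kM m20.
have dmp := @udiff_mpw (m / 2) (M + m / 2) r r0 r1 m20 hr.
have dmp1 : rdiff (fun t => r t - 1) (r0 - 1) r1.
  move=> e1 /hr[d d0 h]; exists d => // t td.
  by have := h t td; have -> : r t - 1 - (r0 - 1) - t * r1 = r t - r0 - t * r1 by ring.
have [Kp [dp [Kp0 dp0 lp]]] := udiff_lip (@udiff_mpw (m / 2) (M + m / 2) _ _ _ m20 dmp1).
have sH2 : specin (m / 2) (M + m / 2) H0.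
  by split => // i; have /andP[a c] := sH.2 i; apply/andP; split; lra.
case: dN => [[KH KH0 hKH] sN].
have [d1 d10 h1] : exists2 d : R, 0 < d & forall t, `|t| < d ->
   `|rtr (mpw (r t) H0) - rtr (mpw r0 H0) -
      t * (r1 * rtr (mfn (fun x => x `^ r0 * ln x) H0))| <= e / 4 * `|t|.
  have [d d0 h] := dmp.2 (e / 4) (divr_gt0 e0 (ltr0n _ 4)).
  exists d => // t td; have := h t H0 td sH2.
  move=> /(le_trans (rtr_mN _)).
  by rewrite !rtrB !rtrZ.
pose G : R := 1 + `|r1|; have G0 : 0 < G by rewrite ltr_pwDl.
pose A0 : R := `|r0| + G; have A00 : 0 < A0 by rewrite ltr_wpDl.
have e2 : 0 < e / (4 * (A0 * (Kp + 1))) by rewrite divr_gt0 // !mulr_gt0 //; lra.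
have [d2 d20 h2] := sN _ e2.
pose B1 := Kt * Kn ^+ 2 + 1.
have B10 : 0 < B1 by rewrite ltr_wpDl // mulr_ge0 // sqr_ge0.
pose B2 : R := (G * Kp + A0 * Kp) * KH + 1.
have B20 : 0 < B2.
  by rewrite ltr_wpDl // mulr_ge0 // addr_ge0 // mulr_ge0 // ltW.
pose d3 := e / (4 * B1); have d30 : 0 < d3 by rewrite divr_gt0 // mulr_gt0.
pose d4 := e / (4 * B2); have d40 : 0 < d4 by rewrite divr_gt0 // mulr_gt0.
(* This keeps 4 [mN (N t i - H0)] below m/2, so that the spectrum of [N t i] stays in
   [m/2, M + m/2], where Kt is valid. *)
pose d5 := m / (8 * (Kn + 1)).
have d50 : 0 < d5 by rewrite divr_gt0 // mulr_gt0 // ltr_wpDl.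
pose dd := Num.min (Num.min (Num.min dn rl) (Num.min dp d1))
           (Num.min (Num.min d2 d3) (Num.min (Num.min d4 d5) (Num.min 1 b))).
exists dd; first by rewrite !lt_min dn0 dl0 dp0 d10 d20 d30 d40 d50 ltr01 b0.
move=> t i; rewrite !lt_min => /andP[/andP[/andP[tn tl] /andP[tp t1]]].
move=> /andP[/andP[t2 t3] /andP[/andP[t4 t5] /andP[tlt1 tb]]] Ti.
have t0 := normr_ge0 t.
have [n1 n2] := lipN t i tn Ti.
have rb : `|r t - r0| <= G * `|t| by exact: hl.
have Gt : G * `|t| <= G by rewrite ler_piMr // ?ltW //.
have rkM : `|r t| <= kM.
  have -> : r t = r0 + (r t - r0) by ring.
  rewrite (le_trans (ler_normD _ _)) // /kM; rewrite /G in Gt rb.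
  by clear - Gt rb; lra.
have rA0 : `|r t| <= A0 by rewrite (le_trans rkM) // /kM /A0 /G addrA.
have sN1 : specin (m / 2) (M + m / 2) (N t i).
  have := eig_perturb (hN t i tb Ti) sH; case=> _ hh; split; first exact: hN.
  have small : 4 * mN (N t i - H0) <= m / 2.
    have := ltW t5; rewrite /d5 ler_pdivlMr; last by rewrite mulr_gt0 // ltr_wpDl.
    have : mN (N t i - H0) <= (Kn + 1) * `|t| by rewrite (le_trans n1) // ler_wpM2r // lerDl.
    by clear; lra.
  by move=> j; have := hh j; clear - small; lra.
have tay := @klein_taylor R S k (N t i) H0 (fun x => x `^ (r t))
   (fun x => r t * x `^ (r t - 1)) Kt (hN t i tb Ti) hH.
have {tay} := tay _.
have -> : mfn (fun x => r t * x `^ (r t - 1)) H0 = rc S (r t) *: mpw (r t - 1) H0.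
  by rewrite mfnZ.
rewrite -scalemxAl rtrZ => tay.
have {tay} : `|rtr (mpw (r t) (N t i)) - rtr (mpw (r t) H0)
     - r t * rtr (mpw (r t - 1) H0 *m (N t i - H0))| <= e / 4 * `|t|.
  apply: le_trans (tay _) _.
    move=> a c; have /andP[x1 x2] := sN1.2 a; have /andP[y1 y2] := sH2.2 c.
    exact: ht.
  apply: (@le_trans _ _ (Kt * (Kn * `|t|) ^+ 2)).
    rewrite ler_wpM2l // (le_trans (rtr_sq_le _)) //.
    by rewrite ler_pXn2r ?nnegrE ?mN_ge0 // mulr_ge0.
  have := ltW t3; rewrite /d3 ler_pdivlMr ?mulr_gt0 // => h.
  have -> : Kt * (Kn * `|t|) ^+ 2 = (Kt * Kn ^+ 2 * `|t|) * `|t| by ring.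
  rewrite ler_wpM2r // ler_pdivlMr //.
  by rewrite /B1 in h; clear - h t0; lra.
have := h1 t t1.
set X := rtr (mpw (r t) (N t i)); set Y := rtr (mpw (r t) H0); set Z := rtr (mpw r0 H0).
set L := r1 * _.
have [p1 p2] := lp t H0 tp sH2.
have key : `|r t * rtr (mpw (r t - 1) H0 *m (N t i - H0)) -
   t * (r0 * rtr (mpw (r0 - 1) H0 *m H1 i))| <= e / 2 * `|t|.
  set Dp := mpw (r t - 1) H0 in p1 p2 *; set D0 := mpw (r0 - 1) H0 in p1 *.
  have [_ kh1] := hKH i Ti.
  have -> : r t * rtr (Dp *m (N t i - H0)) - t * (r0 * rtr (D0 *m H1 i)) =
     r t * rtr (Dp *m (N t i - H0 - rc S t *: H1 i)) +
     t * ((r t - r0) * rtr (Dp *m H1 i) + r0 * rtr ((Dp - D0) *m H1 i)).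
    rewrite [Dp *m (_ - _ - _)]mulmxBr -scalemxAr rtrB rtrZ mulmxBl rtrB.
    exact: scale_diff_split.
  rewrite (le_trans (ler_normD _ _)) //.
  have q1 : `|r t * rtr (Dp *m (N t i - H0 - rc S t *: H1 i))| <= e / 4 * `|t|.
    rewrite normrM.
    apply: (@le_trans _ _ (A0 * ((Kp + 1) * (e / (4 * (A0 * (Kp + 1))) * `|t|)))).
      apply: ler_pM => //; rewrite (le_trans (rtr_mN _)) // (le_trans (mNM _ _)) //.
      apply: ler_pM; [exact: mN_ge0|exact: mN_ge0|by rewrite (le_trans p2) // lerDl|exact: h2].
    have Kp1 : 0 < Kp + 1 by rewrite ltr_wpDl.
    clear - A00 Kp1; rewrite le_eqVlt; apply/orP; left; apply/eqP; field.
    by rewrite !gt_eqF.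
  have q2 : `|t * ((r t - r0) * rtr (Dp *m H1 i) + r0 * rtr ((Dp - D0) *m H1 i))|
       <= e / 4 * `|t|.
    rewrite normrM mulrC ler_wpM2r // (le_trans (ler_normD _ _)) // !normrM.
    have a1 : `|r t - r0| * `|rtr (Dp *m H1 i)| <= G * `|t| * (Kp * KH).
      apply: ler_pM => //; rewrite (le_trans (rtr_mN _)) // (le_trans (mNM _ _)) //.
      by apply: ler_pM; rewrite ?mN_ge0.
    have a2 : `|r0| * `|rtr ((Dp - D0) *m H1 i)| <= A0 * (Kp * `|t| * KH).
      apply: ler_pM => //; first by rewrite /A0 lerDl ltW.
      rewrite (le_trans (rtr_mN _)) // (le_trans (mNM _ _)) //.
      by apply: ler_pM; rewrite ?mN_ge0.
    have := ltW t4; rewrite /d4 ler_pdivlMr ?mulr_gt0 // => h.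
    rewrite ler_pdivlMr //; rewrite /B2 in h.
    by clear - h a1 a2 t0; lra.
  by clear - q1 q2; lra.
move: key; set U := r t * _; set V := r0 * _ => key h3 h4.
have -> : X - Z - t * (L + V) = (X - Y - U) + (Y - Z - t * L) + (U - t * V) by ring.
rewrite (le_trans (ler_normD _ _)) //.
have h5 := ler_normD (X - Y - U) (Y - Z - t * L); clear - key h3 h4 h5; lra.
Qed.

End UniformExpansion.

(** * Amalgamated norms over a conditional expectation *)
Section Definitions.
Variable R : realType.
Variable S : cplx R.
Local Notation C := (ck S).

Definition mab k (Y : 'M[C]_k) : 'M[C]_k := mpw (2^-1) (adjm Y *m Y).

Definition schat k (th : R) (Y : 'M[C]_k) : R :=
  if th == 0 then \big[Num.max/0]_(i < k) re S (spectral_diag (mab Y) 0 i)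
  else (rtr (mpw (th^-1) (mab Y))) `^ th.

Definition Gam k (sigma : 'M[C]_k) (s : R) (X : 'M[C]_k) : 'M[C]_k :=
  mpw (s / 2) sigma *m X *m mpw (s / 2) sigma.

Definition wnrm k (sigma : 'M[C]_k) (th : R) (X : 'M[C]_k) : R :=
  schat th (Gam sigma th X).

Definition aminf k (N : set 'M[C]_k) (sigma : 'M[C]_k) (a b : R)
    (X : 'M[C]_k) : R :=
  inf [set v : R | exists A B Y : 'M[C]_k,
        [/\ N A, N B, X = A *m Y *m B &
            v = wnrm sigma ((a^-1 - b^-1) / 2) A
                * wnrm sigma ((a^-1 - b^-1) / 2) B
                * wnrm sigma (b^-1) Y]].

Definition amsup k (N : set 'M[C]_k) (sigma : 'M[C]_k) (b a : R)
    (X : 'M[C]_k) : R :=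
  sup [set v : R | exists A B : 'M[C]_k,
        [/\ N A, N B, A != 0, B != 0 &
            v = wnrm sigma (a^-1) (A *m X *m B)
                / (wnrm sigma ((a^-1 - b^-1) / 2) A
                   * wnrm sigma ((a^-1 - b^-1) / 2) B)]].

Definition amlg k (N : set 'M[C]_k) (sigma : 'M[C]_k) (x y : R)
    (X : 'M[C]_k) : R :=
  if x <= y then aminf N sigma x y X else amsup N sigma x y X.

Definition entq k (E : 'M[C]_k -> 'M[C]_k) (sigma : 'M[C]_k) (q : R)
    (Y : 'M[C]_k) : R :=
  let Z := Gam sigma (q^-1) Y in
  let Zq := mpw q Z in
  q^-1 * rtr (Zq *m (mlg Zq - mlg sigma
                      - mlg (E (mpw (- 2^-1) sigma *m Zq *m mpw (- 2^-1) sigma)))).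

(** The interface between semigroup and analysis: [decohering_cond_exp] produces it, and the
    expansion of the norm sees the semigroup only through these fields. *)
Record cond_exp n (N : set 'M[C]_n) (E : 'M[C]_n -> 'M[C]_n)
    (sigma : 'M[C]_n) : Prop := CondExp {
  ce_pos : (0 < n)%N;
  ce_lin : forall (c : C) (X Y : 'M[C]_n), E (c *: X + Y) = c *: E X + E Y;
  ce_in : forall X, N (E X);
  ce_id : forall X, N X -> E X = X;
  ce_mod : forall A B X, N A -> N B -> E (A *m X *m B) = A *m E X *m B;
  ce_psd : forall X, psdm X -> psdm (E X);
  ce_one : N 1%:M;
  ce_tr : forall X, \tr (sigma *m X) = \tr (E X) / n%:R;
  ce_sig : pdm sigma }.

End Definitions.

(** * Powers of positive matrices and the form [Tform] *)

Section FullCalculus.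
Variable R : realType.
Variable S : cplx R.
Local Notation C := (ck S).
Variable k : nat.
Implicit Types (A B X Z : 'M[C]_k).

Lemma mpwD A r s : pdm A -> mpw r A *m mpw s A = mpw (r + s) A.
Proof.
move=> pA; rewrite mfnM; apply: mfn_ext => i.
by rewrite powRD // (gt_eqF (pdm_eig i pA)) implybT.
Qed.

Lemma mpw0 A : mpw 0 A = 1%:M.
Proof. by rewrite /mpw -(mfn1 A); apply: mfn_ext => i; rewrite powRr0. Qed.

Lemma mpw1 A : psdm A -> mpw 1 A = A.
Proof.
move=> pA; rewrite -[RHS](mfn_id (psdm_herm pA)); apply: mfn_ext => i.
by rewrite powRr1 // psdm_eig.
Qed.

Lemma mpw_comp A r s : mpw r (mpw s A) = mpw (s * r) A.
Proof. by rewrite /mpw mfn_comp; apply: mfn_ext => i /=; rewrite powRrM. Qed.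

Lemma mpw_herm r A : hermm (mpw r A). Proof. exact: mfn_herm. Qed.

Lemma mpw_psd r A : psdm (mpw r A).
Proof. by apply: mfn_psd => i; exact: powR_ge0. Qed.

Lemma mpw_pd r A : pdm A -> pdm (mpw r A).
Proof. by move=> pA; apply: mfn_pd => i; rewrite powR_gt0 // pdm_eig. Qed.

Lemma mpw_invl r A : pdm A -> mpw (- r) A *m mpw r A = 1%:M.
Proof. by move=> pA; rewrite mpwD // addNr mpw0. Qed.

Lemma mpw_half A : psdm A -> mpw 2^-1 A *m mpw 2^-1 A = A.
Proof.
move=> pA; rewrite mfnM -[RHS](mfn_id (psdm_herm pA)); apply: mfn_ext => i /=.
by rewrite powR12_sqrt ?psdm_eig // -expr2 sqr_sqrtr ?psdm_eig.
Qed.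

Lemma mpwN1 A : pdm A -> mpw (-1) A = invmx A.
Proof.
move=> pA; have uA := pd_unit pA.
rewrite -[LHS]mulmx1 -(mulmxV uA) mulmxA.
by rewrite -{2}(mpw1 (pdm_psd pA)) mpw_invl // mul1mx.
Qed.

Lemma mpwZ c r A : 0 <= c -> psdm A ->
  mpw r (rc S c *: A) = rc S (c `^ r) *: mpw r A.
Proof.
move=> c0 pA; have hA := psdm_herm pA.
have -> : rc S c *: A = mfn (fun x => c * x) A by rewrite -mfnZ mfn_id.
rewrite /mpw mfn_comp mfnZ; apply: mfn_ext => i /=.
by rewrite powRM // psdm_eig.
Qed.

Lemma psdZ c A : 0 <= c -> psdm A -> psdm (rc S c *: A).
Proof.
move=> c0 pA; have hA := psdm_herm pA.
have -> : rc S c *: A = mfn (fun x => c * x) A by rewrite -mfnZ mfn_id.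
by apply: mfn_psd => i; rewrite mulr_ge0 // psdm_eig.
Qed.

(** The polar parts of L and Q drop out here: for X = [adjm (Z *m Q)] times |L|, the two arguments
    are [X *m adjm X] and [adjm X *m X], whose powers have equal trace. *)
Lemma rtr_form_cyc r (L Z Q : 'M[C]_k) : hermm Z ->
  rtr (mpw r (adjm (L *m Z *m Q) *m (L *m Z *m Q))) =
  rtr (mpw r (mpw 2^-1 (adjm L *m L) *m Z *m (Q *m adjm Q) *m Z
              *m mpw 2^-1 (adjm L *m L))).
Proof.
move=> hZ; set h := mpw 2^-1 _; have hh : hermm h := mpw_herm _ _.
pose X := adjm (Z *m Q) *m h.
have E1 : adjm (L *m Z *m Q) *m (L *m Z *m Q) = X *m adjm X.
  rewrite /X [adjm (_ *m h)]adjmM hh adjmK -[L *m Z *m Q]mulmxA adjmM !mulmxA.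
  by rewrite -(mulmxA _ h h) mpw_half ?mulmxA //; exact: psd_adjMl.
have E2 : h *m Z *m (Q *m adjm Q) *m Z *m h = adjm X *m X.
  by rewrite /X adjmM hh adjmK adjmM hZ !mulmxA.
rewrite E1 E2 -[mpw r (X *m _)]mul1mx -[mpw r (adjm X *m _)]mul1mx.
by apply: rtr_cyc; rewrite mul1mx mulmx1.
Qed.

Definition Tform r (x1 Z x2 : 'M[C]_k) : R :=
  rtr (mpw r (mpw 2^-1 x1 *m Z *m x2 *m Z *m mpw 2^-1 x1)).

Lemma TformC r x1 Z x2 : hermm Z -> psdm x1 -> psdm x2 ->
  Tform r x1 Z x2 = Tform r x2 Z x1.
Proof.
move=> hZ p1 p2; have h1 := mpw_herm 2^-1 x1; have h2 := mpw_herm 2^-1 x2.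
have := @rtr_form_cyc r (mpw 2^-1 x2) Z (mpw 2^-1 x1) hZ.
rewrite h1 h2 !mpw_half // -/(Tform r x2 Z x1) => <-.
rewrite /Tform; congr (rtr (mpw r _)).
by rewrite !adjmM h1 h2 hZ !mulmxA -(mulmxA _ (mpw 2^-1 x2) (mpw 2^-1 x2)) mpw_half.
Qed.

(** In the middle argument this is congruence followed by trace monotonicity of powers; the outer
    argument is brought to the middle by [TformC]. *)
Lemma Tform_le r x1 y1 Z x2 y2 : 0 < r -> hermm Z ->
  psdm x1 -> psdm x2 -> psdm (y1 - x1) -> psdm (y2 - x2) ->
  Tform r x1 Z x2 <= Tform r y1 Z y2.
Proof.
move=> r0 hZ px1 px2 l1 l2.
have py2 : psdm y2 by have := psdD l2 px2; rewrite subrK.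
have py1 : psdm y1 by have := psdD l1 px1; rewrite subrK.
have mono x u v : psdm u -> psdm (v - u) -> Tform r x Z u <= Tform r x Z v.
  move=> pu luv; set h := mpw 2^-1 x; have hh : hermm h := mpw_herm _ _.
  have E w : h *m Z *m w *m Z *m h = h *m Z *m w *m adjm (h *m Z).
    by rewrite adjmM hh hZ !mulmxA.
  rewrite /Tform -/h !E; apply: rtr_mpw_le => //; first exact: psd_congr.
  exact: psd_congr_sub.
rewrite (le_trans (mono x1 _ _ px2 l2)) // TformC // [leRHS]TformC //.
exact: mono.
Qed.

End FullCalculus.

Lemma mx_trace_inj (F : fieldType) n (A B : 'M[F]_n) :
  (forall X, \tr (A *m X) = \tr (B *m X)) -> A = B.
Proof.
have E (M : 'M[F]_n) i j : \tr (M *m delta_mx j i) = M i j.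
  rewrite /mxtrace (bigD1 i) //= big1 => [|l li]; rewrite mxE (bigD1 j) //= big1.
  - by rewrite mxE !eqxx mulr1 !addr0.
  - by move=> m mj; rewrite mxE (negPf mj) mulr0.
  - by rewrite mxE (negPf li) andbF mulr0 addr0.
  - by move=> m mj; rewrite mxE (negPf mj) mulr0.
by move=> h; apply/matrixP => i j; rewrite -!E.
Qed.

(** * Positive maps and conditional expectations *)

Section PositiveMap.
Variable R : realType.
Variable S : cplx R.
Local Notation C := (ck S).
Variables (n : nat) (E : 'M[C]_n -> 'M[C]_n).
Hypothesis lin : forall (c : C) (X Y : 'M[C]_n), E (c *: X + Y) = c *: E X + E Y.

Lemma lin_map0 : E 0 = 0.
Proof.
have := lin 1 0 0; rewrite !scale1r addr0 => h.
by apply: (addrI (E 0)); rewrite -h addr0.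
Qed.

Lemma lin_mapD X Y : E (X + Y) = E X + E Y.
Proof. by have := lin 1 X Y; rewrite !scale1r. Qed.

Lemma lin_mapZ c X : E (c *: X) = c *: E X.
Proof. by have := lin c X 0; rewrite !addr0 lin_map0 addr0. Qed.

Lemma lin_mapB X Y : E (X - Y) = E X - E Y.
Proof. by rewrite lin_mapD -scaleN1r lin_mapZ scaleN1r. Qed.

Hypothesis pos : forall X, psdm X -> psdm (E X).

Lemma pos_map_herm X : hermm X -> hermm (E X).
Proof.
move=> hX.
have -> : X = mfn (fun x => Num.max x 0) X - mfn (fun x => Num.max (- x) 0) X.
  rewrite mfnB -[LHS](mfn_id hX); apply: mfn_ext => i; rewrite /= !maxEle.
  by case: ifP; case: ifP => /=; lra.
rewrite lin_mapB /hermm adjmB; congr (_ - _); apply: psdm_herm; apply: pos;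
  by apply: mfn_psd => i; rewrite le_max lexx orbT.
Qed.

(** Cartesian decomposition X = H + iK with H and K Hermitian, whose images are Hermitian by
    splitting into positive and negative parts. *)
Lemma pos_map_adj X : E (adjm X) = adjm (E X).
Proof.
pose H := 2^-1 *: (X + adjm X); pose K := (2^-1 * 'i) *: (adjm X - X).
have c2 : (2^-1 : C)^* = 2^-1 by rewrite fmorphV rmorph_nat.
have n2 : (2 : C) != 0 by rewrite pnatr_eq0.
have hH : hermm H by rewrite /hermm /H adjmZ c2 adjmD adjmK addrC.
have hK : hermm K.
  rewrite /hermm /K adjmZ rmorphM /= c2 conjCi adjmB adjmK mulrN scaleNr.
  by rewrite -scalerN opprB.
have XE : X = H + 'i *: K.
  apply/matrixP => i j; rewrite !mxE.
  have i2 : 'i * 'i = -1 :> C by rewrite -expr2 sqrCi.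
  have -> : 'i * (2^-1 * 'i * ((X j i)^* - X i j)) = ('i * 'i) * (2^-1 * ((X j i)^* - X i j)) :> C.
    by ring.
  by rewrite i2; field.
clearbody H K; have XaE : adjm X = H - 'i *: K.
  by rewrite {1}XE adjmD adjmZ conjCi hH hK scaleNr.
rewrite XaE lin_mapB lin_mapZ {1}XE lin_mapD lin_mapZ adjmD adjmZ conjCi (pos_map_herm hH) (pos_map_herm hK) scaleNr.
by [].
Qed.

End PositiveMap.

Section ConditionalExpectation.
Variable R : realType.
Variable S : cplx R.
Local Notation C := (ck S).
Variables (n : nat) (N : set 'M[C]_n) (E : 'M[C]_n -> 'M[C]_n) (sigma : 'M[C]_n).
Hypothesis ce : cond_exp N E sigma.
Implicit Types (A B X : 'M[C]_n).

Let hs : hermm sigma := pdm_herm (ce_sig ce).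

Lemma ED X Y : E (X + Y) = E X + E Y. Proof. exact: lin_mapD (ce_lin ce) _ _. Qed.
Lemma EZ c X : E (c *: X) = c *: E X. Proof. exact: lin_mapZ (ce_lin ce) _ _. Qed.
Lemma EB X Y : E (X - Y) = E X - E Y. Proof. exact: lin_mapB (ce_lin ce) _ _. Qed.
Lemma E_herm X : hermm X -> hermm (E X).
Proof. exact: pos_map_herm (ce_lin ce) (ce_psd ce) _. Qed.
Lemma E_adj X : E (adjm X) = adjm (E X).
Proof. exact: pos_map_adj (ce_lin ce) (ce_psd ce) _. Qed.

Lemma E1 : E 1%:M = 1%:M. Proof. by apply: (ce_id ce); exact: (ce_one ce). Qed.

(** The algebra structure of N is read off from E: N is its range, and the bimodule property at the
    identity gives A B = E(A B). *)
Lemma N_mul A B : N A -> N B -> N (A *m B).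
Proof.
move=> NA NB; have := ce_mod ce 1%:M NA NB; rewrite mulmx1 E1 mulmx1 => <-.
exact: ce_in ce _.
Qed.

Lemma N_add A B : N A -> N B -> N (A + B).
Proof.
move=> NA NB; rewrite -(ce_id ce NA) -(ce_id ce NB) -ED; exact: ce_in ce _.
Qed.

Lemma N_scale c A : N A -> N (c *: A).
Proof. by move=> NA; rewrite -(ce_id ce NA) -EZ; exact: ce_in ce _. Qed.

Lemma N_mfn f A : hermm A -> N A -> N (mfn f A).
Proof.
move=> hA NA; apply: mfn_closed => //; [exact: ce_one ce|exact: N_add|exact: N_scale|exact: N_mul].
Qed.

Lemma N_adj A : N A -> N (adjm A).
Proof. by move=> NA; rewrite -(ce_id ce NA) -E_adj; exact: ce_in ce _. Qed.

(** Against any X, tr (sigma A X) = tr (A E X) / n and tr (sigma X A) = tr (E X A) / n, which agree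
    because the trace is cyclic. This lets elements of N pass through Gamma. *)
Lemma sig_comm A : N A -> sigma *m A = A *m sigma.
Proof.
move=> NA; apply: mx_trace_inj => X.
have N1 := ce_one ce.
rewrite -[LHS]/(\tr (sigma *m A *m X)) -mulmxA (ce_tr ce) -mulmxA.
rewrite (mxtrace_mulC A) -mulmxA (ce_tr ce).
have -> : E (A *m X) = A *m E X.
  by rewrite -[A *m X]mulmx1 (ce_mod ce) // mulmx1.
have -> : E (X *m A) = E X *m A.
  by rewrite -[X *m A]mul1mx mulmxA (ce_mod ce) // mul1mx.
by rewrite mxtrace_mulC.
Qed.

Lemma sig_mfn_comm f A : N A -> mfn f sigma *m A = A *m mfn f sigma.
Proof. by move=> NA; apply: mfn_comm => //; exact: sig_comm. Qed.

Lemma rtr_sigE X B : N B -> rtr (sigma *m E X *m B) = rtr (sigma *m X *m B).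
Proof.
move=> NB; rewrite /rtr -!mulmxA !(ce_tr ce).
have -> : E X *m B = E (X *m B).
  by rewrite -[X *m B]mul1mx mulmxA (ce_mod ce) ?mul1mx //; exact: ce_one ce.
by rewrite (ce_id ce (ce_in ce _)).
Qed.

Lemma rtr_sig1 : rtr sigma = 1.
Proof.
rewrite -[sigma]mulmx1 /rtr (ce_tr ce) E1 mxtrace1 mulfV; first by rewrite -rc1 re_rc.
by rewrite pnatr_eq0 -lt0n (ce_pos ce).
Qed.

Lemma E_specge X (m : R) : hermm X -> (forall i, m <= eig X i) ->
  forall i, m <= eig (E X) i.
Proof.
move=> hX h i.
have p : psdm (X - rc S m *: 1%:M).
  rewrite scalemx1 -(mfn_cst m X) -{1}(mfn_id hX) mfnB; apply: mfn_psd => j.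
  by rewrite subr_ge0.
have /(ce_psd ce) := p; rewrite EB EZ E1 scalemx1 => q.
have hE := E_herm hX.
have u := eigrow_unit (E X) i.
have /ge0_Re_ge0 := q.2 (eigrow (E X) i).
rewrite mulmxBr mulmxBl mul_mx_scalar -scalemxAl u.
have sub (Y Z : 'M[C]_1) : (Y - Z) 0 0 = Y 0 0 - Z 0 0 by rewrite !mxE.
by rewrite sub eigrow_form // !mxE eqxx mulr1 ReB !re_rc subr_ge0.
Qed.

Lemma E_pd X : pdm X -> pdm (E X).
Proof.
move=> pX; have [m [M [m0 [hX h]]]] := specin_bounds pX.
apply/pdmP; split; first exact: E_herm.
move=> i; apply: lt_le_trans m0 _; apply: E_specge => // j.
by have /andP[] := h j.
Qed.

Lemma Gam_N s A X B : N A -> N B ->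
  Gam sigma s (A *m X *m B) = A *m Gam sigma s X *m B.
Proof.
move=> NA NB; rewrite /Gam; set h := mpw _ sigma.
have -> : h *m (A *m X *m B) *m h = (h *m A) *m X *m (B *m h) by rewrite !mulmxA.
by rewrite [h *m A]sig_mfn_comm // -[B *m h]sig_mfn_comm // !mulmxA.
Qed.

Lemma wnrm_fin th X : th != 0 ->
  wnrm sigma th X = (rtr (mpw (th^-1 / 2) (adjm (Gam sigma th X) *m Gam sigma th X))) `^ th.
Proof.
by move=> th0; rewrite /wnrm /schat (negPf th0) /mab mpw_comp mulrC.
Qed.

(** By commutation Gamma^th(A) = sigma^th A, and the power of |A|^2 sigma^(2 th) factors, leaving
    exactly one sigma: the constraint will be linear in a. *)
Lemma wnrm_N (th : R) A : 0 < th -> N A ->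
  wnrm sigma th A = (rtr (sigma *m mpw (th^-1 / 2) (adjm A *m A))) `^ th.
Proof.
move=> th0 NA; rewrite wnrm_fin ?gt_eqF //; congr (rtr _ `^ _).
have ps := ce_sig ce.
have NA' := N_adj NA; have NAA := N_mul NA' NA.
set h := mpw (th / 2) sigma.
have hh : hermm h := mpw_herm _ _.
have E1 : adjm (Gam sigma th A) *m Gam sigma th A = mpw (2 * th) sigma *m (adjm A *m A).
  have -> : Gam sigma th A = mpw th sigma *m A.
    rewrite /Gam -/h -mulmxA -[A *m h]sig_mfn_comm // mulmxA mpwD //.
    by rewrite -splitr.
  rewrite adjmM mpw_herm -mulmxA (mulmxA (mpw th sigma)) mpwD // mulmxA.
  rewrite -[adjm A *m _]sig_mfn_comm // mulmxA.
  by rewrite mulr2n mulrDl mul1r.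
rewrite E1 mpw_commM; [|exact: mpw_psd|exact: psd_adjMl|exact: sig_mfn_comm].
rewrite mpw_comp.
have -> : 2 * th * (th^-1 / 2) = 1 by field; rewrite gt_eqF.
by rewrite mpw1 //; exact: pdm_psd.
Qed.

End ConditionalExpectation.

(** * Reduction to positive densities *)
Section Entropy.
Variable R : realType.
Variable S : cplx R.
Local Notation C := (ck S).

(** Klein's inequality for relative entropy, from ln(y/x) <= y/x - 1 on pairs of eigenvalues. *)
Lemma klein_entropy k (D1 D2 : 'M[C]_k) : pdm D1 -> pdm D2 ->
  rtr D1 - rtr D2 <= rtr (D1 *m (mlg D1 - mlg D2)).
Proof.
move=> p1 p2; have h1 := pdm_herm p1; have h2 := pdm_herm p2.
have := @klein R S k D1 D2 [:: (fun x => x * ln x, fun=> 1); (fun x => - x, @ln R);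
  (fun x => - x, fun=> 1); (fun=> 1, id)].
rewrite !big_cons !big_nil /= !mfn1 !mulmx1 mul1mx addr0 (mfn_id h2).
have -> : mfn (fun x => - x) D1 = - D1.
  rewrite -[in RHS](mfn_id h1) -[RHS]add0r -(scale0r (mfn id D1)) -rc0 mfnZ mfnB.
  by apply: mfn_ext => i; rewrite mul0r sub0r.
have -> : mfn (fun x => x * ln x) D1 = D1 *m mlg D1.
  by rewrite -{2}(mfn_id h1) mfnM.
rewrite mulNmx !rtrN mulmxBr rtrB -/(mlg D2) => h.
suff : 0 <= rtr (D1 *m mlg D1) + (- rtr (D1 *m mlg D2) + (- rtr D1 + rtr D2)) by lra.
apply: h => i j; rewrite !big_cons !big_nil /=.
have x0 := pdm_eig i p1; have y0 := pdm_eig j p2.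
move: (eig D1 i) (eig D2 j) x0 y0 => x y x0 y0.
have := expR_ge1Dx (ln (y / x)); rewrite lnK ?posrE ?divr_gt0 // ln_div ?posrE //.
have : y / x * x = y by rewrite divfK // gt_eqF.
by nra.
Qed.

Lemma pd_commM k (A B : 'M[C]_k) : pdm A -> pdm B -> A *m B = B *m A -> pdm (A *m B).
Proof.
move=> pA pB AB; apply: psd_unit_pd; last by rewrite unitmx_mul !pd_unit.
by apply: psd_commM => //; exact: pdm_psd.
Qed.

Lemma rtr_pd_gt0 k (A : 'M[C]_k) : (0 < k)%N -> pdm A -> 0 < rtr A.
Proof.
move=> k0 pA; rewrite -(mfn_id (pdm_herm pA)) rtr_mfn (bigD1 (Ordinal k0)) //=.
by rewrite ltr_pwDl ?pdm_eig // sumr_ge0 // => i _; apply/ltW/pdm_eig.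
Qed.

Lemma mlgZ k c (A : 'M[C]_k) : 0 < c -> pdm A ->
  mlg (rc S c *: A) = mlg A + rc S (ln c) *: 1%:M.
Proof.
move=> c0 pA; have hA := pdm_herm pA.
have -> : rc S c *: A = mfn (fun x => c * x) A by rewrite -mfnZ mfn_id.
rewrite /mlg mfn_comp scalemx1 -(mfn_cst (ln c) A) mfnD; apply: mfn_ext => i /=.
by rewrite lnM ?posrE ?pdm_eig // addrC.
Qed.

Lemma pdZ k c (A : 'M[C]_k) : 0 < c -> pdm A -> pdm (rc S c *: A).
Proof.
move=> c0 pA; have hA := pdm_herm pA.
have -> : rc S c *: A = mfn (fun x => c * x) A by rewrite -mfnZ mfn_id.
by apply: mfn_pd => i; rewrite mulr_gt0 // pdm_eig.
Qed.

Lemma adjmM_eq0 k (A : 'M[C]_k) : adjm A *m A = 0 -> A = 0.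
Proof.
move=> h; apply/matrixP => i j; rewrite [RHS]mxE.
move/matrixP/(_ j j): h; rewrite [RHS]mxE mxE => /eqP.
rewrite psumr_eq0 => [/allP/(_ i (mem_index_enum i))|l _]; last first.
  by rewrite !mxE mulrC -normCK exprn_ge0.
by rewrite !mxE mulf_eq0 conjC_eq0 orbb => /eqP.
Qed.

End Entropy.

Section Reduction.
Variable R : realType.
Variable S : cplx R.
Local Notation C := (ck S).
Variables (n : nat) (N : set 'M[C]_n) (E : 'M[C]_n -> 'M[C]_n) (sigma : 'M[C]_n).
Hypothesis ce : cond_exp N E sigma.
Implicit Types (A B X a b : 'M[C]_n).

Let ps : pdm sigma := ce_sig ce.

Lemma rtr_condE W B : N B ->
  rtr (W *m B) = rtr (sigma *m E (mpw (- 2^-1) sigma *m W *m mpw (- 2^-1) sigma) *m B).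
Proof.
move=> NB; rewrite (rtr_sigE ce) //.
have sE : sigma *m mpw (- 2^-1) sigma = mpw 2^-1 sigma.
  rewrite -{1}(mpw1 (pdm_psd ps)) mpwD //; congr (mpw _ _).
  by rewrite [X in X - _](splitr 1) mul1r addrK.
rewrite !mulmxA sE; set h := mpw 2^-1 sigma; set g := mpw (- 2^-1) sigma.
have hB : h *m B = B *m h by exact: (sig_mfn_comm ce).
have -> : h *m W *m g *m B = h *m (W *m (g *m B)) by rewrite !mulmxA.
by rewrite (rtrC h) -!mulmxA -hB (mulmxA g) mpw_invl // mul1mx.
Qed.

Definition cdens W := E (mpw (- 2^-1) sigma *m W *m mpw (- 2^-1) sigma).
(** The density with respect to sigma of the restriction of W / tr W to N, as [rtr_ndens] shows;
    this is the a_0 of the overview. *)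
Definition ndens W := rc S (rtr W)^-1 *: cdens W.

Lemma cdens_pd W : pdm W -> pdm (cdens W).
Proof.
move=> pW; apply: (E_pd ce).
rewrite -{2}(mpw_herm (- 2^-1) sigma); apply: pd_congr => //.
by apply: pd_unit; exact: mpw_pd.
Qed.

Lemma ndens_pd W : pdm W -> pdm (ndens W).
Proof.
move=> pW; apply: pdZ; last exact: cdens_pd.
by rewrite invr_gt0 rtr_pd_gt0 // (ce_pos ce).
Qed.

Lemma ndens_N W : N (ndens W).
Proof. by apply: (N_scale ce); exact: (ce_in ce). Qed.

Lemma rtr_ndens W B : pdm W -> N B ->
  rtr (sigma *m ndens W *m B) = (rtr W)^-1 * rtr (W *m B).
Proof.
by move=> pW NB; rewrite /ndens -scalemxAr -scalemxAl rtrZ [in RHS]rtr_condE.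
Qed.

Lemma rtr_sig_ndens W : pdm W -> rtr (sigma *m ndens W) = 1.
Proof.
move=> pW; rewrite -[_ *m ndens W]mulmx1 rtr_ndens ?mulmx1 //; last exact: (ce_one ce).
by rewrite mulVf // gt_eqF // rtr_pd_gt0 // (ce_pos ce).
Qed.

(** Klein's inequality for the products sigma a_0 and sigma a. Both commute, so ln sigma cancels,
    and what remains lies in N and can be traced against W. The excess mass eta, multiplied by tr W,
    is the error. *)
Lemma ent_bound W a eta : pdm W -> pdm a -> N a -> rtr (sigma *m a) = 1 + eta ->
  rtr (W *m mlg a) <= rtr (W *m mlg (ndens W)) + rtr W * eta.
Proof.
move=> pW pa Na ra; set a0 := ndens W.
have pa0 : pdm a0 := ndens_pd pW; have Na0 : N a0 := ndens_N W.
have c1 := sig_comm ce Na; have c0 := sig_comm ce Na0.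
have Q0 : 0 < rtr W by rewrite rtr_pd_gt0 // (ce_pos ce).
have := klein_entropy (pd_commM ps pa0 c0) (pd_commM ps pa c1).
rewrite !mlg_commM // rtr_sig_ndens // ra.
have -> : mlg sigma + mlg a0 - (mlg sigma + mlg a) = mlg a0 - mlg a.
  by rewrite opprD addrACA subrr add0r.
rewrite mulmxBr rtrB !rtr_ndens //; last first.
- by apply: (N_mfn ce) => //; exact: pdm_herm.
- by apply: (N_mfn ce) => //; exact: pdm_herm.
rewrite -mulrBr mulrC ler_pdivlMr //; lra.
Qed.

Lemma sig_lower : exists2 m : R, 0 < m & forall i, m <= eig sigma i.
Proof.
have [m [M [m0 [_ h]]]] := specin_bounds ps.
by exists m => // i; have /andP[] := h i.
Qed.

Lemma rtr_sig_ge m X : (forall i, m <= eig sigma i) -> psdm X ->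
  m * rtr X <= rtr (sigma *m X).
Proof.
move=> hm pX.
have p : psdm (sigma - rc S m *: 1%:M).
  have hs := pdm_herm ps.
  rewrite scalemx1 -(mfn_cst m sigma) -{1}(mfn_id hs) mfnB; apply: mfn_psd => j.
  by rewrite subr_ge0.
have := rtr_psdM p pX; rewrite mulmxBl rtrB -scalemxAl rtrZ mul1mx; lra.
Qed.

Lemma rtr_sig_pow_gt0 (r : R) x : 0 < r -> psdm x -> x != 0 ->
  0 < rtr (sigma *m mpw r x).
Proof.
move=> r0 px x0; have [m m0 hm] := sig_lower.
apply: lt_le_trans (rtr_sig_ge hm (mpw_psd r x)); rewrite mulr_gt0 //.
have [i xi] : exists i, eig x i != 0.
  apply/existsP; rewrite -negb_forall; apply: contra x0 => /forallP z.
  rewrite -(mfn_id (psdm_herm px)) (_ : mfn id x = mfn (fun=> 0) x).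
    by rewrite mfn_cst rc0 raddf0.
  by apply: mfn_ext => i; exact/eqP.
rewrite rtr_mfn (bigD1 i) //= ltr_pwDl ?sumr_ge0 // => [|j _]; last exact: powR_ge0.
by rewrite powR_gt0 // lt_neqAle eq_sym xi psdm_eig.
Qed.

(* x^{1/tau}, rescaled and shifted so that its spectrum stays in a compact subset
   of the positive axis that does not depend on x. *)
Definition regul (tau eta : R) x :=
  mfn (fun y => (rtr (sigma *m mpw tau^-1 x))^-1 * y `^ tau^-1 + eta) x.

Section Regularization.
Variables (tau eta : R) (x : 'M[C]_n).
Hypotheses (tau0 : 0 < tau) (eta0 : 0 < eta) (px : psdm x) (x0 : x != 0) (Nx : N x).
Let al := rtr (sigma *m mpw tau^-1 x).
Let al0 : 0 < al. Proof. by apply: rtr_sig_pow_gt0 => //; rewrite invr_gt0. Qed.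

Lemma regul_N : N (regul tau eta x).
Proof. by apply: (N_mfn ce) => //; exact: psdm_herm. Qed.

Lemma regul_pd : pdm (regul tau eta x).
Proof.
apply: mfn_pd => i; rewrite ltr_wpDl // mulr_ge0 ?powR_ge0 // invr_ge0; exact: ltW.
Qed.

Lemma rtr_sig_regul : rtr (sigma *m regul tau eta x) = 1 + eta.
Proof.
rewrite /regul -/al -mfnD -mfnZ mfn_cst mulmxDr rtrD -scalemxAr rtrZ mul_mx_scalar rtrZ.
by rewrite -/al mulVf ?gt_eqF // (rtr_sig1 ce) mulr1.
Qed.

(** The largest eigenvalue is at most the trace, and m times the trace is at most the sigma-weighted
    trace 1 + eta. The lower end is the shift. *)
Lemma regul_specin m : 0 < m -> (forall i, m <= eig sigma i) ->
  specin eta ((1 + eta) / m) (regul tau eta x).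
Proof.
move=> m0 hm; split; first exact: mfn_herm.
move=> i; apply/andP; split.
  have [j ->] := eig_mfn (fun y => al^-1 * y `^ tau^-1 + eta) x i.
  by rewrite lerDr mulr_ge0 ?powR_ge0 // invr_ge0 ltW.
have := rtr_sig_ge hm (pdm_psd regul_pd); rewrite rtr_sig_regul mulrC.
rewrite -ler_pdivlMr // => h; apply: le_trans h.
rewrite -{2}(mfn_id (pdm_herm regul_pd)) rtr_mfn (bigD1 i) //= lerDl.
by rewrite sumr_ge0 // => j _; apply/ltW/pdm_eig/regul_pd.
Qed.

(** An equality at eta = 0, and the right side grows with eta. Applied to the spectrum of x,
    directly or inverted, it gives the two operator comparisons below. *)
Let scal (y : R) : 0 <= y -> y <= al `^ tau * (al^-1 * y `^ tau^-1 + eta) `^ tau.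
Proof.
move=> y0; have a0 := ltW al0.
rewrite -powRM ?addr_ge0 ?mulr_ge0 ?powR_ge0 ?invr_ge0 ?(ltW eta0) //.
rewrite mulrDr mulrA mulfV ?gt_eqF // mul1r.
rewrite -{1}[y]powRr1 // -(mulVf (lt0r_neq0 tau0)) powRrM.
apply: ge0_ler_powR; rewrite ?nnegrE ?(ltW tau0) ?powR_ge0 //.
  by rewrite addr_ge0 ?powR_ge0 // mulr_ge0 // ltW.
by rewrite lerDl mulr_ge0 // ltW.
Qed.

Lemma regul_ge : psdm (rc S (al `^ tau) *: mpw tau (regul tau eta x) - x).
Proof.
rewrite -{2}(mfn_id (psdm_herm px)) /mpw mfn_comp mfnZ mfnB; apply: mfn_psd => i /=.
by rewrite subr_ge0 scal // psdm_eig.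
Qed.

Lemma regul_inv_le : x \in unitmx ->
  psdm (mpw (-1) x - rc S (al `^ (- tau)) *: mpw (- tau) (regul tau eta x)).
Proof.
move=> ux; have pdx := psd_unit_pd px ux.
rewrite /mpw mfn_comp mfnZ mfnB; apply: mfn_psd => i /=.
have y0 := pdm_eig i pdx.
rewrite subr_ge0 !powRN powRr1 ?(ltW y0) // -invfM lef_pV2 ?posrE //.
  by apply: scal; exact: ltW.
rewrite mulr_gt0 ?powR_gt0 // ltr_wpDl // mulr_ge0 ?powR_ge0 // invr_ge0; exact: ltW.
Qed.

End Regularization.

(* For |A|^2 = a^s and |B^*|^2 = b^s this is the p-th power of the weighted p-norm
   of A^{-1} X B^{-1}, where k = p / 2 and Z = Gamma^{1/p}(X); a supremum
   competitor A X B corresponds to negative s. *)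
Definition Phi (k s : R) (Z a b : 'M[C]_n) : R :=
  rtr (mpw k (mpw (- s / 2) a *m Z *m mpw (- s) b *m Z *m mpw (- s / 2) a)).

Lemma Tform_Phi (k s c1 c2 : R) Z a b : 0 <= c1 -> 0 <= c2 -> hermm Z ->
  Tform k (rc S c1 *: mpw (- s) a) Z (rc S c2 *: mpw (- s) b) =
  (c1 * c2) `^ k * Phi k s Z a b.
Proof.
move=> c10 c20 hZ; rewrite /Tform (mpwZ 2^-1 c10 (mpw_psd (- s) a)) mpw_comp.
rewrite -!(scalemxAl, scalemxAr) !scalerA -!rcM.
have h2 : 2^-1 + 2^-1 = 1 :> R by lra.
have -> : c1 `^ 2^-1 * (c1 `^ 2^-1 * c2) = c1 * c2.
  by rewrite mulrA -powRD ?h2 ?powRr1 // oner_eq0.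
rewrite mpwZ ?mulr_ge0 // ?rtrZ //.
set h := mpw (- s / 2) a.
have -> : h *m Z *m mpw (- s) b *m Z *m h = (h *m Z) *m mpw (- s) b *m adjm (h *m Z).
  by rewrite adjmM mpw_herm hZ !mulmxA.
exact/psd_congr/mpw_psd.
Qed.

Lemma rtr_mpw_ge0 k X : 0 <= rtr (mpw k X).
Proof. by rewrite rtr_mfn sumr_ge0 // => i _; exact: powR_ge0. Qed.

Definition admissible (eta m : R) a :=
  [/\ N a, specin eta ((1 + eta) / m) a, pdm a & rtr (sigma *m a) = 1 + eta].

Lemma regul_admissible tau eta m x : 0 < tau -> 0 < eta -> psdm x -> x != 0 -> N x ->
  0 < m -> (forall i, m <= eig sigma i) -> admissible eta m (regul tau eta x).
Proof.
move=> *; split; [exact: regul_N|exact: regul_specin|exact: regul_pd|exact: rtr_sig_regul].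
Qed.

(** As A commutes with sigma, the left and right absolute values give the same norm; each factor of
    a competitor uses the one facing the right way. *)
Lemma wnrm_Nadj (s : R) A : 0 < s -> N A ->
  wnrm sigma (s / 2) A = (rtr (sigma *m mpw s^-1 (A *m adjm A))) `^ (s / 2).
Proof.
move=> s0 NA; rewrite (wnrm_N ce (divr_gt0 s0 (ltr0n _ 2)) NA).
have -> : (s / 2)^-1 / 2 = s^-1 by field; rewrite gt_eqF.
by rewrite [in RHS](rtr_cyc _ (sig_comm ce NA)).
Qed.

Lemma wnrm_Nadj' (s : R) A : 0 < s -> N A ->
  wnrm sigma (s / 2) A = (rtr (sigma *m mpw s^-1 (adjm A *m A))) `^ (s / 2).
Proof. by move=> s0 NA; rewrite (wnrm_Nadj s0 NA) [in LHS](rtr_cyc _ (sig_comm ce NA)). Qed.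

Lemma unit_neq0 (A : 'M[C]_n) : A \in unitmx -> A != 0.
Proof.
apply: contraTneq => ->; apply/negP => /mxrank_unit; rewrite mxrank0 => n0.
by have := ce_pos ce; rewrite -n0.
Qed.

(** A and B are invertible because A W B is, and the norm of W involves the inverses of x1 and x2,
    bounded below by [regul_inv_le]. The powers of al and be released there cancel those in the
    norms of A and B. *)
Lemma inf_elem (s p eta m : R) A B W : 0 < s -> 0 < p -> 0 < eta -> 0 < m ->
  (forall i, m <= eig sigma i) -> N A -> N B -> pdm (A *m W *m B) ->
  exists a b, [/\ admissible eta m a, admissible eta m b &
    Phi (p / 2) s (Gam sigma p^-1 (A *m W *m B)) a b <=
    (wnrm sigma (s / 2) A * wnrm sigma (s / 2) B * wnrm sigma p^-1 W) `^ p].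
Proof.
move=> s0 p0 eta0 m0 hm NA NB pX.
have := pd_unit pX; rewrite !unitmx_mul => /andP[/andP[uA uW] uB].
pose x1 := A *m adjm A; pose x2 := adjm B *m B.
have ux1 : x1 \in unitmx by rewrite unitmx_mul uA unitmx_adj.
have ux2 : x2 \in unitmx by rewrite unitmx_mul uB unitmx_adj uB.
have px1 : psdm x1 := psd_adjMr A; have px2 : psdm x2 := psd_adjMl B.
have Nx1 : N x1 by apply: (N_mul ce) => //; exact: (N_adj ce).
have Nx2 : N x2 by apply: (N_mul ce) => //; exact: (N_adj ce).
have z1 := unit_neq0 ux1; have z2 := unit_neq0 ux2.
exists (regul s eta x1), (regul s eta x2).
split; [exact: regul_admissible|exact: regul_admissible|].
rewrite wnrm_Nadj // wnrm_Nadj' // -/x1 -/x2.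
set al := rtr (sigma *m mpw s^-1 x1); set be := rtr (sigma *m mpw s^-1 x2).
have al0 : 0 < al by apply: rtr_sig_pow_gt0 => //; rewrite invr_gt0.
have be0 : 0 < be by apply: rtr_sig_pow_gt0 => //; rewrite invr_gt0.
set Z := Gam sigma p^-1 _.
have hZ : hermm Z.
  rewrite /Z /Gam -{2}(mpw_herm _ sigma).
  by apply: psdm_herm; apply: psd_congr; exact: pdm_psd.
rewrite wnrm_fin ?gt_eqF ?invr_gt0 // invrK.
set G := Gam sigma p^-1 W.
have ZE : Z = A *m G *m B by rewrite /Z (Gam_N ce).
have GE : G = invmx A *m Z *m invmx B.
  by rewrite ZE !mulmxA mulVmx // mul1mx mulmxK.
have e1 : adjm (invmx A) *m invmx A = mpw (-1) x1.
  rewrite (mpwN1 (psd_unit_pd px1 ux1)) -[LHS]mulmx1 -(mulmxV ux1) mulmxA.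
  rewrite [X in X *m invmx x1](_ : _ = 1%:M) ?mul1mx // /x1 mulmxA mulmxKV //.
  by rewrite -adjmM mulmxV // adjm1.
have e2 : invmx B *m adjm (invmx B) = mpw (-1) x2.
  rewrite (mpwN1 (psd_unit_pd px2 ux2)) -[LHS]mulmx1 -(mulmxV ux2) mulmxA.
  rewrite [X in X *m invmx x2](_ : _ = 1%:M) ?mul1mx // /x2 -mulmxA.
  by rewrite (mulmxA _ (adjm B)) -adjmM mulmxV // adjm1 mul1mx mulVmx.
have e3 : rtr (mpw (p / 2) (adjm G *m G)) = Tform (p / 2) (mpw (-1) x1) Z (mpw (-1) x2).
  by rewrite GE rtr_form_cyc // e1 e2.
have l1 := regul_inv_le s0 eta0 px1 z1 ux1.
have l2 := regul_inv_le s0 eta0 px2 z2 ux2.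
rewrite -/al in l1; rewrite -/be in l2.
have lT : Tform (p / 2) (rc S (al `^ (- s)) *: mpw (- s) (regul s eta x1)) Z
     (rc S (be `^ (- s)) *: mpw (- s) (regul s eta x2)) <=
   Tform (p / 2) (mpw (-1) x1) Z (mpw (-1) x2).
  by apply: Tform_le => //; rewrite ?divr_gt0 //; apply: psdZ; rewrite ?powR_ge0 //; exact: mpw_psd.
rewrite Tform_Phi ?powR_ge0 // in lT.
rewrite e3; set T := Tform _ _ _ _ in lT *.
have T0 : 0 <= T by rewrite /T -e3; exact: rtr_mpw_ge0.
have pp : p^-1 * p = 1 by rewrite mulVf // gt_eqF.
rewrite powRM ?mulr_ge0 ?powR_ge0 // -powRrM pp powRr1 // -powRM ?(ltW al0) ?(ltW be0) //.
have ab0 : 0 < al * be by rewrite mulr_gt0.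
rewrite -powRM ?(ltW al0) ?(ltW be0) // -powRrM in lT.
rewrite -powRrM.
apply: le_trans (ler_wpM2l (powR_ge0 _ _) lT); rewrite [leRHS]mulrA -powRD.
  have -> : s / 2 * p + - s * (p / 2) = 0 by lra.
  by rewrite powRr0 mul1r.
by rewrite (gt_eqF ab0) implybT.
Qed.

(** No inverse occurs, so A and B may be singular; being nonzero makes al and be positive.
    [regul_ge] bounds x1 and x2 from above, and the powers of al and be again cancel. *)
Lemma sup_elem (s p eta m : R) A B X : 0 < s -> 0 < p -> 0 < eta -> 0 < m ->
  (forall i, m <= eig sigma i) -> N A -> N B -> A != 0 -> B != 0 -> pdm X ->
  exists a b, [/\ admissible eta m a, admissible eta m b &
    (wnrm sigma p^-1 (A *m X *m B) / (wnrm sigma (s / 2) A * wnrm sigma (s / 2) B)) `^ p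
    <= Phi (p / 2) (- s) (Gam sigma p^-1 X) a b].
Proof.
move=> s0 p0 eta0 m0 hm NA NB A0 B0 pX.
pose x1 := adjm A *m A; pose x2 := B *m adjm B.
have px1 : psdm x1 := psd_adjMl A; have px2 : psdm x2 := psd_adjMr B.
have Nx1 : N x1 by apply: (N_mul ce) => //; exact: (N_adj ce).
have Nx2 : N x2 by apply: (N_mul ce) => //; exact: (N_adj ce).
have z1 : x1 != 0 by apply: contra_neq A0 => /adjmM_eq0.
have z2 : x2 != 0.
  apply: contra_neq B0 => h; rewrite -[B]adjmK.
  have -> : adjm B = 0 by apply: adjmM_eq0; rewrite adjmK.
  by apply/matrixP => i j; rewrite !mxE rmorph0.
exists (regul s eta x1), (regul s eta x2).
split; [exact: regul_admissible|exact: regul_admissible|].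
rewrite (wnrm_Nadj s0 NB) (wnrm_Nadj' s0 NA) -/x1 -/x2.
set al := rtr (sigma *m mpw s^-1 x1); set be := rtr (sigma *m mpw s^-1 x2).
have al0 : 0 < al by apply: rtr_sig_pow_gt0 => //; rewrite invr_gt0.
have be0 : 0 < be by apply: rtr_sig_pow_gt0 => //; rewrite invr_gt0.
set Z := Gam sigma p^-1 _.
have hZ : hermm Z.
  rewrite /Z /Gam -{2}(mpw_herm _ sigma).
  by apply: psdm_herm; apply: psd_congr; exact: pdm_psd.
rewrite wnrm_fin ?gt_eqF ?invr_gt0 // invrK (Gam_N ce) // -/Z.
rewrite rtr_form_cyc // -/x1 -/x2 -/(Tform (p / 2) x1 Z x2).
have l1 := regul_ge s0 eta0 px1 z1; have l2 := regul_ge s0 eta0 px2 z2.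
rewrite -/al in l1; rewrite -/be in l2.
have lT : Tform (p / 2) x1 Z x2 <=
   Tform (p / 2) (rc S (al `^ s) *: mpw s (regul s eta x1)) Z
     (rc S (be `^ s) *: mpw s (regul s eta x2)).
  by apply: Tform_le => //; rewrite divr_gt0.
have TP := @Tform_Phi (p / 2) (- s) _ _ Z (regul s eta x1) (regul s eta x2)
  (powR_ge0 al s) (powR_ge0 be s) hZ.
rewrite opprK in TP; rewrite TP in lT.
set T := Tform _ _ _ _ in lT *.
have T0 : 0 <= T by exact: rtr_mpw_ge0.
have pp : p^-1 * p = 1 by rewrite mulVf // gt_eqF.
have ab0 : 0 < al * be by rewrite mulr_gt0.
rewrite -powRM ?(ltW al0) ?(ltW be0) // -powRN.
rewrite powRM ?powR_ge0 // -!powRrM pp powRr1 //.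
rewrite -powRM ?(ltW al0) ?(ltW be0) // -powRrM in lT.
rewrite mulrC; apply: le_trans (ler_wpM2l (powR_ge0 _ _) lT) _.
rewrite [leLHS]mulrA -powRD.
  have -> : - (s / 2) * p + s * (p / 2) = 0 by lra.
  by rewrite powRr0 mul1r.
by rewrite (gt_eqF ab0) implybT.
Qed.

Lemma wnrm_pow_unit (s : R) a : 0 < s -> N a -> pdm a -> rtr (sigma *m a) = 1 ->
  wnrm sigma (s / 2) (mpw (s / 2) a) = 1.
Proof.
move=> s0 Na pa ra; rewrite wnrm_Nadj //; last by apply: (N_mfn ce) => //; exact: pdm_herm.
rewrite mpw_herm mpwD // mpw_comp -splitr mulfV ?gt_eqF // mpw1 ?ra ?powR1 //.
exact: pdm_psd.
Qed.

(** A = B = a^(s/2) has norm 1, so the value is exactly Phi, free of eta; it will be used at a_0. *)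
Lemma inf_attained (s p : R) a X : 0 < s -> 0 < p -> N a -> pdm a ->
  rtr (sigma *m a) = 1 -> pdm X ->
  exists A B W, [/\ N A, N B, X = A *m W *m B &
   (wnrm sigma (s / 2) A * wnrm sigma (s / 2) B * wnrm sigma p^-1 W) `^ p =
   Phi (p / 2) s (Gam sigma p^-1 X) a a].
Proof.
move=> s0 p0 Na pa ra pX; have ha := pdm_herm pa.
have Nh r : N (mpw r a) by apply: (N_mfn ce).
exists (mpw (s / 2) a), (mpw (s / 2) a), (mpw (- (s / 2)) a *m X *m mpw (- (s / 2)) a).
split; [exact: Nh|exact: Nh| |].
  rewrite !mulmxA mpwD // -(mulmxA _ (mpw (- _) a)) mpwD // addNr subrr mpw0.
  by rewrite mul1mx mulmx1.
rewrite wnrm_pow_unit // !mul1r wnrm_fin ?gt_eqF ?invr_gt0 // invrK.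
rewrite (Gam_N ce) // -powRrM mulVf ?gt_eqF // powRr1 ?rtr_mpw_ge0 //.
set Z := Gam sigma p^-1 X.
have hZ : hermm Z.
  rewrite /Z /Gam -{2}(mpw_herm _ sigma).
  by apply: psdm_herm; apply: psd_congr; exact: pdm_psd.
rewrite rtr_form_cyc // mpw_herm mpwD // mpw_comp /Phi.
by have -> : - (s / 2) - s / 2 = - s by lra.
Qed.

Lemma sup_attained (s p : R) a X : 0 < s -> 0 < p -> N a -> pdm a ->
  rtr (sigma *m a) = 1 -> pdm X ->
  exists A B, [/\ N A, N B, A != 0, B != 0 &
   (wnrm sigma p^-1 (A *m X *m B) / (wnrm sigma (s / 2) A * wnrm sigma (s / 2) B)) `^ p =
   Phi (p / 2) (- s) (Gam sigma p^-1 X) a a].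
Proof.
move=> s0 p0 Na pa ra pX; have ha := pdm_herm pa.
have Nh r : N (mpw r a) by apply: (N_mfn ce).
have u r : mpw r a != 0 by apply/unit_neq0/pd_unit/mpw_pd.
exists (mpw (s / 2) a), (mpw (s / 2) a).
split; [exact: Nh|exact: Nh|exact: u|exact: u|].
rewrite wnrm_pow_unit // mulr1 divr1 wnrm_fin ?gt_eqF ?invr_gt0 // invrK.
rewrite (Gam_N ce) // -powRrM mulVf ?gt_eqF // powRr1 ?rtr_mpw_ge0 //.
set Z := Gam sigma p^-1 X.
have hZ : hermm Z.
  rewrite /Z /Gam -{2}(mpw_herm _ sigma).
  by apply: psdm_herm; apply: psd_congr; exact: pdm_psd.
rewrite rtr_form_cyc // mpw_herm mpwD // mpw_comp /Phi opprK.
by rewrite -splitr.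
Qed.

End Reduction.

(** * Real derivatives at 0 *)

Section ScalarDerivatives.
Variable R : realType.

Lemma rdiffP (f : R -> R) (f1 : R) : rdiff f (f 0) f1 <-> is_derive (0 : R) (1 : R) f f1.
Proof.
pose D := fun h : R => h^-1 *: ((f \o shift 0) (h *: (1 : R)) - f 0).
have DE h : D h = h^-1 * (f h - f 0).
  by rewrite /D /= addr0 [h *: 1]mulr1.
split=> [hf|[dv dE] e e0].
  have cv : D h @[h --> 0^'] --> f1.
    apply/cvgrPdist_le => e e0; have [d d0 h] := hf e e0.
    near=> t; rewrite DE.
    have t0 : t != 0 by near: t; exact: nbhs_dnbhs_neq.
    have td : `|t| < d by near: t; exact: dnbhs0_lt.
    have := h t td; rewrite (distrC f1).
    have -> : t^-1 * (f t - f 0) - f1 = t^-1 * (f t - f 0 - t * f1) by field.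
    by rewrite normrM normfV (mulrC `|t|^-1) ler_pdivrMr ?normr_gt0.
  by apply: DeriveDef; [apply/cvg_ex; exists f1|exact: cvg_lim].
have cv : D h @[h --> 0^'] --> f1 by rewrite -dE; exact: dv.
move/cvgrPdist_le/(_ e e0): cv => [d /= d0 hd]; exists d => // t td.
have [->|t0] := eqVneq t 0; first by rewrite mul0r subrr subr0 normr0 mulr0.
have := hd t; rewrite /= sub0r normrN => /(_ td t0); rewrite DE distrC.
have -> : f t - f 0 - t * f1 = t * (t^-1 * (f t - f 0) - f1) by field.
by move=> hh; rewrite normrM (mulrC e); apply: ler_wpM2l.
Unshelve. all: by end_near.
Qed.

Lemma rdiff_affine (g : R -> R) (g0 g1 a b : R) : rdiff g g0 g1 ->
  rdiff (fun t => a * g t + b) (a * g0 + b) (a * g1).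
Proof.
move=> hg e e0.
have a0 : 0 < `|a| + 1 by rewrite ltr_wpDl.
have [d d0 h] := hg _ (divr_gt0 e0 a0); exists d => // t /h {}h.
have -> : a * g t + b - (a * g0 + b) - t * (a * g1) = a * (g t - g0 - t * g1) by ring.
rewrite normrM (le_trans (ler_wpM2l (normr_ge0 a) h)) //.
rewrite mulrA ler_wpM2r // mulrCA ler_piMr ?(ltW e0) //.
by rewrite ler_pdivrMr // mul1r lerDl.
Qed.

Lemma rdiff_inv (g : R -> R) (g1 : R) : g 0 != 0 -> rdiff g (g 0) g1 ->
  rdiff (fun t => (g t)^-1) (g 0)^-1 (- (g 0) ^- 2 * g1).
Proof.
move=> g0 /rdiffP hg; have := is_deriveV g0 hg.
by move=> /(rdiffP (fun t => (g t)^-1)).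
Qed.

Lemma rdiff_incr_ge0 (g : R -> R) (g1 e : R) : 0 < e -> rdiff g (g 0) g1 ->
  (forall s t, `|s| < e -> `|t| < e -> s < t -> g s < g t) -> 0 <= g1.
Proof.
move=> e0 hg inc; rewrite leNgt; apply/negP => g10.
have e1 : 0 < - g1 / 2 by lra.
have [d d0 h] := hg _ e1; pose t := Num.min (d / 2) (e / 2).
have t0 : 0 < t by rewrite lt_min !divr_gt0.
have td : t < d by rewrite gt_min; apply/orP; left; lra.
have te : t < e by rewrite gt_min; apply/orP; right; lra.
have nt : `|t| = t by rewrite ger0_norm // ltW.
have := inc 0 t; rewrite normr0 nt => /(_ e0 te t0) i1.
have := h t; rewrite nt => /(_ td); rewrite ler_norml => /andP[_].
by nra.
Qed.

Lemma rdiff_root (u g : R -> R) u1 g1 : 0 < u 0 -> rdiff u (u 0) u1 ->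
  rdiff g (g 0) g1 ->
  is_derive (0 : R) (1 : R) (fun t => u t `^ g t)
    (u 0 `^ g 0 * (g 0 * ((u 0)^-1 * u1) + ln (u 0) * g1)).
Proof.
move=> u0 hu /rdiffP dg; have /rdiffP du := hu.
have dln : is_derive (0 : R) (1 : R) (@ln R \o u) ((u 0)^-1 * u1).
  by apply: is_derive1_comp => //; exact: is_derive1_ln.
have dm := is_deriveM dg dln.
have de := @is_derive1_comp R expR (g * (@ln R \o u)) 0 _ _
  (is_derive_expR ((g * (@ln R \o u)) 0)) dm.
have ee : is_derive (0 : R) (1 : R) (expR \o (g * (@ln R \o u)))
    (u 0 `^ g 0 * (g 0 * ((u 0)^-1 * u1) + ln (u 0) * g1)).
  by rewrite powR_expR //; exact: de.
apply: near_eq_is_derive ee.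
have [d d0 h] := rdiff_lip hu.
pose K := 1 + `|u1|; have K0 : 0 < K by rewrite ltr_pwDl.
(* On this radius u(t) stays positive, where the power is exp (g ln u). *)
pose d' := Num.min d (u 0 / K).
have d'0 : 0 < d' by rewrite lt_min d0 divr_gt0.
exists d' => //= t; rewrite /= sub0r normrN lt_min => /andP[td tK].
have ut : 0 < u t.
  have := h t td; rewrite -/K; rewrite ltr_pdivlMr // mulrC in tK.
  by rewrite ler_norml => /andP[a _]; lra.
by rewrite powR_expR.
Qed.

End ScalarDerivatives.

(** * The operator norm and the amalgamated norm at t = 0 *)

Section OperatorNorm.
Variable R : realType.
Variable S : cplx R.
Local Notation C := (ck S).
Variables (n : nat) (N : set 'M[C]_n) (E : 'M[C]_n -> 'M[C]_n) (sigma : 'M[C]_n).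
Hypothesis ce : cond_exp N E sigma.
Implicit Types (A B X : 'M[C]_n).

Lemma wnrm0E A : wnrm sigma 0 A = \big[Num.max/0]_i eig (mab A) i.
Proof. by rewrite /wnrm /schat eqxx /Gam mul0r mpw0 mul1mx mulmx1. Qed.

Lemma wnrm0_ge0 A : 0 <= wnrm sigma 0 A.
Proof. by rewrite wnrm0E; apply/bigmax_geP; left. Qed.

Lemma wnrm0_psd A : psdm (rc S (wnrm sigma 0 A ^+ 2) *: 1%:M - adjm A *m A).
Proof.
set c := wnrm sigma 0 A.
have <- : mfn (fun x => x * x) (mab A) = adjm A *m A.
  have ph : psdm (mab A) by exact: mpw_psd.
  by rewrite -(mfnM id id) (mfn_id (psdm_herm ph)) mpw_half //; exact: psd_adjMl.
rewrite scalemx1 -(mfn_cst _ (mab A)) mfnB; apply: mfn_psd => i.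
have e0 : 0 <= eig (mab A) i by apply: psdm_eig; exact: mpw_psd.
have ec : eig (mab A) i <= c by rewrite /c wnrm0E; apply: le_bigmax.
by rewrite subr_ge0 expr2 ler_pM.
Qed.

(** Congruence by B turns the hypothesis into c x - x^2 >= 0 for x = [B *m adjm B]. This gives c >=
    l at each eigenvalue l > 0; at l = 0 the original form at the eigenvector gives c >= 0. *)
Lemma psd_adj_swap (c : R) B : psdm (rc S c *: 1%:M - adjm B *m B) ->
  psdm (rc S c *: 1%:M - B *m adjm B).
Proof.
move=> h; pose x := B *m adjm B; have px : psdm x := psd_adjMr B.
have hx := psdm_herm px.
rewrite -/x scalemx1 -(mfn_cst c x) -{2}(mfn_id hx) mfnB; apply: mfn_psd => i /=.
have := psd_congr B h; rewrite mulmxBr mulmxBl -scalemxAr mulmx1 -scalemxAl -/x.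
have -> : B *m (adjm B *m B) *m adjm B = x *m x by rewrite /x !mulmxA.
have -> : x *m x = mfn (fun y => y * y) x by rewrite -(mfnM id id) mfn_id.
rewrite -{1}(mfn_id hx) mfnZ mfnB => hp.
have u := eigrow_unit x i.
have li := psdm_eig i px.
have [->|l0] := eqVneq (eig x i) 0; last first.
  have lp : 0 < eig x i by rewrite lt_neqAle eq_sym l0.
  have /ge0_Re_ge0 := hp.2 (eigrow x i).
  rewrite mfnE row_mul_gdiag ?spectral_unit // -scalemxAl -/(eigrow x i) u.
  rewrite !mxE eqxx mulr1 re_rc /= -mulrBl pmulr_lge0 //.
have /ge0_Re_ge0 := h.2 (eigrow x i).
have : 0 <= re S ((eigrow x i *m (adjm B *m B) *m adjm (eigrow x i)) 0 0).
  exact/ge0_Re_ge0/(psd_adjMl B).2.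
rewrite mulmxBr mulmxBl -scalemxAr mulmx1 -scalemxAl u.
have sub (Y Z : 'M[C]_1) : (Y - Z) 0 0 = Y 0 0 - Z 0 0 by rewrite !mxE.
rewrite sub ReB ![(_ *: 1%:M) 0 0]mxE [1%:M 0 0]mxE eqxx mulr1 re_rc; lra.
Qed.

Lemma wnrm_mul_le (q : R) A B W : 0 < q -> N A -> N B ->
  wnrm sigma q^-1 (A *m W *m B) <=
  wnrm sigma 0 A * wnrm sigma 0 B * wnrm sigma q^-1 W.
Proof.
move=> q0 NA NB; have qi : q^-1 != 0 by rewrite gt_eqF ?invr_gt0.
rewrite !(wnrm_fin _ _ qi) !invrK (Gam_N ce) //.
set G := Gam sigma q^-1 W; set a := wnrm sigma 0 A; set b := wnrm sigma 0 B.
have a0 : 0 <= a := wnrm0_ge0 A; have b0 : 0 <= b := wnrm0_ge0 B.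
have a20 : 0 <= a ^+ 2 by rewrite sqr_ge0. have b20 : 0 <= b ^+ 2 by rewrite sqr_ge0.
have q2 : 0 < q / 2 by rewrite divr_gt0.
have cyc X : rtr (mpw (q / 2) (X *m adjm X)) = rtr (mpw (q / 2) (adjm X *m X)).
  rewrite -[mpw _ (X *m _)]mul1mx -[mpw _ (adjm X *m _)]mul1mx.
  by apply: rtr_cyc; rewrite mul1mx mulmx1.
have s1 : rtr (mpw (q / 2) (adjm (A *m G *m B) *m (A *m G *m B))) <=
    (a ^+ 2) `^ (q / 2) * rtr (mpw (q / 2) (adjm (G *m B) *m (G *m B))).
  rewrite -rtrZ -mpwZ //; last exact: psd_adjMl.
  apply: rtr_mpw_le => //; first exact: psd_adjMl.
  have := psd_congr_sub (adjm (G *m B)) (wnrm0_psd A).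
  rewrite adjmK -/a -scalemxAr mulmx1 -scalemxAl.
  by rewrite -[A *m G *m B]mulmxA [adjm (A *m _)]adjmM !mulmxA.
have s2 : rtr (mpw (q / 2) (adjm (G *m B) *m (G *m B))) <=
    (b ^+ 2) `^ (q / 2) * rtr (mpw (q / 2) (adjm G *m G)).
  rewrite -cyc -(cyc G) -rtrZ -mpwZ //; last exact: psd_adjMr.
  apply: rtr_mpw_le => //; first exact: psd_adjMr.
  have := psd_congr_sub G (psd_adj_swap (wnrm0_psd B)).
  by rewrite -/b -scalemxAr mulmx1 -scalemxAl [adjm (G *m B)]adjmM !mulmxA.
have sq (x : R) : 0 <= x -> (x ^+ 2) `^ (q / 2) = x `^ q.
  by move=> x0; rewrite -powR_mulrn // -powRrM mulrCA mulfV ?pnatr_eq0 // mulr1.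
rewrite (sq a a0) in s1; rewrite (sq b b0) in s2.
have s3 := le_trans s1 (ler_wpM2l (powR_ge0 a q) s2).
have := @ge0_ler_powR R q^-1; rewrite invr_ge0 => /(_ (ltW q0)) mono.
apply: le_trans (mono _ _ _ _ s3) _; rewrite ?nnegrE ?rtr_mpw_ge0 //.
  by rewrite !mulr_ge0 ?powR_ge0 ?rtr_mpw_ge0.
move: (rtr _) (rtr_mpw_ge0 (q / 2) (adjm G *m G)) => w w0.
rewrite (powRM _ (powR_ge0 _ _)) ?mulr_ge0 ?powR_ge0 // (powRM _ (powR_ge0 _ _)) //.
have rq (x : R) : 0 <= x -> (x `^ q) `^ q^-1 = x.
  by move=> x0; rewrite -powRrM mulfV ?gt_eqF // powRr1.
by clearbody a b; rewrite (rq a a0) (rq b b0) mulrA lexx.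
Qed.

Lemma wnrm01 : wnrm sigma 0 1%:M = 1.
Proof.
have e1 i : eig (mab (1%:M : 'M[C]_n)) i = 1.
  have -> : mab (1%:M : 'M[C]_n) = mfn (fun=> 1) sigma.
    rewrite /mab adjm1 mulmx1 mfn1 /mpw -(mfn1 sigma) mfn_comp.
    by apply: mfn_ext => j /=; rewrite powR1.
  by have [j ->] := eig_mfn (fun=> 1) sigma i.
rewrite wnrm0E; apply/eqP; rewrite eq_le; apply/andP; split.
  by apply/bigmax_leP; split => // i _; rewrite e1.
rewrite -(e1 (Ordinal (ce_pos ce))); exact: le_bigmax.
Qed.

Lemma wnrm_ge0 th X : 0 <= wnrm sigma th X.
Proof.
have [->|t0] := eqVneq th 0; first exact: wnrm0_ge0.
by rewrite wnrm_fin // powR_ge0.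
Qed.

(** Here 1/r = 0, the outer factors carry operator norms, and a substitution by a power of a is
    void. The Hoelder bound [wnrm_mul_le] is attained at A = B = 1. *)
Lemma aminf_diag (q : R) X : 0 < q -> aminf N sigma q q X = wnrm sigma q^-1 X.
Proof.
move=> q0; rewrite /aminf subrr mul0r; set T := [set v | _].
have T1 : T (wnrm sigma q^-1 X).
  exists 1%:M, 1%:M, X; rewrite wnrm01 !mul1r mul1mx mulmx1.
  by split => //; exact: (ce_one ce).
have lb : lbound T (wnrm sigma q^-1 X).
  by move=> v [A [B [W [NA NB -> ->]]]]; exact: wnrm_mul_le.
apply/eqP; rewrite eq_le; apply/andP; split.
  by apply: ge_inf => //; exists (wnrm sigma q^-1 X).
by apply: lb_le_inf => //; exists (wnrm sigma q^-1 X).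
Qed.

End OperatorNorm.

(** * Derivative of the amalgamated norm *)
Section FirstOrder.
Variable R : realType.
Variable S : cplx R.
Local Notation C := (ck S).
Variable n : nat.

Lemma udiff_ext (I : Type) (T : set I) (F : R -> I -> 'M[C]_n) F0 F0' F1 :
  (forall i, F0 i = F0' i) -> udiff T F F0 F1 -> udiff T F F0' F1.
Proof. by move=> /funext ->. Qed.

Lemma udiff_ext2 (I : Type) (T : set I) (F : R -> I -> 'M[C]_n) F0 F0' F1 F1' :
  (forall i, F0 i = F0' i) -> (forall i, F1 i = F1' i) ->
  udiff T F F0 F1 -> udiff T F F0' F1'.
Proof. by move=> /funext -> /funext ->. Qed.

Lemma hermm_sandwich (A X B : 'M[C]_n) : hermm A -> hermm X -> hermm B ->
  hermm (A *m X *m B *m X *m A).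
Proof. by rewrite /hermm => hA hX hB; rewrite !adjmM hA hX hB !mulmxA. Qed.

(** The derivative of the five-fold product in Phi, traced against D, a power of Z: cyclicity
    collects the outer variation F twice and the middle one G once. *)
Lemma rtr_first_order (D Z V W F G Z1 : 'M[C]_n) :
  D *m Z = V -> Z *m D = V -> V *m Z = W -> Z *m V = W ->
  rtr (D *m (Z *m Z *m F + (Z *m Z1 + (Z *m G + (Z1 + F *m Z)) *m Z))) =
  2 * rtr (W *m F) + rtr (W *m G) + 2 * rtr (V *m Z1).
Proof.
move=> DZ ZD VZ ZV; rewrite !(mulmxDr, mulmxDl) !rtrD.
have e1 : rtr (D *m (Z *m Z *m F)) = rtr (W *m F) by rewrite !mulmxA DZ VZ.
have e2 : rtr (D *m (Z *m Z1)) = rtr (V *m Z1) by rewrite mulmxA DZ.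
have e3 : rtr (D *m (Z *m G *m Z)) = rtr (W *m G).
  by rewrite !mulmxA DZ rtrC mulmxA ZV.
have e4 : rtr (D *m (Z1 *m Z)) = rtr (V *m Z1).
  by rewrite mulmxA rtrC mulmxA ZD.
have e5 : rtr (D *m (F *m Z *m Z)) = rtr (W *m F).
  by rewrite !mulmxA rtrC !mulmxA -mulmxA rtrC -!mulmxA rtrC !mulmxA -ZV -ZD !mulmxA.
by rewrite e1 e2 e3 e4 e5; ring.
Qed.

Lemma mpw_sq k (Z : 'M[C]_n) : pdm Z -> mpw k (Z *m Z) = mpw (2 * k) Z.
Proof.
move=> pZ; have hZ := pdm_herm pZ.
have -> : Z *m Z = mpw 2 Z.
  by rewrite -{1 2}(mpw1 (pdm_psd pZ)) mpwD //; congr (mpw _ _).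
by rewrite mpw_comp.
Qed.

End FirstOrder.

(** * Passing from p(t)-th powers to the norm *)

Section RootBounds.
Variable R : realType.
Implicit Types (T : set R).

Lemma powR_rootK (x r : R) : 0 <= x -> r != 0 -> (x `^ r) `^ r^-1 = x.
Proof. by move=> x0 r0; rewrite -powRrM mulfV // powRr1. Qed.

Lemma powR_root_inv (x r : R) : 0 <= x -> r != 0 -> (x `^ r^-1) `^ r = x.
Proof. by move=> x0 r0; rewrite -powRrM mulVf // powRr1. Qed.

Lemma powR_mono (r x y : R) : 0 < r -> 0 <= x -> x <= y -> x `^ r <= y `^ r.
Proof.
move=> r0 x0 xy; apply: ge0_ler_powR => //; rewrite ?nnegrE //; first exact: ltW.
exact: le_trans xy.
Qed.

Lemma inf_powR T (r L x0 : R) : 0 < r -> T x0 ->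
  (forall x, T x -> 0 <= x /\ L <= x `^ r) ->
  [/\ 0 <= inf T, L <= inf T `^ r & inf T `^ r <= x0 `^ r].
Proof.
move=> r0 Tx0 h; have rn : r != 0 by rewrite gt_eqF.
have T0 : T !=set0 by exists x0.
have i0 : 0 <= inf T by apply: lb_le_inf => // x /h[].
split=> //.
  (* L stands for a first-order approximation and may be negative, where no root can be taken. *)
  have [L0|/ltW L0] := leP L 0; first exact: le_trans L0 (powR_ge0 _ _).
  have : L `^ r^-1 <= inf T.
    apply: lb_le_inf => // x /h[x1 Lx]; rewrite -(powR_rootK x1 rn).
    by apply: powR_mono; rewrite ?invr_gt0.
  by move=> /(powR_mono r0 (powR_ge0 _ _)); rewrite powR_root_inv.
by apply: powR_mono => //; apply: ge_inf => //; exists 0 => x /h[].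
Qed.

Lemma sup_powR T (r U x0 : R) : 0 < r -> T x0 ->
  (forall x, T x -> 0 <= x /\ x `^ r <= U) ->
  [/\ 0 <= sup T, sup T `^ r <= U & x0 `^ r <= sup T `^ r].
Proof.
move=> r0 Tx0 h; have rn : r != 0 by rewrite gt_eqF.
have T0 : T !=set0 by exists x0.
have U0 : 0 <= U by apply: le_trans (powR_ge0 _ _) (h _ Tx0).2.
have ub : ubound T (U `^ r^-1).
  move=> x /h[x1 xU]; rewrite -(powR_rootK x1 rn).
  by apply: powR_mono; rewrite ?invr_gt0 ?powR_ge0.
have x0s : x0 <= sup T by apply: ub_le_sup => //; exists (U `^ r^-1).
have x00 := (h _ Tx0).1; have s0 : 0 <= sup T := le_trans x00 x0s.
split=> //; last exact: powR_mono.
rewrite -[leRHS](powR_root_inv U0 rn); apply: powR_mono => //.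
exact: ge_sup.
Qed.

Lemma log_slack (c x y L eps : R) : 0 <= c -> c * y <= eps / 2 ->
  x <= 2 * L + 2 * y -> c / 2 * x <= c * L + eps / 2.
Proof.
move=> c0 cy xL; have : 0 <= c * (2 * L + 2 * y - x) by rewrite mulr_ge0 ?subr_ge0.
lra.
Qed.

(** Half of eps pays for the expansion and half for the eta-error in z. For t < 0 an upper bound on
    z gives an upper bound on x, as the supremum needs; for t > 0 it gives the lower bound for the
    infimum. *)
Lemma expand_upper (t x Q h z w eps : R) : t < 0 -> z <= w + eps / 2 ->
  `|x - Q - t * (h - z)| <= eps / 2 * `|t| -> x <= Q + t * (h - w) - eps * t.
Proof.
move=> t0 zw; rewrite (ltr0_norm t0) ler_norml => /andP[_ f].
have : 0 <= (- t) * (w + eps / 2 - z) by rewrite mulr_ge0 ?subr_ge0 // oppr_ge0 ltW.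
lra.
Qed.

Lemma expand_lower (t x Q h z w eps : R) : 0 < t -> z <= w + eps / 2 ->
  `|x - Q - t * (h - z)| <= eps / 2 * `|t| -> Q + t * (h - w) - eps * t <= x.
Proof.
move=> t0 zw; rewrite (gtr0_norm t0) ler_norml => /andP[f _].
have : 0 <= t * (w + eps / 2 - z) by rewrite mulr_ge0 ?subr_ge0 // ltW.
lra.
Qed.

Lemma sandwich_neg (t x y Q g eps : R) : t < 0 -> `|x - Q - t * g| <= eps * `|t| ->
  x <= y -> y <= Q + t * g - eps * t -> `|y - Q - t * g| <= eps * `|t|.
Proof.
move=> t0; rewrite (ltr0_norm t0) !ler_norml => /andP[f _] xy yQ.
by apply/andP; split; lra.
Qed.

Lemma sandwich_pos (t x y Q g eps : R) : 0 < t -> `|x - Q - t * g| <= eps * `|t| ->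
  y <= x -> Q + t * g - eps * t <= y -> `|y - Q - t * g| <= eps * `|t|.
Proof.
move=> t0; rewrite (gtr0_norm t0) !ler_norml => /andP[_ f] xy yQ.
by apply/andP; split; lra.
Qed.

(** v is the p(t)-th root of v^p(t); base and exponent both move, hence the term in ln Q. *)
Lemma derive_of_powR_expand (v p : R -> R) (q s1 Q G1 : R) : 0 < Q -> p 0 = q ->
  rdiff (fun t => (p t)^-1) q^-1 (- s1) -> v 0 `^ q = Q ->
  (forall eps : R, 0 < eps -> exists2 d : R, 0 < d & forall t, `|t| < d ->
     [/\ 0 < p t, 0 <= v t & `|v t `^ p t - Q - t * G1| <= eps * `|t|]) ->
  is_derive (0 : R) (1 : R) v (Q `^ q^-1 * (q^-1 * (Q^-1 * G1) + ln Q * (- s1))).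
Proof.
move=> Q0 p0 dg v0 h; rewrite -p0 in v0 dg *.
have du : rdiff (fun t => v t `^ p t) (v 0 `^ p 0) G1.
  move=> eps eps0; have [d d0 k] := h _ eps0; rewrite v0.
  by exists d => // t /k[].
have u0 : 0 < v 0 `^ p 0 by rewrite v0.
have := @rdiff_root R _ _ _ _ u0 du dg; rewrite /= v0.
apply: near_eq_is_derive; have [d d0 k] := h _ ltr01.
exists d => //= t; rewrite /= sub0r normrN => /k[pt vt _].
by rewrite powR_rootK // gt_eqF.
Qed.

End RootBounds.

(** * Uniform expansion of Phi and derivative of the norm *)

Section MainExpansion.
Variable R : realType.
Variable S : cplx R.
Local Notation C := (ck S).
Variables (n : nat) (N : set 'M[C]_n) (E : 'M[C]_n -> 'M[C]_n) (sigma : 'M[C]_n).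
Hypothesis ce : cond_exp N E sigma.
Variables (p : R -> R) (q p1 : R) (Y : R -> 'M[C]_n) (Y1 : 'M[C]_n) (e : R).
Hypotheses (e0 : 0 < e) (dp : rdiff p q p1) (p0 : p 0 = q) (q1 : 1 <= q).
Hypothesis inc : forall s t : R, `|s| < e -> `|t| < e -> s < t -> p s < p t.
Hypothesis pY : forall t, `|t| < e -> pdm (Y t).
Hypothesis dY : udiff [set: unit] (fun t _ => Y t) (fun=> Y 0) (fun=> Y1).

Let Zt t := Gam sigma (p t)^-1 (Y t).
Let Z := Gam sigma q^-1 (Y 0).
Let W := mpw q Z.
Let Q := rtr W.
Let s t := q^-1 - (p t)^-1.
Let s1 := p1 / q ^+ 2.
Let V := mpw (q - 1) Z.
(** The part of the first-order coefficient independent of a and b: from the outer exponent, from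
    Y(t), and from the exponent 1/p(t) of sigma. *)
Let h1 := p1 * rtr (W *m mlg Z) + q * rtr (V *m Gam sigma q^-1 Y1)
          - p1 / q * rtr (W *m mlg sigma).

Let q0 : 0 < q. Proof. exact: lt_le_trans ltr01 q1. Qed.
Let ps : pdm sigma := ce_sig ce.
Let pY0 : pdm (Y 0). Proof. by apply: pY; rewrite normr0. Qed.

Lemma Gam_pd r X : pdm X -> pdm (Gam sigma r X).
Proof.
move=> pX; rewrite /Gam -{2}(mpw_herm _ sigma); apply: pd_congr => //.
exact/pd_unit/mpw_pd.
Qed.

Let pZ : pdm Z. Proof. exact: Gam_pd. Qed.
Let pW : pdm W. Proof. exact: mpw_pd. Qed.
Let Q0 : 0 < Q. Proof. by rewrite rtr_pd_gt0 // (ce_pos ce). Qed.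

Let dpi : rdiff (fun t => (p t)^-1) q^-1 (- s1).
Proof.
have := @rdiff_inv R p p1; rewrite p0 => /(_ (lt0r_neq0 q0) dp).
by rewrite /s1 mulNr mulrC.
Qed.

Let ds c : rdiff (fun t => c * s t) 0 (c * s1).
Proof.
have := rdiff_affine (- c) (c * q^-1) dpi.
have -> : (fun t => - c * (p t)^-1 + c * q^-1) = (fun t => c * s t).
  by apply/funext => t; rewrite /s; ring.
by rewrite mulNr addNr mulrNN.
Qed.

Let Z1 := Z *m (rc S (- s1 / 2) *: mlg sigma) + Gam sigma q^-1 Y1
          + (rc S (- s1 / 2) *: mlg sigma) *m Z.

Let dZ (I : Type) (T : set I) : udiff T (fun t _ => Zt t) (fun=> Z) (fun=> Z1).
Proof.
suff : udiff [set: unit] (fun t _ => Zt t) (fun=> Z) (fun=> Z1).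
  exact: (@udiff_map R S unit I setT T n (fun=> tt)).
have [m [M [m0 sp]]] := specin_bounds ps.
have dg : rdiff (fun t => (p t)^-1 / 2) (q^-1 / 2) (- s1 / 2).
  have := rdiff_affine 2^-1 0 dpi.
  have -> : (fun t => 2^-1 * (p t)^-1 + 0) = (fun t => (p t)^-1 / 2).
    by apply/funext => t; rewrite addr0 mulrC.
  by rewrite addr0 ![2^-1 * _]mulrC.
have dS := @udiff_map R S 'M[C]_n unit _ setT n (fun=> sigma) _ _ _
  (fun _ _ => sp) (@udiff_mpw R S n m M _ _ _ m0 dg).
have := udiff_mul (udiff_mul dS dY) dS.
rewrite /comp -/(Gam sigma q^-1 (Y 0)) -/Z.
set S0 := mpw (q^-1 / 2) sigma; set S1 := rc S _ *: mfn _ _.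
have S1l : S1 = S0 *m (rc S (- s1 / 2) *: mlg sigma).
  by rewrite -scalemxAr mfnM.
have S1r : S1 = (rc S (- s1 / 2) *: mlg sigma) *m S0.
  by rewrite -scalemxAl mfnM; congr (_ *: _); apply: mfn_ext => i; rewrite mulrC.
have -> : S0 *m Y 0 *m S1 + (S0 *m Y1 + S1 *m Y 0) *m S0 = Z1.
  rewrite {1}S1l S1r /Z1 mulmxDl addrA; congr (_ + _ + _).
    by rewrite /Z /Gam -/S0 !mulmxA.
  by rewrite /Z /Gam -/S0 !mulmxA.
by [].
Qed.

(** As s(0) = 0, every pair (a, b) starts from the base point Z^2. The exponent -s/2 of a occurs
    twice and -s of b once, so both logarithms get the weight -s1, times the outer exponent q/2. *)
Lemma phi_expand (eta M : R) : 0 < eta -> forall eps : R, 0 < eps ->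
  exists2 d : R, 0 < d & forall t a b, `|t| < d -> specin eta M a -> specin eta M b ->
  `|Phi (p t / 2) (s t) (Zt t) a b - Q
     - t * (h1 - q * s1 / 2 * rtr (W *m (mlg a + mlg b)))| <= eps * `|t|.
Proof.
move=> eta0 eps eps0.
pose I := ('M[C]_n * 'M[C]_n)%type.
pose T : set I := [set i | specin eta M i.1 /\ specin eta M i.2].
have dF : udiff T (fun t i => mpw (- s t / 2) i.1) (fun=> 1%:M)
    (fun i => rc S (- s1 / 2) *: mfn (fun x => x `^ 0 * ln x) i.1).
  have hg : rdiff (fun t => - s t / 2) 0 (- s1 / 2).
    have := ds (- 2^-1).
    have -> : (fun t => - 2^-1 * s t) = (fun t => - s t / 2).
      by apply/funext => t; rewrite mulNr mulrC mulNr.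
    by rewrite mulNr mulrC -mulNr.
  apply: (@udiff_ext _ _ _ _ _ _ (fun i : I => mpw 0 i.1)); first by move=> i; rewrite mpw0.
  exact: (@udiff_map R S 'M[C]_n I _ T n fst _ _ _ (fun i h => h.1)
     (@udiff_mpw R S n eta M _ _ _ eta0 hg)).
have dG : udiff T (fun t i => mpw (- s t) i.2) (fun=> 1%:M)
    (fun i => rc S (- s1) *: mfn (fun x => x `^ 0 * ln x) i.2).
  have hg : rdiff (fun t => - s t) 0 (- s1).
    have := ds (- 1).
    have -> : (fun t => - 1 * s t) = (fun t => - s t).
      by apply/funext => t; rewrite mulN1r.
    by rewrite mulN1r.
  apply: (@udiff_ext _ _ _ _ _ _ (fun i : I => mpw 0 i.2)); first by move=> i; rewrite mpw0.
  exact: (@udiff_map R S 'M[C]_n I _ T n snd _ _ _ (fun i h => h.2)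
     (@udiff_mpw R S n eta M _ _ _ eta0 hg)).
have dN := udiff_mul (udiff_mul (udiff_mul (udiff_mul dF (dZ T)) dG) (dZ T)) dF.
have hr : rdiff (fun t => p t / 2) (q / 2) (p1 / 2).
  have := rdiff_affine 2^-1 0 dp.
  have -> : (fun t => 2^-1 * p t + 0) = (fun t => p t / 2).
    by apply/funext => t; rewrite addr0 mulrC.
  by rewrite addr0 ![2^-1 * _]mulrC.
have pZZ : pdm (Z *m Z) by apply: pd_commM.
have hN t (i : I) : `|t| < e -> T i ->
   hermm (mpw (- s t / 2) i.1 *m Zt t *m mpw (- s t) i.2 *m Zt t *m mpw (- s t / 2) i.1).
  move=> te _; have hZ : hermm (Zt t) by apply/pdm_herm/Gam_pd/pY.
  by apply: hermm_sandwich => //; exact: mpw_herm.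
have {}dN : udiff T (fun t i => mpw (- s t / 2) i.1 *m Zt t *m mpw (- s t) i.2 *m Zt t
      *m mpw (- s t / 2) i.1) (fun=> Z *m Z)
   (fun i => let F := rc S (- s1 / 2) *: mlg i.1 in let G := rc S (- s1) *: mlg i.2 in
     Z *m Z *m F + (Z *m Z1 + (Z *m G + (Z1 + F *m Z)) *m Z)).
  have lE (a : 'M[C]_n) : mfn (fun x => x `^ 0 * ln x) a = mlg a.
    by apply: mfn_ext => j; rewrite powRr0 mul1r.
  by apply: udiff_ext2 dN => i /=; rewrite !mul1mx !mulmx1 ?lE.
have [d d0 hd] := udiff_rtr_mpw e0 pZZ dN hN hr eps0.
exists d => // t a b td sa sb; have := hd t (a, b) td (conj sa sb).
have q2 : 2 * (q / 2) = q by rewrite mulrC divfK // pnatr_eq0.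
rewrite /= /Phi !mpw_sq // q2 -/W -/Q.
have -> : rtr (mfn (fun x => x `^ (q / 2) * ln x) (Z *m Z)) = 2 * rtr (W *m mlg Z).
  have -> : Z *m Z = mpw 2 Z by rewrite -{1 2}(mpw1 (pdm_psd pZ)) mpwD.
  rewrite /mpw mfn_comp /W mfnM -rtrZ mfnZ; congr rtr; apply: mfn_ext => i /=.
  by rewrite -powRrM q2 ln_powR; ring.
have mZ r : mpw r Z *m Z = mpw (r + 1) Z.
  by rewrite -{2}(mpw1 (pdm_psd pZ)) mpwD.
have Zm r : Z *m mpw r Z = mpw (r + 1) Z.
  by rewrite -{1}(mpw1 (pdm_psd pZ)) mpwD // addrC.
have d1 : 2 * (q / 2 - 1) + 1 = q - 1 by rewrite mulrBr q2; ring.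
have d2 : q - 1 + 1 = q by rewrite subrK.
rewrite (@rtr_first_order R S n _ Z V W); last first.
- by rewrite /V Zm d2.
- by rewrite /V mZ d2.
- by rewrite Zm d1.
- by rewrite mZ d1.
rewrite -!scalemxAr !rtrZ.
have -> : rtr (V *m Z1) = rtr (V *m Gam sigma q^-1 Y1) - s1 * rtr (W *m mlg sigma).
  rewrite /Z1 !mulmxDr !rtrD -scalemxAl -!scalemxAr !rtrZ.
  have a1 : rtr (V *m (Z *m mlg sigma)) = rtr (W *m mlg sigma).
    by rewrite (mulmxA V Z) /V mZ d2.
  have a2 : rtr (V *m (mlg sigma *m Z)) = rtr (W *m mlg sigma).
    by rewrite (mulmxA V) (rtrC _ Z) (mulmxA Z V) /V Zm d2.
  rewrite a1 a2; move: (rtr _) (rtr (W *m _)) => x y.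
  by field.
rewrite mulmxDr rtrD /h1.
have qs : p1 / q = q * s1 by rewrite /s1; field; rewrite gt_eqF.
rewrite qs.
move: (rtr (W *m mlg a)) (rtr (W *m mlg b)) (rtr (W *m mlg Z)) (rtr (W *m mlg sigma))
  (rtr (V *m Gam sigma q^-1 Y1)) (rtr (mpw _ _)) Q s1 => x1 x2 x3 x4 x5 x6 x7 x8.
set u := (X in _ - t * X); set v := (X in _ -> `|_ - t * X| <= _).
by have -> : u = v by rewrite /u /v; field.
Qed.

Let a0 := ndens E sigma W.
Let L0 := rtr (W *m mlg a0).
Let G1 := h1 - q * s1 * L0.
Let v t := amlg N sigma q (p t) (Y t).

(** The sign fixes the direction in which the bound on tr (W ln a) acts on the first-order
    coefficient. *)
Let s10 : 0 <= s1.
Proof.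
rewrite /s1 divr_ge0 ?sqr_ge0 //; apply: (rdiff_incr_ge0 e0 _ inc).
by rewrite p0.
Qed.

Let p_gt0 : exists2 d : R, 0 < d & forall t, `|t| < d -> 0 < p t.
Proof.
have [d d0 h] := rdiff_lip dp.
pose K := 1 + `|p1|; have K0 : 0 < K by rewrite ltr_pwDl.
exists (Num.min d (q / K)) => [|t]; first by rewrite lt_min d0 divr_gt0.
rewrite lt_min => /andP[/h]; rewrite -/K ltr_pdivlMr // mulrC => a b.
by move: a; rewrite ler_norml => /andP[a _]; move: q0 => ?; lra.
Qed.

Lemma wnrm_diag : wnrm sigma q^-1 (Y 0) = Q `^ q^-1.
Proof.
have qn : q^-1 != 0 by rewrite gt_eqF ?invr_gt0.
have ZZ : adjm Z *m Z = Z *m Z by rewrite (pdm_herm pZ).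
have q2 : 2 * (q / 2) = q by rewrite mulrC divfK // pnatr_eq0.
rewrite (wnrm_fin sigma (Y 0) qn) invrK [adjm _ *m _]ZZ (mpw_sq _ pZ) q2.
by [].
Qed.

Lemma admissible_log_le (eta m : R) a b :
  admissible N sigma eta m a -> admissible N sigma eta m b ->
  rtr (W *m (mlg a + mlg b)) <= 2 * L0 + 2 * (Q * eta).
Proof.
move=> [Na _ pa ra] [Nb _ pb rb]; rewrite mulmxDr rtrD.
have := ent_bound ce pW pa Na ra; have := ent_bound ce pW pb Nb rb.
rewrite -/a0 -/L0 -/Q; lra.
Qed.

Lemma amlg_expand (eps : R) : 0 < eps -> exists2 d : R, 0 < d & forall t, `|t| < d ->
  [/\ 0 < p t, 0 <= v t & `|v t `^ p t - Q - t * G1| <= eps * `|t|].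
Proof.
move=> eps0.
have qs0 : 0 <= q * s1 by rewrite mulr_ge0 // ltW.
(* eta is chosen so that the error q s1 Q eta is at most eps/2; the summand 1 covers s1 = 0. *)
pose K := q * s1 * Q + 1.
have K0 : 0 < K by rewrite ltr_wpDl // mulr_ge0 // ltW.
pose eta := eps / 2 / K; have e2 : 0 < eps / 2 by rewrite divr_gt0.
have eta0 : 0 < eta by rewrite divr_gt0.
have Keta : q * s1 * (Q * eta) <= eps / 2.
  have : K * eta = eps / 2 by rewrite mulrC divfK // gt_eqF.
  rewrite /K => <-; rewrite mulrDl mul1r mulrA lerDl; exact: ltW.
have [m m0 hm] := sig_lower ce.
have pa0 : pdm a0 := ndens_pd ce pW; have Na0 : N a0 := ndens_N ce W.
have ra0 : rtr (sigma *m a0) = 1 := rtr_sig_ndens ce pW.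
have [m' [M' [m'0 sa0]]] := specin_bounds pa0.
have [d1 d10 h_1] := phi_expand ((1 + eta) / m) eta0 e2.
(* a_0 satisfies the constraint with eta = 0 and has spectral bounds of its own, so it takes a
   second instance of the expansion. *)
have [d2 d20 h2] := phi_expand M' m'0 eps0.
have [d3 d30 h3] := p_gt0.
pose d := Num.min (Num.min d1 d2) (Num.min d3 e).
exists d => [|t]; first by rewrite !lt_min d10 d20 d30 e0.
rewrite !lt_min => /andP[/andP[td1 td2] /andP[td3 te]].
have pt := h3 _ td3; have pYt := pY te.
have P0 := h2 t a0 a0 td2 sa0 sa0.
have := mulmxDr W (mlg a0) (mlg a0) => /(congr1 (@rtr _ S _)).
rewrite rtrD -/L0 => L2.
have L3 : q * s1 / 2 * (L0 + L0) = q * s1 * L0 by field.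
rewrite L2 L3 -/G1 in P0.
have P1 a b (aa : admissible N sigma eta m a) (ab : admissible N sigma eta m b) :
    let ab := rtr (W *m (mlg a + mlg b)) in
    ab <= 2 * L0 + 2 * (Q * eta) /\
    `|Phi (p t / 2) (s t) (Zt t) a b - Q - t * (h1 - q * s1 / 2 * ab)| <= eps / 2 * `|t|.
  split; first exact: admissible_log_le aa ab.
  by apply: h_1 => //; [case: aa|case: ab].
(* The norm changes form at p(t) = q: supremum with 1/r = -s(t) for t < 0, infimum with 1/r = s(t)
   for t > 0. In both branches a_0 gives one bound and all competitors together the other. *)
have [t0|t0|t0] := ltgtP t 0.
- have pq : p t < q by rewrite -p0; apply: inc => //; rewrite normr0.
  have st : 0 < - s t by rewrite oppr_gt0 subr_lt0 ltf_pV2 ?posrE.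
  have sE : (p t)^-1 - q^-1 = - s t by rewrite /s opprB.
  have qp : (q <= p t) = false by apply/negbTE; rewrite -ltNge.
  rewrite /v /amlg qp /amsup sE.
  have [A [B [NA NB A0 B0 hAB]]] := sup_attained ce st pt Na0 pa0 ra0 pYt.
  set T := [set x | _].
  have Tx : T (wnrm sigma (p t)^-1 (A *m Y t *m B) / (wnrm sigma (- s t / 2) A * wnrm sigma (- s t / 2) B)).
    by exists A, B.
  have hT x : T x -> 0 <= x /\ x `^ p t <= Q + t * G1 - eps * t.
    move=> [A' [B' [NA' NB' A'0 B'0 ->]]]; split.
      by rewrite divr_ge0 ?mulr_ge0 ?wnrm_ge0.
    have [a [b [aa ab le1]]] := sup_elem ce st pt eta0 m0 hm NA' NB' A'0 B'0 pYt.
    rewrite opprK in le1; apply: le_trans le1 _.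
    have [/= f1 f2] := P1 a b aa ab.
    exact: (expand_upper t0 (log_slack qs0 Keta f1) f2).
  have [i0 i1 i2] := sup_powR pt Tx hT.
  split=> //; rewrite hAB opprK -/(Zt t) in i2.
  exact: (sandwich_neg t0 P0 i2 i1).
- have pq : q < p t by rewrite -p0; apply: inc => //; rewrite normr0.
  have st : 0 < s t by rewrite subr_gt0 ltf_pV2 ?posrE.
  rewrite /v /amlg (ltW pq) /aminf -/(s t).
  have [A [B [X [NA NB XE hAB]]]] := inf_attained ce st pt Na0 pa0 ra0 pYt.
  set T := [set x | _].
  have Tx : T (wnrm sigma (s t / 2) A * wnrm sigma (s t / 2) B * wnrm sigma (p t)^-1 X).
    by exists A, B, X.
  have hT x : T x -> 0 <= x /\ Q + t * G1 - eps * t <= x `^ p t.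
    move=> [A' [B' [X' [NA' NB' XE' ->]]]]; split.
      by rewrite !mulr_ge0 ?wnrm_ge0.
    have pX' : pdm (A' *m X' *m B') by rewrite -XE'.
    have [a [b [aa ab le1]]] := inf_elem ce st pt eta0 m0 hm NA' NB' pX'.
    apply: le_trans le1; rewrite -XE'.
    have [/= f1 f2] := P1 a b aa ab.
    exact: (expand_lower t0 (log_slack qs0 Keta f1) f2).
  have [i0 i1 i2] := inf_powR pt Tx hT.
  split=> //; rewrite hAB -/(Zt t) in i2.
  exact: (sandwich_pos t0 P0 i2 i1).
have vE : v t = Q `^ q^-1.
  by rewrite /v t0 p0 /amlg lexx (aminf_diag ce) // wnrm_diag.
split=> //; rewrite vE ?powR_ge0 // t0 p0 powR_root_inv ?gt_eqF ?(ltW Q0) //.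
by rewrite subrr mul0r subr0 normr0 mulr0.
Qed.

(** The ln Q from normalising a_0 cancels the one from taking the root, and ln W = q ln Z restores
    the entropy. With p1 multiplied in, the formula covers p1 = 0. *)
Lemma amlg_derive : is_derive (0 : R) (1 : R) v
  ((p1 * entq E sigma q (Y 0) + q * rtr (V *m Gam sigma q^-1 Y1))
   / (q * (wnrm sigma q^-1 (Y 0)) `^ (q - 1))).
Proof.
have v0 : v 0 `^ p 0 = Q.
  rewrite /v p0 /amlg lexx (aminf_diag ce) // wnrm_diag powR_root_inv ?gt_eqF //.
  exact: ltW.
rewrite p0 in v0.
have := derive_of_powR_expand Q0 p0 dpi v0 amlg_expand.
set D := _ * _; set D' := _ / _.
have -> : D = D'.
  have -> : D' = Q `^ q^-1 * (p1 * entq E sigma q (Y 0) + q * rtr (V *m Gam sigma q^-1 Y1)) / (q * Q).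
    rewrite /D' wnrm_diag -powRrM mulrBr mulVf ?gt_eqF // mulr1.
    have -> : Q `^ (1 - q^-1) = Q / Q `^ q^-1.
      by rewrite powRD ?(gt_eqF Q0) ?implybT // powRr1 ?(ltW Q0) // powRN.
    have : 0 < Q `^ q^-1 by rewrite powR_gt0.
    move: (Q `^ q^-1) (_ + _) (lt0r_neq0 Q0) (lt0r_neq0 q0) => w x Qn qn /lt0r_neq0 wn.
    by field; rewrite Qn qn wn.
  rewrite /D /entq -/Z -/W -[E _]/(cdens E sigma W).
  have -> : mlg W = rc S q *: mlg Z.
    rewrite /W /mpw /mlg mfn_comp mfnZ; apply: mfn_ext => i /=.
    by rewrite ln_powR.
  rewrite !mulmxBr !rtrB -scalemxAr rtrZ.
  have LE : L0 = rtr (W *m mlg (cdens E sigma W)) - Q * ln Q.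
    rewrite /L0 /a0 /ndens mlgZ ?invr_gt0 //; last exact: (cdens_pd ce).
    rewrite mulmxDr rtrD -scalemxAr rtrZ mulmx1 -/Q lnV ?posrE //; ring.
  rewrite /G1 LE /h1 /s1; move: (rtr (W *m mlg Z)) (rtr (W *m mlg sigma)).
  move: (rtr (V *m _)) (rtr (W *m _)) (ln Q) (Q `^ q^-1) (lt0r_neq0 Q0) (lt0r_neq0 q0).
  move: Q => x0 x1 x2 x3 x4 Qn qn x5 x6.
  by field; rewrite Qn qn.
by [].
Qed.

End MainExpansion.

(** * Decohering semigroups and the complex field *)
Section Semigroup.
Variable R : realType.
Variable S : cplx R.
Local Notation C := (ck S).

Lemma mN_entries k (A : 'M[C]_k) (d : R) :
  (forall i j, `|re S (A i j)| <= d /\ `|im S (A i j)| <= d) ->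
  mN A <= 2 * (k * k)%:R * d.
Proof.
move=> h; apply: (@le_trans _ _ (\sum_(i < k) \sum_(j < k) (2 * d))).
  apply: ler_sum => i _; apply: ler_sum => j _.
  by have [] := h i j; rewrite /cN; lra.
by rewrite sumr_const sumr_const !card_ord -mulrnA -[leLHS]mulr_natr mulrAC.
Qed.

(** Turns complete positivity at m = 1, stated on block matrices, into plain positivity. *)
Lemma psd_mxblock1 k (X : 'M[C]_k) :
  psdm (\mxblock_(i < 1, j < 1) X) <-> psdm X.
Proof.
have trE (Y : 'M[C]_k) : adjm (\mxblock_(i < 1, j < 1) Y) = \mxblock_(i < 1, j < 1) adjm Y.
  by apply/matrixP => i j; rewrite !mxE.
have rowE (u : 'rV[C]_k) : adjm (\mxrow_(j < 1) u) = \mxcol_(j < 1) adjm u.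
  by apply/matrixP => i j; rewrite !mxE.
have formE (u : 'rV[C]_k) : \mxrow_(j < 1) u *m \mxblock_(i < 1, j < 1) X
    *m adjm (\mxrow_(j < 1) u) = u *m X *m adjm u.
  by rewrite rowE mul_mxrow_mxblock mul_mxrow_mxcol !big_ord1.
split=> [[h f]|[h f]]; split.
- move: h; rewrite /hermm trE => /mxblockP/(_ 0 0).
  by rewrite !mxblockK.
- by move=> u; rewrite -formE.
- by rewrite /hermm trE h.
move=> v; have -> : v = \mxrow_(j < 1) submxrow v 0.
  by rewrite -[LHS]submxrowK; apply/mxrowP => j; rewrite !mxrowK ord1.
by rewrite formE.
Qed.

Lemma psd_tr_ge0 k (A : 'M[C]_k) : psdm A -> 0 <= \tr A.
Proof.
move=> [_ h]; rewrite /mxtrace sumr_ge0 // => i _.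
have := h (delta_mx 0 i); rewrite -rowE.
have -> : adjm (delta_mx (0 : 'I_1) i : 'rV[C]_k) = delta_mx i 0.
  by apply/matrixP => a b; rewrite !mxE andbC; case: (_ && _); rewrite ?rmorph1 ?rmorph0.
by rewrite -colE !mxE.
Qed.

Lemma psd_tr_eq0 k (A : 'M[C]_k) : psdm A -> \tr A = 0 -> A = 0.
Proof.
move=> pA t0; have hA := psdm_herm pA.
have : rtr A = 0 by rewrite /rtr t0 re0.
rewrite -(mfn_id hA) rtr_mfn => /eqP.
rewrite psumr_eq0 => [/allP h|i _]; last exact: psdm_eig.
have -> : mfn id A = mfn (fun=> 0) A.
  by apply: mfn_ext => i; apply/eqP/h/mem_index_enum.
by rewrite mfn_cst rc0 raddf0.
Qed.

Lemma tr_rank1 k (A : 'M[C]_k) (v : 'rV[C]_k) :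
  \tr (A *m (adjm v *m v)) = (v *m A *m adjm v) 0 0.
Proof. by rewrite mulmxA mxtrace_mulC mulmxA /mxtrace big_ord1. Qed.

Section DecoheringCondExp.
Variables (n : nat) (P : R -> 'M[C]_n -> 'M[C]_n) (E : 'M[C]_n -> 'M[C]_n).
Variables (rho sigma : 'M[C]_n).
Let N : set 'M[C]_n := [set X | forall t, 0 <= t ->
     P t (adjm X *m X) = adjm (P t X) *m P t X /\
     P t (X *m adjm X) = P t X *m adjm (P t X)].
Hypothesis P1 : forall t, 0 <= t -> P t 1%:M = 1%:M.
Hypothesis prho : pdm rho.
Hypothesis trho : \tr rho = 1.
Hypothesis irho : forall t X, 0 <= t -> \tr (rho *m P t X) = \tr (rho *m X).
Hypothesis lin : forall (c : C) (X Y : 'M[C]_n), E (c *: X + Y) = c *: E X + E Y.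
Hypothesis Ein : forall X, N (E X).
Hypothesis Eid : forall X, N X -> E X = X.
Hypothesis Emod : forall A B X, N A -> N B -> E (A *m X *m B) = A *m E X *m B.
Hypothesis pos : forall X, psdm X -> psdm (E X).
Hypothesis Elim : forall X i j,
  (re S (P x (X - E X) i j) @[x --> +oo] --> (0 : R)) /\
  (im S (P x (X - E X) i j) @[x --> +oo] --> (0 : R)).
Hypothesis Etr : forall X, \tr (sigma *m X) = \tr (E X) / n%:R.

Let n_gt0 : (0 < n)%N.
Proof.
rewrite lt0n; apply/eqP => n0; move: trho; rewrite /mxtrace big1 => [/eqP|i].
  by rewrite eq_sym oner_eq0.
by have := ltn_ord i; rewrite {2}n0.
Qed.

(* If E X = 0 then P t X -> 0, whereas the faithful state rho keeps tr (rho P_t X) constant. *)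
Lemma cond_exp_faithful X : E X = 0 -> rtr (rho *m X) = 0.
Proof.
move=> EX; apply/eqP; rewrite -normr_le0; apply/ler_addgt0Pr => e e0; rewrite add0r.
pose K := mN rho * (2 * (n * n)%:R) + 1.
have K0 : 0 < K by rewrite ltr_wpDl // mulr_ge0 ?mN_ge0.
pose d := e / K; have d0 : 0 < d by rewrite divr_gt0.
(* Finitely many entries, hence one time beyond which all are small. *)
have h : \forall x \near +oo, forall ij : 'I_n * 'I_n,
    `|re S (P x X ij.1 ij.2)| <= d /\ `|im S (P x X ij.1 ij.2)| <= d.
  apply: filter_forall => -[i j]; have := Elim X i j; rewrite EX subr0.
  move=> [/cvgrPdist_le/(_ d d0) a /cvgrPdist_le/(_ d d0) b].
  by near=> x; split; rewrite -normrN -sub0r /=; near: x.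
have [x [x0 hx]] : exists x : R, 0 <= x /\ forall ij : 'I_n * 'I_n,
    `|re S (P x X ij.1 ij.2)| <= d /\ `|im S (P x X ij.1 ij.2)| <= d.
  near (pinfty_nbhs R) => x; exists x; split; first by near: x; exact: nbhs_pinfty_ge.
  by near: x.
have -> : rtr (rho *m X) = rtr (rho *m P x X) by rewrite /rtr irho.
apply: le_trans (rtr_mN _) _; apply: le_trans (mNM _ _) _.
have := @mN_entries n (P x X) d (fun i j => hx (i, j)) => b.
apply: le_trans (ler_wpM2l (mN_ge0 _) b) _; rewrite mulrA.
rewrite -[leRHS](@divfK _ K) ?gt_eqF // -/d [leRHS]mulrC ler_wpM2r ?(ltW d0) //.
by rewrite lerDl.
Unshelve. all: by end_near. Qed.

Lemma decohering_cond_exp : cond_exp N E sigma.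
Proof.
have hs : hermm sigma.
  apply: mx_trace_inj => X.
  have -> : \tr (adjm sigma *m X) = (\tr (sigma *m adjm X))^*.
    rewrite mxtrace_mulC -[X in X *m adjm sigma]adjmK -adjmM /mxtrace rmorph_sum.
    by apply: eq_bigr => i _; rewrite !mxE.
  rewrite !Etr (pos_map_adj lin pos) rmorphM /= fmorphV rmorph_nat; congr (_ / _).
  by rewrite /mxtrace rmorph_sum; apply: eq_bigr => i _; rewrite !mxE; exact: conjCK.
split=> //.
  by move=> t t0; rewrite adjm1 mulmx1 P1 // adjm1 mulmx1.
(* Faithfulness of sigma: for the rank-one X built on v, a vanishing form forces tr (E X) = 0, so E
   X = 0, hence tr (rho X) has real part 0, against positive definiteness of rho. *)
split=> // v v0; rewrite -tr_rank1 Etr.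
have pX : psdm (adjm v *m v) := psd_adjMl v.
have pE := pos pX.
rewrite divr_gt0 ?ltr0n // lt_def psd_tr_ge0 // andbT.
apply/eqP => /(psd_tr_eq0 pE)/cond_exp_faithful; rewrite /rtr tr_rank1 => h.
have := prho.2 v v0; rewrite lt_def ck_ge0 => /and3P[/eqP z /eqP iz _].
by apply: z; apply: (@ck_inj R S); rewrite ?h ?iz ?re0 ?im0.
Qed.

End DecoheringCondExp.

Lemma udiff_entries n (Y : R -> 'M[C]_n) (Y1 : 'M[C]_n) :
  (forall i j, rdiff (fun t => re S (Y t i j)) (re S (Y 0 i j)) (re S (Y1 i j)) /\
               rdiff (fun t => im S (Y t i j)) (im S (Y 0 i j)) (im S (Y1 i j))) ->
  udiff [set: unit] (fun t _ => Y t) (fun=> Y 0) (fun=> Y1).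
Proof.
move=> h; split.
  exists (mN (Y 0) + mN Y1); first by rewrite addr_ge0 ?mN_ge0.
  by move=> _ _; split; rewrite ?lerDl ?lerDr mN_ge0.
move=> e e0; pose K : R := 2 * (n * n)%:R + 1.
have K0 : 0 < K by rewrite ltr_wpDl.
pose c := e / K; have c0 : 0 < c by rewrite divr_gt0.
have nb (g : R -> R) g0 g1 : rdiff g g0 g1 ->
    \forall t \near (0 : R), `|g t - g0 - t * g1| <= c * `|t|.
  move=> /(_ c c0) [d d0 hd]; exists d => //= t; rewrite /= sub0r normrN; exact: hd.
have : \forall t \near (0 : R), forall ij : 'I_n * 'I_n,
    `|re S ((Y t - Y 0 - rc S t *: Y1) ij.1 ij.2)| <= c * `|t| /\
    `|im S ((Y t - Y 0 - rc S t *: Y1) ij.1 ij.2)| <= c * `|t|.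
  apply: (@filter_forall R ('I_n * 'I_n)%type (fun ij t =>
    `|re S ((Y t - Y 0 - rc S t *: Y1) ij.1 ij.2)| <= c * `|t| /\
    `|im S ((Y t - Y 0 - rc S t *: Y1) ij.1 ij.2)| <= c * `|t|) (nbhs (0 : R))) => -[i j].
  have [/nb a /nb b] := h i j.
  near=> t; rewrite !mxE !reD !imD !reN !imN reM imM re_rc im_rc !mul0r subr0 addr0.
  by split; near: t.
move=> [d /= d0 hd]; exists d => // t _ td _.
have := @mN_entries n _ _ (fun i j => hd t _ (i, j)) => /=.
rewrite sub0r normrN => /(_ td) b; apply: le_trans b _.
rewrite mulrA ler_wpM2r // /c mulrCA ler_piMr ?(ltW e0) // ler_pdivrMr //.
by rewrite mul1r lerDl.
Unshelve. all: by end_near. Qed.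

End Semigroup.

(** * Instantiation at R[i] *)

Section Complex.
Variable R : realType.
Local Notation C := R[i].

Lemma complex_re_conj (z : C) : complex.Re z^* = complex.Re z.
Proof. by case: z. Qed.

Lemma complex_im_conj (z : C) : complex.Im z^* = - complex.Im z.
Proof. by case: z. Qed.

Lemma complex_ge0 (z : C) : (0 <= z) = (complex.Im z == 0) && (0 <= complex.Re z).
Proof. by rewrite lecE /= eq_sym. Qed.

Lemma complex_ext (x y : C) :
  complex.Re x = complex.Re y -> complex.Im x = complex.Im y -> x = y.
Proof. by case: x y => [a b] [c d] /= -> ->. Qed.

Lemma complex_reM (x y : C) :
  complex.Re (x * y) = complex.Re x * complex.Re y - complex.Im x * complex.Im y.
Proof. by case: x y => [a b] [c d]. Qed.

Lemma complex_imM (x y : C) :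
  complex.Im (x * y) = complex.Re x * complex.Im y + complex.Im x * complex.Re y.
Proof. by case: x y => [a b] [c d]. Qed.

Definition complex_cplx : cplx R :=
  @Cplx R C (real_complex R) (@complex.Re R) (@complex.Im R)
    (fun=> erefl) (fun=> erefl) (@raddfD _ _ (@complex.Re R)) (@raddfD _ _ (@complex.Im R))
    complex_reM complex_imM complex_re_conj complex_im_conj complex_ext complex_ge0.
Local Notation S := complex_cplx.

Lemma mfun_mfn k f (A : 'M[C]_k) : Defs.mfun f A = @mfn R S k f A.
Proof.
by rewrite /mfn (svalP (mfn_seal S)).
Qed.

Lemma mpow_mpw k r (A : 'M[C]_k) : mpow r A = @mpw R S k r A.
Proof. exact: mfun_mfn. Qed.

Lemma mlog_mlg k (A : 'M[C]_k) : mlog A = @mlg R S k A.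
Proof. exact: mfun_mfn. Qed.

Lemma Gammas_Gam k (sigma : 'M[C]_k) r X : Gammas sigma r X = @Gam R S k sigma r X.
Proof. by rewrite /Gammas mpow_mpw. Qed.

Lemma wnorm_inv_wnrm k : @wnorm_inv R k = @wnrm R S k.
Proof.
apply/funext => sigma; apply/funext => th; apply/funext => X.
by rewrite /wnorm_inv Gammas_Gam /schatten_inv /mabs !mpow_mpw.
Qed.

Lemma amalg_amlg k (N : set 'M[C]_k) sigma x y X :
  amalg N sigma x y X = @amlg R S k N sigma x y X.
Proof. by rewrite /amalg /amalg_inf /amalg_sup wnorm_inv_wnrm. Qed.

Lemma Ent_q_entq k E (sigma : 'M[C]_k) q Y : Ent_q E sigma q Y = @entq R S k E sigma q Y.
Proof. by rewrite /Ent_q Gammas_Gam !mpow_mpw !mlog_mlg. Qed.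

Lemma dfa_cond_exp n (P : R -> 'M[C]_n -> 'M[C]_n) E sigma :
  is_QMS P -> decohering P -> is_dfa_cond_exp P E -> is_sigma_Tr E sigma ->
  @cond_exp R S n (dfa P) E sigma.
Proof.
move=> [_ [P1 _]] [rho [prho trho irho]] [lin [Ein [Eid [cp [Emod Elim]]]]] Etr.
have pos X : @psdm R S n X -> @psdm R S n (E X).
  move=> /(psd_mxblock1 (S := S)) h; apply/(psd_mxblock1 (S := S)).
  exact: (cp 1%N (fun _ _ => X) h).
exact: (@decohering_cond_exp R S n P E rho sigma P1 prho trho irho lin Ein Eid
  Emod pos Elim Etr).
Qed.

Lemma C2_rdiff e (f : R -> R) : 0 < e -> C2_near e f -> rdiff f (f 0) (derive1 f 0).
Proof.
move=> e0 /(_ 0); rewrite normr0 => /(_ e0) [df _ _].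
by apply/rdiffP; rewrite derive1E; exact/derivableP.
Qed.

Lemma mderiv0_udiff n (Y : R -> 'M[C]_n) e : 0 < e ->
  (forall i j, C2_near e (fun t => complex.Re (Y t i j)) /\
               C2_near e (fun t => complex.Im (Y t i j))) ->
  udiff (S := S) [set: unit] (fun t _ => Y t) (fun=> Y 0) (fun=> mderiv0 Y).
Proof.
move=> e0 h; apply: udiff_entries => i j; have [/(C2_rdiff e0) a /(C2_rdiff e0) b] := h i j.
by rewrite [mderiv0 Y i j]mxE.
Qed.

End Complex.

Theorem theorem3p4 (R : realType) (n : nat)
  (P : R -> 'M[R[i]]_n -> 'M[R[i]]_n)
  (E : 'M[R[i]]_n -> 'M[R[i]]_n) (sigma : 'M[R[i]]_n)
  (p : R -> R) (q : R) (Y : R -> 'M[R[i]]_n) (e : R) :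
  is_QMS P -> decohering P ->
  is_dfa_cond_exp P E -> is_sigma_Tr E sigma ->
  0 < e ->
  C2_near e p ->
  (forall s t, `|s| < e -> `|t| < e -> s < t -> p s < p t) ->
  p 0 = q -> 1 <= q ->
  (forall i j, C2_near e (fun t => complex.Re (Y t i j)) /\
               C2_near e (fun t => complex.Im (Y t i j))) ->
  (forall t, `|t| < e -> mxpd (Y t)) ->
  is_derive (0 : R) (1 : R)
    (fun t => amalg (dfa P) sigma q (p t) (Y t))
    ((derive1 p 0 * Ent_q E sigma q (Y 0)
      + q * retr (mpow (q - 1) (Gammas sigma (q^-1) (Y 0))
                  *m Gammas sigma (q^-1) (mderiv0 Y)))
     / (q * (wnorm_inv sigma (q^-1) (Y 0)) `^ (q - 1))).
Proof.
move=> qms dec hE hs e0 Cp inc p0 q1 CY pY.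
have ce := dfa_cond_exp qms dec hE hs.
have dp : rdiff p q (derive1 p 0) by rewrite -[X in rdiff p X]p0; exact: C2_rdiff Cp.
have := amlg_derive ce e0 dp p0 q1 inc pY (mderiv0_udiff e0 CY).
have -> : (fun t => amalg (dfa P) sigma q (p t) (Y t)) =
  (fun t => @amlg R (complex_cplx R) n (dfa P) sigma q (p t) (Y t)).
  by apply/funext => t; exact: amalg_amlg.
rewrite Ent_q_entq wnorm_inv_wnrm mpow_mpw !Gammas_Gam.
exact: id.
Qed.
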